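(* Let $(\mathscr{E},\mathscr{F})$ be the regular, irreducible, strongly local Dirichlet form on $L^2(I,m)$ with scale function $\mathbf{s}\in\tilde{\mathbf{S}}(\mathring I)$ and effective interval $I_e$ described in the context, and let $\mathcal{H}$ be the space of harmonic functions. Then: (1) When $I_e=(l,r)$: $\mathcal{H}=\{0\}$ if $\mathbf{s}(l)>-\infty$ or $\mathbf{s}(r)<\infty$; otherwise $\mathcal{H}=\mathrm{span}\{1\}$. (2) When $I_e=[l,r)$: $\mathcal{H}=\mathrm{span}\{u^0_l\}$ if $\mathbf{s}(r)<\infty$; otherwise $\mathcal{H}=\mathrm{span}\{1\}$. (3) When $I_e=(l,r]$: $\mathcal{H}=\mathrm{span}\{u^0_r\}$ if $\mathbf{s}(l)>-\infty$; otherwise $\mathcal{H}=\mathrm{span}\{1\}$. (4) When $I_e=[l,r]$: $\mathcal{H}=\mathrm{span}\{u^0_l,u^0_r\}$.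
   Context: Setting. Let $I$ be an interval with endpoints $-\infty\le l<r\le\infty$, where each of $l,r$ may or may not belong to $I$; $\mathring I:=(l,r)$. Let $m$ be a positive Radon measure on $I$ with full topological support, and fix $e\in\mathring I$ with $m(\{e\})=0$. $\mathbf{S}(\mathring I)$ is the set of continuous strictly increasing functions $\mathbf{s}:\mathring I\to\mathbb{R}$ with $\mathbf{s}(e)=0$ (scale functions); $\mathbf{s}(l):=\lim_{x\downarrow l}\mathbf{s}(x)\ge-\infty$ and $\mathbf{s}(r):=\lim_{x\uparrow r}\mathbf{s}(x)\le\infty$. $\tilde{\mathbf{S}}(\mathring I)$ is the set of $\mathbf{s}\in\mathbf{S}(\mathring I)$ such that for $j=l$ or $r$: if $j\in I$ and $m(\{j\})>0$, then $|\mathbf{s}(j)|<\infty$. The measure $d\mathbf{s}$ is the Lebesgue–Stieltjes measure of $\mathbf{s}$. Integral convention: $\int_e^\xi f\,dm$ means $\int_{(e,\xi]}f\,dm$ for $\xi>e$ and $-\int_{(\xi,e]}f\,dm$ for $\xi<e$. Set $\sigma(x):=\int_e^x\int_e^\xi m(d\eta)\,d\mathbf{s}(\xi)$ and $\mu(x):=\int_e^x\int_e^\xi d\mathbf{s}(\eta)\,m(d\xi)$ for $x\in[l,r]$ (values at endpoints being limits from inside). For $j=l$ or $r$, $j$ is regular if $\sigma(j)<\infty$ and $\mu(j)<\infty$; it is absorbing if it is regular and $j\notin I$; it is reflecting if it is regular and $j\in I$. $f\ll d\mathbf{s}$ means $f=g\circ\mathbf{s}$ for a (locally) absolutely continuous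 function $g$ on the interval $\{\mathbf{s}(x):x\in I,\ |\mathbf{s}(x)|<\infty\}$, and then $df/d\mathbf{s}:=g'\circ\mathbf{s}$. Values $f(j)$ at endpoints where $f$ is not defined are limits from inside. Dirichlet form. For $\mathbf{s}\in\tilde{\mathbf{S}}(\mathring I)$, $(\mathscr{E},\mathscr{F})$ is $\mathscr{F}=\{f\in L^2(I,m): f\ll d\mathbf{s},\ df/d\mathbf{s}\in L^2(I,d\mathbf{s}),\ f(j)=0\text{ if } j\text{ is absorbing, for } j=l\text{ or }r\}$, $\mathscr{E}(f,g)=\frac12\int_I\frac{df}{d\mathbf{s}}\frac{dg}{d\mathbf{s}}\,d\mathbf{s}$. The effective interval $I_e$ is the interval with $\mathring I\subset I_e\subset I$ such that, for $j=l$ or $r$, $j\in I_e$ if and only if $j$ is reflecting. The set $I\setminus I_e$ is $m$-null and $\mathscr{E}$-polar, and functions are identified with their continuous versions on $I_e$. Harmonic functions. $\mathscr{F}_{\mathrm{e}}$ denotes the extended Dirichlet space of $(\mathscr{E},\mathscr{F})$ (the $m$-a.e. finite functions that are $m$-a.e. limits of $\mathscr{E}$-Cauchy sequences in $\mathscr{F}$, with $\mathscr{E}$ extended accordingly), $\mathscr{F}^0_{\mathrm{e}}:=\{f\in\mathscr{F}_{\mathrm{e}}: f=0\ \mathscr{E}\text{-q.e. on } I\setminus\mathring I\}$, and $\mathcal{H}:=\{u\in\mathscr{F}_{\mathrm{e}}:\mathscr{E}(u,f)=0\ \ \forall f\in\mathscr{F}^0_{\mathrm{e}}\}$. When $|\mathbf{s}(l)|+|\mathbf{s}(r)|<\infty$,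 set $u^0_l(x):=\frac{\mathbf{s}(r)-\mathbf{s}(x)}{\mathbf{s}(r)-\mathbf{s}(l)}$ and $u^0_r(x):=\frac{\mathbf{s}(x)-\mathbf{s}(l)}{\mathbf{s}(r)-\mathbf{s}(l)}$, extended to endpoints in $I_e$ by continuity. (If an endpoint $j$ belongs to $I_e$ then $|\mathbf{s}(j)|<\infty$.) *)

(* Defs.v *)
From HB Require Import structures.
From mathcomp Require Import all_boot all_order all_algebra.
From mathcomp Require Import all_classical all_reals all_analysis.
From mathcomp Require Import measurable_realfun.

Set Implicit Arguments.
Unset Strict Implicit.
Unset Printing Implicit Defensive.

Import Order.TTheory GRing.Theory Num.Theory.
Import numFieldNormedType.Exports.

Local Open Scope classical_set_scope.
Local Open Scope ring_scope.

(* The end-points of the state interval may be infinite and may nevertheless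
   belong to it, so the ambient space is \bar R: the interval is a set of
   extended reals, measures on it are Borel measures on \bar R that do not
   charge its complement, and functions on it are functions \bar R -> R of
   which only the values on the relevant interval matter. *)

Section OneDimensionalDiffusion.
Context {R : realType}.
Implicit Types (l r e j x : \bar R) (I A U : set (\bar R)).
Implicit Types (s f u v : \bar R -> R) (m ds : {measure set (\bar R) -> \bar R}).

Definition interval_with_endpoints l r I : Prop :=
  [/\ (l < r)%E, `]l, r[%classic `<=` I & I `<=` `[l, r]%classic].

(* Compact subsets of I having finite mass is the Radon property, as every
   such Borel measure on an interval is automatically regular. *)
Definition radon_full_support I m : Prop :=
  [/\ m (~` I) = 0%E,
      (forall K : set (\bar R), compact K -> K `<=` I -> (m K < +oo)%E)
    & (forall U, open U -> U `&` I !=set0 -> (0 < m (U `&` I))%E)].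

Definition inner l r j : set_system (\bar R) := within `]l, r[%classic (nbhs j).

Definition scale_function l r e s : Prop :=
  [/\ {within `]l, r[%classic, continuous s},
      {in `]l, r[ &, {homo s : x y / (x < y)%E >-> x < y}}
    & s e = 0].

(* The value of s at a point of [l, r], by limits from inside at l and r. *)
Definition scale_value l r s x : \bar R :=
  lim ((s y)%:E @[y --> inner l r x]).

Definition scale_tilde l r I e m s : Prop :=
  scale_function l r e s /\
  (forall j, j = l \/ j = r -> I j -> (0 < m [set j])%E ->
    scale_value l r s j \is a fin_num).

Definition is_scale_measure l r s ds : Prop :=
  ds (~` `]l, r[%classic) = 0%E /\
  (forall a b : \bar R, (l < a)%E -> (a <= b)%E -> (b < r)%E ->
    ds `]a, b]%classic = (s b - s a)%:E).

Definition oriented_integral (mu : {measure set (\bar R) -> \bar R}) e x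
    (F : \bar R -> \bar R) : \bar R :=
  if (e <= x)%E then (\int[mu]_(y in `]e, x]%classic) F y)%E
  else (- \int[mu]_(y in `]x, e]%classic) F y)%E.

Definition feller_sigma m ds e x : \bar R :=
  oriented_integral ds e x (fun xi => oriented_integral m e xi (cst 1%E)).

Definition feller_mu m ds e x : \bar R :=
  oriented_integral m e x (fun xi => oriented_integral ds e xi (cst 1%E)).

Definition regular_endpoint l r m ds e j : Prop :=
  (lim (feller_sigma m ds e x @[x --> inner l r j]) < +oo)%E /\
  (lim (feller_mu m ds e x @[x --> inner l r j]) < +oo)%E.

Definition absorbing l r I m ds e j : Prop :=
  regular_endpoint l r m ds e j /\ ~ I j.

Definition reflecting l r I m ds e j : Prop :=
  regular_endpoint l r m ds e j /\ I j.

Definition effective_interval l r I m ds e : set (\bar R) :=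
  `]l, r[%classic `|` [set j | (j = l \/ j = r) /\ reflecting l r I m ds e j].

Definition abs_continuous_on (g : R -> R) (a b : R) : Prop :=
  forall eps : R, 0 < eps -> exists2 delta : R, 0 < delta &
  forall (n : nat) (p q : 'I_n -> R),
    (forall i, [/\ a <= p i, p i <= q i & q i <= b]) ->
    (forall i k, i != k -> q i <= p k \/ q k <= p i) ->
    \sum_(i < n) (q i - p i) < delta ->
    \sum_(i < n) `|g (q i) - g (p i)| < eps.

Definition locally_abs_continuous (J : set R) (g : R -> R) : Prop :=
  forall a b : R, a <= b -> `[a, b]%classic `<=` J -> abs_continuous_on g a b.

Definition scale_range l r I s : set R :=
  [set fine (scale_value l r s x) | x in
     [set x | I x /\ scale_value l r s x \is a fin_num]].

Definition factors_through_scale l r I s f (g : R -> R) : Prop :=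
  locally_abs_continuous (scale_range l r I s) g /\
  (forall x, I x -> scale_value l r s x \is a fin_num ->
    f x = g (fine (scale_value l r s x))).

Definition scale_abs_continuous l r I s f : Prop :=
  exists g : R -> R, factors_through_scale l r I s f g.

(* df/ds := g' o s with f = g o s; g is determined by f on the scale range,
   hence g' is determined in its interior. *)
Definition scale_factor l r I s f : R -> R :=
  get [set g : R -> R | factors_through_scale l r I s f g].

Definition scale_derivative l r I s f x : R :=
  derive1 (scale_factor l r I s f) (fine (scale_value l r s x)).

Definition square_integrable (mu : {measure set (\bar R) -> \bar R}) I f : Prop :=
  measurable_fun I f /\ (\int[mu]_(x in I) ((f x) ^+ 2)%:E < +oo)%E.

Definition dirichlet_domain l r I m s ds e : set (\bar R -> R) :=
  [set f | [/\ square_integrable m I f,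
               scale_abs_continuous l r I s f,
               square_integrable ds I (scale_derivative l r I s f)
             & forall j, j = l \/ j = r -> absorbing l r I m ds e j ->
                 f x @[x --> inner l r j] --> (0 : R)]].

Definition dirichlet_form l r I s ds f u : R :=
  2^-1 * \int[ds]_(x in I)
    (scale_derivative l r I s f x * scale_derivative l r I s u x).

Definition approximating l r I m s ds e u (f_ : nat -> \bar R -> R) : Prop :=
  [/\ (forall n, dirichlet_domain l r I m s ds e (f_ n)),
      (forall eps : R, 0 < eps -> exists N : nat, forall n k : nat,
         (N <= n)%N -> (N <= k)%N ->
         dirichlet_form l r I s ds (f_ n \- f_ k) (f_ n \- f_ k) < eps)
    & {ae m, forall x, I x -> f_ n x @[n --> \oo] --> u x}].

Definition extended_domain l r I m s ds e : set (\bar R -> R) :=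
  [set u | exists f_ : nat -> \bar R -> R, approximating l r I m s ds e u f_].

(* The limit does not depend on the approximating sequences. *)
Definition extended_form l r I m s ds e u v : R :=
  get [set a : R | exists f_ g_ : nat -> \bar R -> R,
    [/\ approximating l r I m s ds e u f_,
        approximating l r I m s ds e v g_
      & dirichlet_form l r I s ds (f_ n) (g_ n) @[n --> \oo] --> a]].

Definition energy1 l r I m s ds f : R :=
  dirichlet_form l r I s ds f f + \int[m]_(x in I) (f x ^+ 2).

Definition capacity_open l r I m s ds e U : \bar R :=
  ereal_inf [set (energy1 l r I m s ds f)%:E | f in
    [set f | dirichlet_domain l r I m s ds e f /\
             {ae m, forall x, (U `&` I) x -> 1 <= f x}]].

(* The relatively open subsets of I are the traces on I of open sets. *)
Definition capacity l r I m s ds e A : \bar R :=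
  ereal_inf [set capacity_open l r I m s ds e U | U in
    [set U | open U /\ A `<=` U]].

(* u = 0 quasi-everywhere on A, for the version of u continuous on the
   effective interval; its values off that interval are irrelevant, as the
   points of I outside of it form a polar set. *)
Definition zero_qe l r I m s ds e A u : Prop :=
  exists2 v : \bar R -> R,
    {within effective_interval l r I m ds e, continuous v} /\
    ae_eq m I u v
  & capacity l r I m s ds e (A `&` [set x | v x != 0]) = 0%E.

Definition extended_domain0 l r I m s ds e : set (\bar R -> R) :=
  [set u | extended_domain l r I m s ds e u /\
           zero_qe l r I m s ds e (I `\` `]l, r[%classic) u].

Definition harmonic_space l r I m s ds e : set (\bar R -> R) :=
  [set u | extended_domain l r I m s ds e u /\
           (forall f, extended_domain0 l r I m s ds e f ->
              extended_form l r I m s ds e u f = 0)].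

(* Functions are m-classes on I: the span consists of all the functions that
   are m-a.e. equal on I to a linear combination of the given ones. *)
Definition span1 I m u : set (\bar R -> R) :=
  [set f | exists c : R, ae_eq m I f (fun x => c * u x)].

Definition span2 I m u v : set (\bar R -> R) :=
  [set f | exists c d : R, ae_eq m I f (fun x => c * u x + d * v x)].

Definition harmonic_left l r s x : R :=
  (fine (scale_value l r s r) - fine (scale_value l r s x)) /
  (fine (scale_value l r s r) - fine (scale_value l r s l)).

Definition harmonic_right l r s x : R :=
  (fine (scale_value l r s x) - fine (scale_value l r s l)) /
  (fine (scale_value l r s r) - fine (scale_value l r s l)).

End OneDimensionalDiffusion.

(* Main.v *)
Require Import Defs.
From HB Require Import structures.
From mathcomp Require Import all_boot all_order all_algebra.
From mathcomp Require Import all_classical all_reals all_analysis.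
From mathcomp Require Import measurable_realfun.
From mathcomp Require Import ring lra.

Set Implicit Arguments.
Unset Strict Implicit.
Unset Printing Implicit Defensive.

Import Order.TTheory GRing.Theory Num.Theory.
Import numFieldNormedType.Exports.
Import HBNNSimple.

Local Open Scope classical_set_scope.
Local Open Scope ring_scope.

(** In the variable [t = s x] the form is half the integral of the product of
   the derivatives with respect to Lebesgue measure, so that a function of zero
   energy against all tents supported inside the scale range must be affine in
   the scale. Conversely, for [u = c s + d] with both scale values finite,
   the energy of [u] and [f] is half of [c] times the difference of the boundary
   values of [f]; these vanish for every [f] in the test space, at an included
   end because points of finite scale have positive capacity, and at an omitted
   one because of the boundary conditions. The harmonic functions are therefore
   exactly the affine functions of the scale that belong to the extended space
   ([harmonic_spaceP]), and it remains to see which ones do.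

   - Elements of the extended space satisfy a Hoelder bound of exponent 1/2 in
     the scale, so an affine one is constant unless both scale values are finite.
   - They vanish at the ends that the scale reaches and the interval omits:
     such an end is absorbing, or else [m] is infinite near it and square
     integrability has the same effect ([domain_zero_end]).
   - The affine functions left over are limits of truncations
     ([extended_domain_cst], [extended_domain_affine]).

   An included end is reflecting precisely when its scale value is finite
   ([reflectingP]), so the effective interval tells which ends impose a
   condition, and the four cases follow by linear algebra.

   Three analytic facts carry the reduction to the scale variable: an absolutely
   continuous function is the integral of its derivative ([abs_continuous_FTC]),
   the scale maps [ds] to Lebesgue measure ([scale_integral]), and square
   integrable derivatives form a complete space ([L2_complete]). Together they
   give every element of the extended space a continuous version together with
   a derivative, from which the extended form is computed ([extended_versionP],
   [extended_formE]). *)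

(** * Square integrable functions *)
Section square_integrable_functions.
Context d (T : measurableType d) (R : realType).
Variables (mu : {measure set T -> \bar R}) (D : set T).
Hypothesis mD : measurable D.
Implicit Types p q : T -> R.

Definition L2fun p :=
  measurable_fun D p /\ (\int[mu]_(x in D) ((p x) ^+ 2)%:E < +oo)%E.

Definition inner_product p q : R := \int[mu]_(x in D) (p x * q x).

Local Notation "<< p , q >>" := (inner_product p q).

(** Nonnegative integrals are suprema over simple functions, so a null set can
   be cut out of the competitors whether or not the integrands are measurable. *)
Lemma ge0_ae_le_integral_nomeas (f g : T -> \bar R) :
  (forall x, D x -> 0 <= f x)%E -> (forall x, D x -> 0 <= g x)%E ->
  {ae mu, forall x, D x -> (f x <= g x)%E} ->
  (\int[mu]_(x in D) f x <= \int[mu]_(x in D) g x)%E.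
Proof.
move=> f0 g0 [N [mN N0 fgN]].
rewrite (ge0_integralE _ f0) (ge0_integralE _ g0).
apply: ge_ereal_sup => _ [h /= hf <-].
pose k := proj_nnsfun h (measurableC mN).
have -> : sintegral mu h = sintegral mu k.
  have sT (u : {nnsfun T >-> R}) : sintegral mu u = (\int[mu]_x (u x)%:E)%E.
    by rewrite integral_nnsfun// patch_setT.
  rewrite !sT; apply: ae_eq_integral => //.
  - exact/measurable_EFinP.
  - exact/measurable_EFinP.
  exists N; split => // x /= xk; apply: contrapT => xN; apply: xk => _.
  by rewrite /= mindicE mem_set// mulr1.
apply: ereal_sup_ubound; exists k => //= x.
rewrite mindicE; have [xN|xN] := boolP (x \in ~` N); last first.
  by rewrite mulr0 /patch; case: ifPn => // /set_mem; exact: g0.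
rewrite mulr1; apply: le_trans (hf x) _.
rewrite /patch; case: ifPn => // /set_mem Dx.
by apply: contrapT => fgx; move/set_mem: xN; apply; apply: fgN => /(_ Dx).
Qed.

Lemma ge0_ae_eq_integral_nomeas (f g : T -> \bar R) :
  (forall x, D x -> 0 <= f x)%E -> (forall x, D x -> 0 <= g x)%E ->
  ae_eq mu D f g -> (\int[mu]_(x in D) f x = \int[mu]_(x in D) g x)%E.
Proof.
move=> f0 g0 fg; apply/eqP; rewrite eq_le !ge0_ae_le_integral_nomeas//.
  by apply: filterS fg => x /[apply] ->.
by apply: filterS fg => x /[apply] ->.
Qed.

Lemma ge0_le_integral_nomeas (f g : T -> \bar R) :
  (forall x, D x -> 0 <= f x)%E -> (forall x, D x -> f x <= g x)%E ->
  (\int[mu]_(x in D) f x <= \int[mu]_(x in D) g x)%E.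
Proof.
move=> f0 fg; apply: ge0_ae_le_integral_nomeas => //.
  by move=> x Dx; exact: le_trans (f0 _ Dx) (fg _ Dx).
exact: aeW.
Qed.

Lemma L2fun_sqr_integrable p : L2fun p ->
  mu.-integrable D (EFin \o (fun x => p x ^+ 2)).
Proof.
move=> [mp ip]; apply/integrableP; split.
  by apply/measurable_EFinP; exact: measurable_funX.
by under eq_integral => x _ do rewrite /= ger0_norm ?sqr_ge0//.
Qed.

Lemma L2fun_mul_integrable p q : L2fun p -> L2fun q ->
  mu.-integrable D (EFin \o (fun x => p x * q x)).
Proof.
move=> hp hq.
apply: (le_integrable mD) (integrableD mD (L2fun_sqr_integrable hp) (L2fun_sqr_integrable hq)).
  apply/measurable_EFinP; apply: measurable_funM; [exact: hp.1|exact: hq.1].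
move=> x _ /=; rewrite lee_fin [leRHS]ger0_norm ?addr_ge0 ?sqr_ge0//.
rewrite ler_norml; nra.
Qed.

Lemma L2fun_le p (f : T -> R) : measurable_fun D p ->
  mu.-integrable D (EFin \o f) -> (forall x, D x -> p x ^+ 2 <= f x) -> L2fun p.
Proof.
move=> mp intf pf; split=> //; apply: le_lt_trans (integrable_lty mD intf).
apply: le_integral => //; last by move=> x /set_mem Dx; rewrite lee_fin pf.
apply: (le_integrable mD _ _ intf).
  by apply/measurable_EFinP; exact: measurable_funX.
move=> x Dx /=; rewrite lee_fin ger0_norm ?sqr_ge0//.
exact: le_trans (pf _ Dx) (ler_norm _).
Qed.

Lemma L2funD p q : L2fun p -> L2fun q -> L2fun (fun x => p x + q x).
Proof.
move=> hp hq.
have ip := L2fun_sqr_integrable hp; have iq := L2fun_sqr_integrable hq.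
apply: (@L2fun_le _ (fun x => (2 * p x ^+ 2) + (2 * q x ^+ 2))).
- by apply: measurable_funD; [exact: hp.1|exact: hq.1].
- apply: (eq_integrable mD) (integrableD mD (integrableZl mD 2 ip) (integrableZl mD 2 iq)).
  by move=> x _ /=; rewrite EFinD !EFinM.
- by move=> x _; have := sqr_ge0 (p x - q x); nra.
Qed.

Lemma L2funZ (c : R) p : L2fun p -> L2fun (fun x => c * p x).
Proof.
move=> hp; have ip := L2fun_sqr_integrable hp.
apply: (@L2fun_le _ (fun x => c ^+ 2 * p x ^+ 2)).
- by apply: measurable_funM; [exact: measurable_cst|exact: hp.1].
- by apply: (eq_integrable mD) (integrableZl mD (c ^+ 2) ip) => x _ /=; rewrite EFinM.
- by move=> x _; rewrite exprMn.
Qed.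

Lemma L2funB p q : L2fun p -> L2fun q -> L2fun (fun x => p x - q x).
Proof.
move=> hp /(L2funZ (-1)) hq; have := L2funD hp hq.
by under [fun x => p x + _]eq_fun do rewrite mulN1r.
Qed.

Lemma inner_productC p q : <<p, q>> = <<q, p>>.
Proof. by apply: eq_Rintegral => x _; rewrite mulrC. Qed.

Lemma inner_productDl p p' q : L2fun p -> L2fun p' -> L2fun q ->
  <<fun x => p x + p' x, q>> = <<p, q>> + <<p', q>>.
Proof.
move=> hp hp' hq; rewrite /inner_product -RintegralD//; last 2 first.
- exact: L2fun_mul_integrable.
- exact: L2fun_mul_integrable.
by apply: eq_Rintegral => x _; rewrite mulrDl.
Qed.

Lemma inner_productZl c p q : L2fun p -> L2fun q ->
  <<fun x => c * p x, q>> = c * <<p, q>>.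
Proof.
move=> hp hq; rewrite /inner_product -RintegralZl//; last exact: L2fun_mul_integrable.
by apply: eq_Rintegral => x _; rewrite mulrA.
Qed.

Lemma inner_productBl p p' q : L2fun p -> L2fun p' -> L2fun q ->
  <<fun x => p x - p' x, q>> = <<p, q>> - <<p', q>>.
Proof.
move=> hp hp' hq; rewrite /inner_product -RintegralB//; last 2 first.
- exact: L2fun_mul_integrable.
- exact: L2fun_mul_integrable.
by apply: eq_Rintegral => x _; rewrite mulrBl.
Qed.

Lemma inner_product_ge0 p : 0 <= <<p, p>>.
Proof. by apply: Rintegral_ge0 => x _; rewrite -expr2 sqr_ge0. Qed.

Lemma inner_product_EFin p : L2fun p ->
  (<<p, p>>%:E = \int[mu]_(x in D) ((p x) ^+ 2)%:E)%E.
Proof.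
move=> hp; rewrite fineK; last exact: (integrable_fin_num mD (L2fun_mul_integrable hp hp)).
by under eq_integral do rewrite -expr2.
Qed.

Lemma inner_productDD p q : L2fun p -> L2fun q ->
  <<fun x => p x + q x, fun x => p x + q x>> = <<p, p>> + 2 * <<p, q>> + <<q, q>>.
Proof.
move=> hp hq; have hpq := L2funD hp hq; rewrite inner_productDl//.
rewrite (inner_productC p) inner_productDl// (inner_productC q (fun x => p x + q x)).
rewrite inner_productDl// (inner_productC q p); lra.
Qed.

(** The quadratic [<<p + c q, p + c q>>] in [c] is nonnegative, so its discriminant
   is not positive. *)
Lemma cauchy_schwarz_L2 p q : L2fun p -> L2fun q ->
  <<p, q>> ^+ 2 <= <<p, p>> * <<q, q>>.
Proof.
move=> hp hq.
have H c : 0 <= <<p, p>> + 2 * (c * <<p, q>>) + c ^+ 2 * <<q, q>>.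
  have := inner_product_ge0 (fun x => p x + c * q x).
  rewrite inner_productDD//; last exact: L2funZ.
  rewrite (inner_productC p (fun x => c * q x)) (inner_productZl c hq hp).
  rewrite (inner_productZl c hq (L2funZ c hq)).
  rewrite (inner_productC q p) (inner_productC q (fun x => c * q x)) inner_productZl//.
  by rewrite expr2 -(mulrA c c).
have := inner_product_ge0 q; rewrite le_eqVlt => /predU1P[q0|q0].
  rewrite -q0 mulr0; suff -> : <<p, q>> = 0 by rewrite expr2 mul0r.
  apply: contrapT => /eqP pq0.
  have := H (- (<<p, p>> + 1) / (2 * <<p, q>>)).
  rewrite -q0 mulr0 addr0; have -> : - (<<p, p>> + 1) / (2 * <<p, q>>) * <<p, q>> = - (<<p, p>> + 1) / 2.
    by field.
  by move=> h; lra.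
have := H (- <<p, q>> / <<q, q>>).
rewrite -(ler_pM2r q0) mul0r => h; rewrite -subr_ge0; apply: le_trans h _.
rewrite le_eqVlt; apply/orP; left; apply/eqP.
by field; rewrite ?gt_eqF.
Qed.

End square_integrable_functions.

(** * Convergence in the quadratic mean *)
Section square_integrable_convergence.
Context d (T : measurableType d) (R : realType).
Variables (mu : {measure set T -> \bar R}) (D : set T).
Hypothesis mD : measurable D.
Implicit Types p q : T -> R.

Local Notation "<< p , q >>" := (inner_product mu D p q).
Local Notation L2 := (L2fun mu D).

Definition cvgL2 (p_ : nat -> T -> R) p :=
  <<fun x => p_ n x - p x, fun x => p_ n x - p x>> @[n --> \oo] --> (0 : R).

Lemma inner_product_sub_le p q r : L2 p -> L2 q -> L2 r ->
  <<fun x => p x - r x, fun x => p x - r x>> <=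
  2 * <<fun x => p x - q x, fun x => p x - q x>> +
  2 * <<fun x => q x - r x, fun x => q x - r x>>.
Proof.
move=> hp hq hr; have h1 := L2funB mD hp hq; have h2 := L2funB mD hq hr.
have -> : (fun x => p x - r x) = (fun x => (p x - q x) + (q x - r x)).
  by apply/funext => x; lra.
rewrite inner_productDD//.
have := inner_product_ge0 mu D (fun x => (p x - q x) - (q x - r x)).
have h3 := L2funZ mD (-1) h2.
have -> : (fun x => p x - q x - (q x - r x)) = (fun x => (p x - q x) + (-1) * (q x - r x)).
  by apply/funext => x; lra.
rewrite inner_productDD// (inner_productC _ _ (fun x => p x - q x) (fun x => -1 * _)).
rewrite (inner_productZl mD (-1) h2 h1) (inner_productZl mD (-1) h2 h3).
rewrite (inner_productC _ _ (fun x => q x - r x) (fun x => -1 * _)).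
rewrite (inner_productZl mD (-1) h2 h2).
rewrite (inner_productC _ _ (fun x => q x - r x) (fun x => p x - q x)).
by move=> h; lra.
Qed.

Lemma sqr_le_cvg0 (a b : nat -> R) : (forall n, a n ^+ 2 <= b n) ->
  b n @[n --> \oo] --> (0 : R) -> a n @[n --> \oo] --> (0 : R).
Proof.
move=> ab b0; apply/cvgr0Pnorm_lt => e e0.
have e2 : 0 < e ^+ 2 by rewrite exprn_gt0.
move/cvgr0Pnorm_lt : b0 => /(_ _ e2); apply: filterS => n bn.
rewrite -(@ltr_pXn2r _ 2)// ?nnegrE ?normr_ge0 ?(ltW e0)//.
rewrite real_normK ?num_real//; apply: le_lt_trans (ab n) _.
exact: le_lt_trans (ler_norm _) bn.
Qed.

Lemma cvgL2_inner_product (p_ q_ : nat -> T -> R) p q :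
  (forall n, L2 (p_ n)) -> L2 p -> (forall n, L2 (q_ n)) -> L2 q ->
  cvgL2 p_ p -> cvgL2 q_ q ->
  <<p_ n, q_ n>> @[n --> \oo] --> <<p, q>>.
Proof.
move=> hp_ hp hq_ hq pp qq.
have dp n := L2funB mD (hp_ n) hp; have dq n := L2funB mD (hq_ n) hq.
have -> : (fun n => <<p_ n, q_ n>>) =
   (fun n => <<fun x => p_ n x - p x, fun x => q_ n x - q x>> + <<fun x => p_ n x - p x, q>>
     + <<fun x => q_ n x - q x, p>> + <<p, q>>).
  apply/funext => n; rewrite [X in _ + X + _](inner_productBl mD)//.
  rewrite [X in X + _ + _ + _](inner_productBl mD)//.
  rewrite [X in _ + X + _ + _](inner_productBl mD)//.
  rewrite (inner_productC _ _ (p_ n) (fun x => _ - _)) (inner_productBl mD)//.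
  rewrite (inner_productC _ _ p (fun x => _ - _)) (inner_productBl mD)//.
  rewrite (inner_productC _ _ q p) (inner_productC _ _ q (p_ n)) (inner_productC _ _ (p_ n)).
  lra.
rewrite -[X in _ --> X]add0r; apply: cvgD; last exact: cvg_cst.
rewrite -[X in _ --> X]addr0; apply: cvgD; last first.
  apply: sqr_le_cvg0 (fun n => cauchy_schwarz_L2 mD (dq n) hp) _.
  by rewrite -(mul0r <<p, p>>); apply: cvgM => //; exact: cvg_cst.
rewrite -[X in _ --> X]addr0; apply: cvgD; last first.
  apply: sqr_le_cvg0 (fun n => cauchy_schwarz_L2 mD (dp n) hq) _.
  by rewrite -(mul0r <<q, q>>); apply: cvgM => //; exact: cvg_cst.
apply: sqr_le_cvg0 (fun n => cauchy_schwarz_L2 mD (dp n) (dq n)) _.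
by rewrite -(mul0r 0); apply: cvgM.
Qed.

(** A Cauchy sequence converges along a subsequence almost everywhere, because
   the series of its rescaled squared increments has a finite integral; the
   pointwise limit is then the limit in the mean by Fatou's lemma. *)
Lemma L2_complete (p_ : nat -> T -> R) : (forall n, L2 (p_ n)) ->
  (forall e : R, 0 < e -> exists N : nat, forall n k : nat,
     (N <= n)%N -> (N <= k)%N ->
     <<fun x => p_ n x - p_ k x, fun x => p_ n x - p_ k x>> < e) ->
  exists2 p, L2 p & cvgL2 p_ p.
Proof.
move=> hp_ hC.
(* The factor [4 ^ k] is the weight of the [k]-th squared increment in the series,
   and the rest makes the weighted integrals summable. *)
pose eps (k : nat) : R := (1 / (2 ^ k.+1)%:R) / 4 ^+ k.
have eps0 k : 0 < eps k.
  by rewrite /eps !divr_gt0 ?exprn_gt0// ltr0n expn_gt0.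
have [N NP] := choice (fun k => hC _ (eps0 k)).
pose phi k : nat := (\sum_(i < k.+1) N i + k)%N.
have phiS k : (phi k <= phi k.+1)%N.
  by rewrite /phi [X in (_ <= X + _)%N]big_ord_recr /= leq_add// leq_addr.
have Nphi k : (N k <= phi k)%N.
  by rewrite /phi big_ord_recr /= -addnA addnCA leq_addr.
have kphi k : (k <= phi k)%N by rewrite /phi leq_addl.
pose dd k x := p_ (phi k.+1) x - p_ (phi k) x.
have hdd k : L2 (dd k) by exact: L2funB.
pose F k x := (4 ^+ k * dd k x ^+ 2)%:E.
have F0 k x : D x -> (0 <= F k x)%E by rewrite lee_fin mulr_ge0 ?sqr_ge0// exprn_ge0.
have mF k : measurable_fun D (F k).
  apply/measurable_EFinP; apply: measurable_funM; first exact: measurable_cst.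
  by apply: measurable_funX; exact: (hdd k).1.
have mSF : measurable_fun D (fun x => \sum_(0 <= k <oo) F k x)%E.
  exact: (@ge0_emeasurable_sum _ _ _ D F xpredT (fun k x Dx _ => F0 k x Dx) (fun k _ => mF k)).
have intF : (\int[mu]_(x in D) (\sum_(0 <= k <oo) F k x) < +oo)%E.
  rewrite integral_nneseries//.
  apply: (@le_lt_trans _ _ 1%E); last exact: ltry.
  apply: le_trans (@epsilon_trick0 R 1 xpredT ler01).
  apply: lee_nneseries => [k _ _|k _]; first by apply: integral_ge0 => x Dx; exact: F0.
  under eq_integral do rewrite /F EFinM.
  rewrite ge0_integralZl_EFin//; last first.
  - by apply/measurable_EFinP; apply: measurable_funX; exact: (hdd k).1.
  - by move=> x _; rewrite lee_fin sqr_ge0.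
  rewrite -inner_product_EFin// -EFinM lee_fin.
  have := NP k (phi k.+1) (phi k) (leq_trans (Nphi k) (phiS k)) (Nphi k).
  rewrite /eps ltr_pdivlMr ?exprn_gt0// => /ltW; rewrite mulrC; exact.
have iF : mu.-integrable D (fun x => \sum_(0 <= k <oo) F k x)%E.
  apply/integrableP; split => //; under eq_integral => x /set_mem Dx.
    rewrite gee0_abs; last by apply: nneseries_ge0 => n _ _; exact: F0.
    over.
  by [].
have [M [mM M0 DM]] := integrable_ae mD iF.
pose E := D `\` M.
have mE : measurable E by exact: measurableD.
have DE : D `\` M = E by [].
have qcvg x : E x -> cvg (p_ (phi k) x @[k --> \oo]).
  move=> [Dx Mx].
  have Sx : (\sum_(0 <= k <oo) F k x \is a fin_num)%E.
    by apply: contrapT => h; apply: Mx; apply: DM => /= /(_ Dx).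
  pose C := fine (\sum_(0 <= k <oo) F k x)%E.
  have FC k : 4 ^+ k * dd k x ^+ 2 <= C.
    rewrite -lee_fin fineK//; apply: le_trans (nneseries_lim_ge k.+1 _); last first.
      by move=> n _ _; exact: F0.
    rewrite big_nat_recr//= leeDr//; apply: sume_ge0 => i _; exact: F0.
  have C0 : 0 <= C.
    by apply: le_trans (FC 0%N); rewrite mulr_ge0 ?sqr_ge0// exprn_ge0.
  (* A bound on the weighted squares is a geometric bound on the increments. *)
  have ddle k : `|dd k x| <= geometric (C + 1) (2^-1) k.
    rewrite /geometric /= -(@ler_pXn2r _ 2)// ?nnegrE; last first.
      by rewrite mulr_ge0 ?addr_ge0// exprn_ge0// invr_ge0.
    rewrite real_normK ?num_real// exprMn -exprM mulnC exprM exprVn.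
    rewrite -natrX (_ : (2 ^ 2)%N = 4%N)//.
    rewrite exprVn ler_pdivlMr ?exprn_gt0// mulrC; apply: le_trans (FC k) _; nra.
  have sc : cvgn (series (telescope (fun k => p_ (phi k) x))).
    apply: normed_cvg; apply: (@series_le_cvg _ _ (geometric (C + 1) (2^-1))).
    - by move=> n; exact: normr_ge0.
    - by move=> n; rewrite /geometric/= mulr_ge0 ?addr_ge0// exprn_ge0// invr_ge0.
    - exact: ddle.
    - by apply: is_cvg_geometric_series; rewrite ger0_norm ?invr_ge0// invf_lt1// ltr1n.
  have -> : (fun k => p_ (phi k) x) =
     (fun k => p_ (phi 0%N) x + series (telescope (fun k => p_ (phi k) x)) k).
    by apply/funext => k; rewrite -eq_sum_telescope.
  by apply: is_cvgD => //; exact: is_cvg_cst.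
pose p x := limn (fun k => (p_ (phi k) \_ E) x).
have pE x : E x -> p_ (phi k) x @[k --> \oo] --> p x.
  move=> Ex; rewrite /p (_ : (fun k => _) = (fun k => p_ (phi k) x)); first exact: qcvg.
  by apply/funext => k; rewrite patchE mem_set.
have mp : measurable_fun D p.
  apply: (@measurable_fun_cvg _ _ _ _ (fun k => p_ (phi k) \_ E)).
    move=> k; apply/measurable_restrict => //; rewrite setIidr; last exact: subIsetl.
    by apply: measurable_funS (hp_ _).1 => //; exact: subIsetl.
  move=> x Dx; have [Ex|nEx] := pselect (E x).
    rewrite (_ : (fun k => _) = (fun k => p_ (phi k) x)); first exact: pE.
    by apply/funext => k; rewrite patchE mem_set.
  rewrite /p (_ : (fun k => _) = cst 0); first by rewrite lim_cst//; exact: cvg_cst.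
  by apply/funext => k; rewrite patchE memNset.
(* Fatou's lemma along the subsequence. *)
have intle e n : 0 < e -> (forall k, (n <= k)%N ->
    <<fun x => p_ n x - p_ k x, fun x => p_ n x - p_ k x>> <= e) ->
    (\int[mu]_(x in D) ((p_ n x - p x) ^+ 2)%:E <= e%:E)%E.
  move=> e0 hn; rewrite (ge0_negligible_integral mM)//; last 2 first.
  - apply/measurable_EFinP; apply: measurable_funX; apply: measurable_funB => //.
    exact: (hp_ n).1.
  - by move=> x _; rewrite lee_fin sqr_ge0.
  rewrite DE.
  have mEpp k : measurable_fun D (fun x => ((p_ n x - p_ (phi k) x) ^+ 2)%:E).
    apply/measurable_EFinP; apply: measurable_funX; exact: (L2funB mD (hp_ n) (hp_ _)).1.
  apply: le_trans (_ : _ <= limn_einf (fun k => \int[mu]_(x in E) ((p_ n x - p_ (phi k) x) ^+ 2)%:E))%E _.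
    rewrite (_ : (\int[mu]_(x in E) _)%E = (\int[mu]_(x in E) limn_einf
        (fun k => ((p_ n x - p_ (phi k) x) ^+ 2)%:E))%E); last first.
      apply: eq_integral => x /set_mem Ex.
      rewrite (cvg_limn_einf_sup (l := ((p_ n x - p x) ^+ 2)%:E))//.
      apply: cvg_EFin; first exact: nearW.
      have h : (p_ n x - p_ (phi k) x) @[k --> \oo] --> p_ n x - p x.
        by apply: cvgB; [exact: cvg_cst|exact: pE].
      by rewrite expr2; under eq_fun do rewrite expr2; exact: (cvgM h h).
    apply: fatou => //.
    - by move=> k; apply: measurable_funS (mEpp k) => //; exact: subIsetl.
    - by move=> k x _; rewrite lee_fin sqr_ge0.
  rewrite limn_einf_lim; apply: lime_le; first exact: is_cvg_einfs.
  apply: nearW => m; apply: ereal_inf_le => //.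
  exists (\int[mu]_(x in E) ((p_ n x - p_ (phi (maxn m n)) x) ^+ 2)%:E)%E.
    by exists (maxn m n) => //=; rewrite leq_maxl.
  apply: le_trans (_ : _ <= \int[mu]_(x in D) ((p_ n x - p_ (phi (maxn m n)) x) ^+ 2)%:E)%E _.
    apply: ge0_subset_integral => //; first by move=> x _; rewrite lee_fin sqr_ge0.
    exact: subIsetl.
  rewrite -(inner_product_EFin mD) ?lee_fin; last exact: L2funB.
  by apply: hn; apply: leq_trans (kphi _); rewrite leq_maxr.
have hdiff e : 0 < e -> exists N, forall n, (N <= n)%N ->
   (\int[mu]_(x in D) ((p_ n x - p x) ^+ 2)%:E <= e%:E)%E.
  move=> e0; have [N1 hN1] := hC _ e0; exists N1 => n Nn; apply: intle => // k nk.
  by apply/ltW/hN1 => //; exact: leq_trans nk.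
have L2d : exists n, L2 (fun x => p_ n x - p x).
  have [N1 hN1] := hdiff 1 ltr01; exists N1; split.
    by apply: measurable_funB => //; exact: (hp_ _).1.
  by apply: le_lt_trans (hN1 _ (leqnn _)) _; exact: ltry.
have hp : L2 p.
  have [n hn] := L2d; have := L2funB mD (hp_ n) hn.
  by under [X in L2 X]eq_fun do rewrite opprB addrCA subrr addr0.
exists p => //; apply/cvgr0Pnorm_le => e e0.
have [N1 hN1] := hdiff e e0; exists N1 => // n /= Nn.
rewrite ger0_norm; last exact: inner_product_ge0.
rewrite -lee_fin inner_product_EFin//; last exact: L2funB.
exact: hN1.
Qed.

Lemma L2fun_indic A : measurable A -> A `<=` D -> (mu A < +oo)%E ->
  L2 (\1_A : T -> R).
Proof.
move=> mA AD fA; split; first exact: measurable_indic.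
rewrite (_ : (\int[mu]_(x in D) _)%E = mu A)//.
under eq_integral => x _ do rewrite indicE -natrX.
rewrite -[in RHS](setIidl AD) -integral_indic//.
by apply: eq_integral => x _; rewrite indicE; case: (x \in A).
Qed.

Lemma inner_product_indic A p : measurable A -> A `<=` D ->
  <<p, \1_A>> = \int[mu]_(x in A) p x.
Proof.
move=> mA AD; rewrite -[in RHS](setIidr AD) Rintegral_mkcondr.
apply: eq_Rintegral => x _; rewrite indicE /patch.
by case: (x \in A); rewrite ?mulr1 ?mulr0.
Qed.

Lemma L2fun_integrable A p : measurable A -> A `<=` D -> (mu A < +oo)%E ->
  L2 p -> mu.-integrable A (EFin \o p).
Proof.
move=> mA AD fA hp; have := L2fun_mul_integrable mD hp (L2fun_indic mA AD fA).
move/(integrableS mD mA AD); apply: eq_integrable => // x xA /=.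
by rewrite indicE xA mulr1.
Qed.

Lemma sqr_Rintegral_le A p : measurable A -> A `<=` D -> (mu A < +oo)%E ->
  L2 p -> (\int[mu]_(x in A) p x) ^+ 2 <= <<p, p>> * fine (mu A).
Proof.
move=> mA AD fA hp; rewrite -inner_product_indic//.
apply: le_trans (cauchy_schwarz_L2 mD hp (L2fun_indic mA AD fA)) _.
rewrite inner_product_indic// le_eqVlt; apply/orP; left; apply/eqP; congr (_ * _).
rewrite (_ : \int[mu]_(x in A) _ = \int[mu]_(x in A) 1).
  by rewrite Rintegral_cst// mul1r.
by apply: eq_Rintegral => x xA; rewrite indicE xA.
Qed.

Lemma cvgL2_Rintegral A (p_ : nat -> T -> R) p : measurable A -> A `<=` D -> (mu A < +oo)%E ->
  (forall n, L2 (p_ n)) -> L2 p -> cvgL2 p_ p ->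
  \int[mu]_(x in A) p_ n x @[n --> \oo] --> \int[mu]_(x in A) p x.
Proof.
move=> mA AD fA hp_ hp pp.
rewrite -inner_product_indic//.
under eq_fun do rewrite -inner_product_indic//.
apply: cvgL2_inner_product => //; [by move=> _; exact: L2fun_indic|exact: L2fun_indic|].
rewrite /cvgL2 [X in X @ _](_ : _ = cst 0); first exact: cvg_cst.
apply/funext => n; rewrite /inner_product (@eq_Rintegral _ _ _ _ _ (cst 0)) /=.
  by rewrite Rintegral_cst// mul0r.
by move=> x _; rewrite subrr mul0r.
Qed.

End square_integrable_convergence.

(** * Variation of absolutely continuous functions *)
Section absolute_continuity_variation.
Context {R : realType}.
Implicit Types (g : R -> R) (a b c x y : R) (L M : seq (R * R)).

Definition disjoint_pair (u v : R * R) := (u.2 <= v.1) || (v.2 <= u.1).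

Definition nonoverlapping L := pairwise disjoint_pair L.

Definition inside a b L := all (fun u => [&& a <= u.1, u.1 <= u.2 & u.2 <= b]) L.

Definition increment g L : R := \sum_(u <- L) (g u.2 - g u.1).

(** Absolute continuity with signed increments and a weak bound: the first makes
   it a condition on the positive variation, the second is inherited by suprema. *)
Definition ac_above g a b := forall eps, 0 < eps -> exists2 delta : R, 0 < delta &
  forall L, inside a b L -> nonoverlapping L -> increment id L < delta ->
  increment g L <= eps.

Lemma increment_cat g L M : increment g (L ++ M) = increment g L + increment g M.
Proof. by rewrite /increment big_cat. Qed.

Lemma increment_cons g u L : increment g (u :: L) = (g u.2 - g u.1) + increment g L.
Proof. by rewrite /increment big_cons. Qed.

Lemma increment_nil g : increment g [::] = 0.
Proof. by rewrite /increment big_nil. Qed.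

Lemma disjoint_pairC u v : disjoint_pair u v = disjoint_pair v u.
Proof. by rewrite /disjoint_pair orbC. Qed.

Lemma inside_cat a b L M : inside a b (L ++ M) = inside a b L && inside a b M.
Proof. exact: all_cat. Qed.

Lemma inside_sub a b a' b' L : a' <= a -> b <= b' -> inside a b L -> inside a' b' L.
Proof.
move=> aa' bb'; apply: sub_all => -[p q] /= /and3P[h1 h2 h3].
by rewrite h2 (le_trans aa' h1) (le_trans h3 bb').
Qed.

Lemma nonoverlapping_cat L M : nonoverlapping (L ++ M) =
  [&& allrel disjoint_pair L M, nonoverlapping L & nonoverlapping M].
Proof. exact: pairwise_cat. Qed.

Lemma allrel_disjoint_refine p q L M : inside p q L ->
  all (disjoint_pair (p, q)) M -> allrel disjoint_pair L M.
Proof.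
move=> hL hM; apply/allrelP => -[p' q'] [p2 q2] /(allP hL)/= /and3P[h1 h2 h3].
move=> /(allP hM); rewrite /disjoint_pair/= => /orP[h|h].
  by rewrite (le_trans h3 h).
by rewrite (le_trans h h1) orbT.
Qed.

Lemma increment_id_le a b L : a <= b -> inside a b L -> nonoverlapping L ->
  increment id L <= b - a.
Proof.
have [n] := ubnP (size L); elim: n L a b => // n IH [|[p q] L] a b.
  by move=> _ ab _ _; rewrite increment_nil subr_ge0.
rewrite ltnS /= => sL ab /andP[/and3P[/= ap pq qb] hL] /andP[dL nL].
pose f (u : R * R) := u.2 <= p.
have -> : increment id ((p, q) :: L) =
    (q - p) + (increment id (seq.filter f L) + increment id (seq.filter (predC f) L)).
  rewrite increment_cons -increment_cat; congr (_ + _).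
  by apply: perm_big; rewrite perm_sym perm_filterC.
have h1 : increment id (seq.filter f L) <= p - a.
  apply: IH => //.
  - by apply: leq_ltn_trans sL; rewrite size_filter count_size.
  - apply/allP => -[p' q']; rewrite mem_filter /f /= => /andP[h /(allP hL)/=].
    by move=> /and3P[-> -> _].
  - exact: pairwise_filter.
have h2 : increment id (seq.filter (predC f) L) <= b - q.
  apply: IH => //.
  - by apply: leq_ltn_trans sL; rewrite size_filter count_size.
  - apply/allP => -[p' q']; rewrite mem_filter /f /= => /andP[h h'].
    have /and3P[h3 h4 h5] := allP hL _ h'.
    rewrite h4 h5 !andbT.
    by have := allP dL _ h'; rewrite /disjoint_pair /= (negbTE h) orbF.
  - exact: pairwise_filter.
lra.
Qed.

(** Clamping both end-points cuts a family at [c]; the intervals on the wrong side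
   become degenerate and contribute nothing. *)
Definition cut_left c L := [seq (Num.min u.1 c, Num.min u.2 c) | u <- L].
Definition cut_right c L := [seq (Num.max u.1 c, Num.max u.2 c) | u <- L].

Lemma increment_cut g c L : increment g L = increment g (cut_left c L) + increment g (cut_right c L).
Proof.
rewrite /increment !big_map -big_split /=; apply: eq_bigr => -[p q] _ /=.
by have [pc|cp] := leP p c; have [qc|cq] := leP q c; lra.
Qed.

Lemma nonoverlapping_cut_left c L : nonoverlapping L -> nonoverlapping (cut_left c L).
Proof.
rewrite /nonoverlapping pairwise_map; apply: sub_pairwise => -[p q] [p' q'] /=.
rewrite /disjoint_pair /= => /orP[h|h]; apply/orP; [left|right]; exact: le_min2.
Qed.

Lemma nonoverlapping_cut_right c L : nonoverlapping L -> nonoverlapping (cut_right c L).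
Proof.
rewrite /nonoverlapping pairwise_map; apply: sub_pairwise => -[p q] [p' q'] /=.
rewrite /disjoint_pair /= => /orP[h|h]; apply/orP; [left|right]; exact: le_max2.
Qed.

Lemma inside_cut_left a b c L : a <= c -> inside a b L -> inside a c (cut_left c L).
Proof.
move=> ac hL; rewrite /inside all_map; apply: sub_all hL => -[p q] /= /and3P[h1 h2 h3].
by rewrite le_min h1 ac /= le_min2//= ge_min lexx orbT.
Qed.

Lemma inside_cut_right a b c L : c <= b -> inside a b L -> inside c b (cut_right c L).
Proof.
move=> cb hL; rewrite /inside all_map; apply: sub_all hL => -[p q] /= /and3P[h1 h2 h3].
by rewrite le_max2//= le_max lexx orbT ge_max h3 cb.
Qed.

Section positive_variation.
Variables (g : R -> R) (a b : R).
Hypotheses (ab : a <= b) (gac : ac_above g a b).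

Definition admissible x : set R :=
  [set increment g L | L in [set L | inside a x L /\ nonoverlapping L]].

Definition positive_variation x : R := sup (admissible x).

Lemma admissible0 x : admissible x 0.
Proof. by exists [::]; rewrite ?increment_nil. Qed.

(** Cutting a family at the points of a subdivision finer than [delta] leaves
   finitely many pieces, each with an increment of at most 1. *)
Lemma admissible_bounded : exists K, forall x, x <= b -> forall L, inside a x L ->
  nonoverlapping L -> increment g L <= K.
Proof.
have [delta d0 H] := gac ltr01.
have step n : forall x, a <= x -> x <= b -> x <= a + n%:R * (delta / 2) ->
    forall L, inside a x L -> nonoverlapping L -> increment g L <= n.+1%:R.
  elim: n => [|n IH] x ax xb xn L hL nL.
    apply: H => //; first exact: inside_sub hL.
    apply: le_lt_trans (increment_id_le ax hL nL) _; lra.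
  have [xn'|xn'] := leP x (a + n%:R * (delta / 2)).
    by apply: le_trans (IH _ ax xb xn' _ hL nL) _; rewrite ler_nat.
  set c := a + n%:R * (delta / 2) in xn'.
  have ac : a <= c by rewrite /c lerDl mulr_ge0// divr_ge0// ltW.
  rewrite (increment_cut g c) [leRHS]mulrS addrC; apply: lerD; last first.
    apply: (H (cut_right c L)).
    - apply: inside_sub ac xb _; apply: inside_cut_right (ltW xn') hL.
    - exact: nonoverlapping_cut_right.
    - apply: le_lt_trans (increment_id_le (ltW xn') (inside_cut_right (ltW xn') hL) _) _.
        exact: nonoverlapping_cut_right.
      by move: xn; rewrite mulrS; rewrite /c; lra.
  apply: (IH c) => //; first exact: le_trans (ltW xn') xb.
    exact: inside_cut_left hL.
  exact: nonoverlapping_cut_left.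
exists (Num.trunc ((b - a) / (delta / 2))).+2%:R => x xb L hL nL.
apply: (step _ b) => //; last exact: inside_sub hL.
rewrite -lerBlDl -ler_pdivrMr ?divr_gt0//.
by apply/ltW; rewrite truncnS_gt.
Qed.

Lemma admissible_has_sup x : x <= b -> has_sup (admissible x).
Proof.
move=> xb; split; first by exists 0; exact: admissible0.
have [K HK] := admissible_bounded; exists K => _ [L [hL nL] <-].
exact: HK hL nL.
Qed.

Lemma positive_variation_ub x L : x <= b -> inside a x L -> nonoverlapping L ->
  increment g L <= positive_variation x.
Proof.
by move=> xb hL nL; apply: sup_upper_bound (admissible_has_sup xb) _ _; exists L.
Qed.

Lemma positive_variation_le x K : (forall L, inside a x L -> nonoverlapping L ->
  increment g L <= K) -> positive_variation x <= K.
Proof.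
move=> HK; apply: ge_sup; first by exists 0; exact: admissible0.
by move=> _ [L [hL nL] <-]; exact: HK.
Qed.

Lemma positive_variation_step x y L : a <= x -> x <= y -> y <= b -> inside x y L ->
  nonoverlapping L -> positive_variation x + increment g L <= positive_variation y.
Proof.
move=> ax xy yb hL nL; rewrite -lerBrDr; apply: positive_variation_le => L' hL' nL'.
rewrite lerBrDr -increment_cat; apply: positive_variation_ub => //.
  by rewrite inside_cat (inside_sub (lexx _) xy hL') (inside_sub ax (lexx _) hL).
rewrite nonoverlapping_cat nL' nL /= andbT.
apply: (allrel_disjoint_refine hL'); apply: sub_all hL => -[p q] /= /and3P[h1 _ _].
by rewrite /disjoint_pair /= h1.
Qed.

Lemma positive_variation_le_step x y K : a <= x -> x <= y -> y <= b ->
  (forall L, inside x y L -> nonoverlapping L -> increment g L <= K) ->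
  positive_variation y <= positive_variation x + K.
Proof.
move=> ax xy yb HK; apply: positive_variation_le => L hL nL.
rewrite (increment_cut g x); apply: lerD.
  apply: positive_variation_ub; first exact: le_trans xy yb.
    exact: inside_cut_left hL.
  exact: nonoverlapping_cut_left.
apply: HK; [exact: inside_cut_right hL|exact: nonoverlapping_cut_right].
Qed.

Lemma positive_variation_nondecreasing x y : a <= x -> x <= y -> y <= b ->
  positive_variation x <= positive_variation y.
Proof.
move=> ax xy yb; have := @positive_variation_step x y [::] ax xy yb isT isT.
by rewrite increment_nil addr0.
Qed.

Lemma positive_variation_ge x y : a <= x -> x <= y -> y <= b ->
  g y - g x <= positive_variation y - positive_variation x.
Proof.
move=> ax xy yb; have := @positive_variation_step x y [:: (x, y)] ax xy yb.
rewrite /inside /= !lexx xy /= => /(_ isT isT).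
rewrite increment_cons increment_nil /=; lra.
Qed.

(** Refining one interval of the family at a time by the families that nearly
   realise its variation trades the increments of the variation for increments
   of [g] over a family of no greater total length. *)
Lemma positive_variation_refine eps delta :
  (forall L, inside a b L -> nonoverlapping L -> increment id L < delta ->
    increment g L <= eps) ->
  forall M L, inside a b (L ++ M) -> nonoverlapping (L ++ M) ->
    increment id (L ++ M) < delta ->
  increment g L + increment positive_variation M <= eps.
Proof.
move=> H; elim => [|[p q] M IH] L.
  by rewrite cats0 increment_nil addr0; exact: H.
rewrite inside_cat /= => /and3P[hL /and3P[/= ap pq qb] hM].
rewrite nonoverlapping_cat allrel_consr /=.
move=> /and3P[/andP[dL dLM] nL /andP[dM nM]].
rewrite increment_cat !increment_cons /= => hd.
suff : positive_variation q <= positive_variation p +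
    (eps - increment g L - increment positive_variation M) by lra.
apply: positive_variation_le_step => // L' hL' nL'.
have := IH (L' ++ L); rewrite (increment_cat g).
suff h : [/\ inside a b ((L' ++ L) ++ M), nonoverlapping ((L' ++ L) ++ M) &
   increment id ((L' ++ L) ++ M) < delta] by case: h => h1 h2 h3 /(_ h1 h2 h3); lra.
split.
- by rewrite !inside_cat hL hM (inside_sub ap qb hL').
- rewrite -catA nonoverlapping_cat nonoverlapping_cat nL' nL nM dLM /= andbT.
  apply: (allrel_disjoint_refine hL'); rewrite all_cat dM andbT.
  by apply: sub_all dL => u; rewrite disjoint_pairC.
- rewrite !increment_cat; apply: le_lt_trans hd.
  have := increment_id_le pq hL' nL'; lra.
Qed.

Lemma positive_variation_ac : ac_above positive_variation a b.
Proof.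
move=> eps eps0; have [delta d0 H] := gac eps0; exists delta => // M hM nM dM.
have := positive_variation_refine H (M := M) (L := [::]) hM nM dM.
by rewrite increment_nil add0r.
Qed.

End positive_variation.

Lemma ac_aboveD g g' a b : ac_above g a b -> ac_above g' a b ->
  ac_above (fun x => g x + g' x) a b.
Proof.
move=> hg hg' eps eps0; have eps2 : 0 < eps / 2 by rewrite divr_gt0.
have [d1 d10 H1] := hg _ eps2; have [d2 d20 H2] := hg' _ eps2.
exists (Num.min d1 d2); first by rewrite lt_min d10.
move=> L hL nL; rewrite lt_min => /andP[l1 l2].
have := H1 L hL nL l1; have := H2 L hL nL l2.
have -> : increment (fun x => g x + g' x) L = increment g L + increment g' L.
  by rewrite /increment -big_split; apply: eq_bigr => u _ /=; lra.
lra.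
Qed.

Lemma abs_continuous_on_ac_above g a b : abs_continuous_on g a b ->
  ac_above g a b /\ ac_above (fun x => - g x) a b.
Proof.
move=> hg.
suff H eps : 0 < eps -> exists2 delta : R, 0 < delta &
    forall L, inside a b L -> nonoverlapping L -> increment id L < delta ->
    \sum_(u <- L) `|g u.2 - g u.1| <= eps.
  split => eps /H [delta d0 hd]; exists delta => // L hL nL dL;
    apply: le_trans (hd L hL nL dL); rewrite /increment; apply: ler_sum => u _.
    exact: ler_norm.
  by rewrite -normrN opprD opprK; apply: le_trans (ler_norm _); rewrite lerD.
move=> eps0; have [delta d0 hd] := hg _ eps0; exists delta => // L hL nL dL.
pose p (i : 'I_(size L)) := (nth (0, 0) L i).1.
pose q (i : 'I_(size L)) := (nth (0, 0) L i).2.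
have E (F : R * R -> R) : \sum_(u <- L) F u = \sum_(i < size L) F (nth (0, 0) L i).
  by rewrite (big_nth (0, 0)) big_mkord.
rewrite E; apply/ltW; apply: (hd _ p q).
- move=> i; have /= := allP hL _ (mem_nth (0, 0) (ltn_ord i)).
  by move=> /and3P[].
- move=> i k ik; move/(pairwiseP (0, 0)): nL => nL.
  have [lt_ik|lt_ki|/val_inj eik] := ltngtP i k; last by rewrite eik eqxx in ik.
    by apply/orP; exact: (nL i k (ltn_ord i) (ltn_ord k) lt_ik).
  by apply/orP; rewrite orbC; exact: (nL k i (ltn_ord k) (ltn_ord i) lt_ki).
- by move: dL; rewrite /increment E.
Qed.

End absolute_continuity_variation.

(** * Densities of absolutely continuous functions *)
Section density_of_absolutely_continuous_functions.
Context {R : realType}.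
Notation leb := (@lebesgue_measure R).
Implicit Types (F g h : R -> R) (a b x y : R) (L : seq (R * R)).

Definition union_of L : set R := \big[setU/set0]_(u <- L) `]u.1, u.2]%classic.

Lemma union_of_cons u L : union_of (u :: L) = `]u.1, u.2]%classic `|` union_of L.
Proof. by rewrite /union_of big_cons. Qed.

Lemma measurable_union_of L : measurable (union_of L).
Proof. by rewrite /union_of; apply: bigsetU_measurable => u _; exact: measurable_itv. Qed.

Lemma disjoint_union_of u L : u.1 <= u.2 -> all (disjoint_pair u) L ->
  `]u.1, u.2]%classic `&` union_of L = set0.
Proof.
move=> u12; elim: L => [_|v L IH /= /andP[uv uL]].
  by rewrite /union_of big_nil setI0.
rewrite union_of_cons setIUr IH// setU0; apply/seteqP; split => // z [/=].
rewrite !in_itv /= => /andP[h1 h2] /andP[h3 h4].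
by case/orP: uv => h; lra.
Qed.

Lemma measure_union_of (mu : {measure set (measurableTypeR R) -> \bar R}) F a b L :
  (forall x y, a <= x -> x <= y -> y <= b -> mu `]x, y]%classic = (F y - F x)%:E) ->
  inside a b L -> nonoverlapping L -> mu (union_of L) = (increment F L)%:E.
Proof.
move=> muF; elim: L => [_ _|u L IH /andP[/and3P[au uu ub] hL] /andP[dL nL]].
  by rewrite /union_of big_nil measure0 increment_nil.
rewrite union_of_cons increment_cons EFinD -(IH hL nL) -(muF _ _ au uu ub).
apply: measureU; [exact: measurable_itv|exact: measurable_union_of|].
exact: disjoint_union_of.
Qed.

Lemma lebesgue_measure_oc x y : x <= y -> leb `]x, y]%classic = (y - x)%:E.
Proof.
rewrite le_eqVlt => /predU1P[->|xy]; first by rewrite set_itvoc0 measure0 subrr.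
by rewrite lebesgue_measure_itv /= lte_fin xy EFinB.
Qed.

Lemma lebesgue_stieltjes_measure_oc (f : cumulative R R) x y : x <= y ->
  lebesgue_stieltjes_measure f `]x, y]%classic = (f y - f x)%:E.
Proof.
move=> xy; rewrite /lebesgue_stieltjes_measure/= /measure_extension/=.
by rewrite measurable_mu_extE/=; [rewrite wlength_itv_bnd|exact: is_ocitv].
Qed.

Section grid.
Variables (a b : R) (U : set R).
Hypothesis ab : a < b.

(** The cells of uniform grids that are contained in an open set exhaust it; each
   grid gives a finite family of intervals, to which absolute continuity applies. *)
Definition grid_point (n k : nat) : R := a + (b - a) * (k%:R / n.+1%:R).

Definition grid_cell_in (n k : nat) : bool :=
  asbool (`]grid_point n k, grid_point n k.+1]%classic `<=` U).

Definition grid_inside (n : nat) : seq (R * R) :=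
  [seq (grid_point n k, grid_point n k.+1) | k <- seq.filter (grid_cell_in n) (iota 0 n.+1)].

Lemma grid_point_le n k l : (k <= l)%N -> grid_point n k <= grid_point n l.
Proof.
move=> kl; rewrite /grid_point lerD2l ler_pM2l ?subr_gt0//.
by rewrite ler_pM2r ?invr_gt0// ler_nat.
Qed.

Lemma grid_inside_inside n : inside a b (grid_inside n).
Proof.
apply/allP => u /mapP[k]; rewrite mem_filter mem_iota add0n => /andP[_ /andP[_ kn]] -> /=.
have h0 : grid_point n 0 = a by rewrite /grid_point mul0r mulr0 addr0.
have h1 : grid_point n n.+1 = b by rewrite /grid_point divff// mulr1 subrKC.
by rewrite -[X in X <= _]h0 -[X in _ && (_ <= X)]h1 !grid_point_le.
Qed.

Lemma grid_inside_nonoverlapping n : nonoverlapping (grid_inside n).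
Proof.
rewrite /nonoverlapping pairwise_map; apply: pairwise_filter.
apply: (@sub_pairwise _ ltn).
  by move=> k l kl; rewrite /disjoint_pair /= grid_point_le.
by rewrite -(sorted_pairwise ltn_trans); exact: iota_ltn_sorted.
Qed.

Lemma union_of_mem L z : union_of L z <-> exists2 u, u \in L & u.1 < z <= u.2.
Proof.
elim: L => [|v L IH].
  by rewrite /union_of big_nil; split => // -[].
rewrite union_of_cons; split.
  move=> [/=|/IH[u uL uz]].
    by rewrite in_itv /= => vz; exists v => //; rewrite mem_head.
  by exists u => //; rewrite in_cons uL orbT.
move=> [u]; rewrite in_cons => /predU1P[-> vz|uL uz].
  by left; rewrite /= in_itv.
by right; apply/IH; exists u.
Qed.

Lemma grid_inside_sub n : union_of (grid_inside n) `<=` U.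
Proof.
move=> z /union_of_mem[u /mapP[k]].
by rewrite mem_filter => /andP[/asboolP kU _] -> kz; apply: kU; rewrite /= in_itv.
Qed.

Lemma grid_inside_cover : open U -> forall z, U z -> a < z <= b ->
  \forall n \near \oo, union_of (grid_inside n) z.
Proof.
move=> oU z Uz /andP[az zb].
have [e /= e0 he] : exists2 e : R, 0 < e & ball z e `<=` U.
  by have /nbhs_ballP[e e0 he] := oU z Uz; exists e.
near=> n.
have n0 : 0 < n.+1%:R :> R by rewrite ltr0n.
have ba0 : 0 < b - a by rewrite subr_gt0.
have ex_k : exists k, z <= grid_point n k.
  by exists n.+1; rewrite /grid_point divff ?gt_eqF// mulr1 subrKC.
have [[|k] zk mink] := ex_minnP ex_k.
  by move: zk; rewrite /grid_point mul0r mulr0 addr0; lra.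
have kz : grid_point n k < z.
  by rewrite ltNge; apply/negP => /mink; rewrite ltnn.
have width : grid_point n k.+1 - grid_point n k < e.
  have -> : grid_point n k.+1 - grid_point n k = (b - a) / n.+1%:R.
    by rewrite /grid_point -natr1; field; rewrite gt_eqF.
  rewrite mulrC -ltr_pdivlMr//; near: n.
  have eba0 : 0 < e / (b - a) by rewrite divr_gt0// subr_gt0.
  exact: (near_infty_natSinv_lt (PosNum eba0)).
apply/union_of_mem; exists (grid_point n k, grid_point n k.+1); last by rewrite /= kz.
apply/mapP; exists k => //; rewrite mem_filter mem_iota add0n leq0n /=.
apply/andP; split.
  apply/asboolP => y /=; rewrite in_itv /= => /andP[ky yk]; apply: he.
  rewrite /ball /= ltr_norml; apply/andP; split; lra.
rewrite ltnNge; apply/negP => nk; have := grid_point_le n nk.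
have -> : grid_point n n.+1 = b by rewrite /grid_point divff ?gt_eqF// mulr1 subrKC.
by move=> h; have := lt_le_trans kz zb; rewrite ltNge h.
Unshelve. all: by end_near. Qed.

End grid.
(** Exhaustion by grid cells carries an epsilon-delta bound for finite families of
   intervals over to open sets. *)
Lemma measure_open_le (mu : {measure set (measurableTypeR R) -> \bar R}) F a b eps delta (U : set R) :
  a < b ->
  (forall x y, a <= x -> x <= y -> y <= b -> mu `]x, y]%classic = (F y - F x)%:E) ->
  (forall L, inside a b L -> nonoverlapping L -> increment id L < delta ->
    increment F L <= eps) ->
  open U -> (leb U < delta%:E)%E -> (mu (U `&` `]a, b]%classic) <= eps%:E)%E.
Proof.
move=> ab muF H oU Ud; pose A n := union_of (grid_inside a b U n).
have mA n : measurable (A n) by exact: measurable_union_of.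
have muA n : (mu (A n) <= eps%:E)%E.
  have hin := grid_inside_inside U ab n; have hn := grid_inside_nonoverlapping U ab n.
  rewrite (measure_union_of muF hin hn) lee_fin H//.
  rewrite -lte_fin; apply: le_lt_trans Ud.
  rewrite -(@measure_union_of (lebesgue_measure : measure _ _) id a b _ _ hin hn); last first.
    by move=> x y _ xy _; exact: lebesgue_measure_oc.
  apply: le_measure; rewrite ?inE//; [exact: mA|exact: open_measurable|].
  exact: grid_inside_sub.
pose E n := \bigcap_(k in [set k | (n <= k)%N]) A k.
have mE n : measurable (E n).
  by apply: bigcap_measurable => [|k _]; [exists n => /=|exact: mA].
have mbE : measurable (\bigcup_n E n) by exact: bigcup_measurable.
have sub : U `&` `]a, b]%classic `<=` \bigcup_n E n.
  move=> z [Uz]; rewrite /= in_itv /= => abz.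
  by have [n _ hn] := grid_inside_cover ab oU Uz abz; exists n.
apply: le_trans (_ : mu (\bigcup_n E n) <= _)%E.
  apply: le_measure; rewrite ?inE//.
  by apply: measurableI; [exact: open_measurable|exact: measurable_itv].
have ndE : {homo E : n m / (n <= m)%N >-> (n <= m)%O}.
  by move=> n m nm; apply/subsetPset => z hz k /= mk; apply: hz => /=; exact: leq_trans mk.
have cv := nondecreasing_cvg_mu (mu := mu) mE mbE ndE.
rewrite -(cvg_lim _ cv)//; apply: lime_le; first by apply/cvg_ex; exists (mu (\bigcup_n E n)).
apply: nearW => n /=; apply: le_trans (muA n); apply: le_measure; rewrite ?inE//.
- exact: mE.
- exact: mA.
- by move=> z hz; exact: (hz n (leqnn n)).
Qed.

Section monotone_density.
Variables (a b : R) (F : R -> R).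
Hypotheses (ab : a < b) (Fac : ac_above F a b).
Hypothesis Fnd : forall x y, a <= x -> x <= y -> y <= b -> F x <= F y.

(** [F] is controlled on the interval from [a] to [b] only; extending it by constants makes it the
   cumulative function of a measure on the line. *)
Let clamp x := Num.max a (Num.min x b).
Let G x := F (clamp x).

Let clampE x : a <= x -> x <= b -> clamp x = x.
Proof. by move=> ax xb; rewrite /clamp min_l// max_r. Qed.

Let clamp_ge x : a <= clamp x. Proof. by rewrite /clamp le_max lexx. Qed.

Let clamp_le x : clamp x <= b.
Proof. by rewrite /clamp ge_max (ltW ab) ge_min lexx orbT. Qed.

Let clamp_nd x y : x <= y -> clamp x <= clamp y.
Proof. by move=> xy; rewrite /clamp le_max2// le_min2. Qed.

Let clamp_lip x y : x <= y -> clamp y - clamp x <= y - x.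
Proof.
move=> xy; rewrite /clamp.
have [xb|bx] := leP x b; have [yb|by'] := leP y b; rewrite /Num.max;
  do ?case: ifPn; rewrite -?leNgt; lra.
Qed.

Let G_nd : {homo G : x y / x <= y}.
Proof. by move=> x y xy; rewrite /G Fnd// ?clamp_nd. Qed.

Let G_lip_small eps : 0 < eps -> exists2 delta : R, 0 < delta &
  forall x y, x <= y -> y - x < delta -> G y - G x <= eps.
Proof.
move=> eps0; have [delta d0 H] := Fac eps0; exists delta => // x y xy xyd.
have := H [:: (clamp x, clamp y)].
rewrite /inside /= clamp_ge clamp_nd// clamp_le /= !increment_cons !increment_nil /=.
rewrite !addr0; apply => //; exact: le_lt_trans (clamp_lip xy) xyd.
Qed.

Let G_rc : right_continuous G.
Proof.
move=> x; apply: cvg_at_right_filter; apply/cvgrPdist_le => eps eps0.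
have [delta d0 H] := G_lip_small eps0; near=> y.
have yd : `|x - y| < delta by near: y; exact: cvgr_dist_lt.
have [xy|yx] := leP x y.
  rewrite ler0_norm ?subr_le0 ?G_nd// opprB H//.
  by move: yd; rewrite ler0_norm ?subr_le0// opprB.
rewrite ger0_norm ?subr_ge0 ?G_nd ?(ltW yx)// H ?(ltW yx)//.
by apply: le_lt_trans yd; exact: ler_norm.
Unshelve. all: by end_near. Qed.

Let Gc : cumulative R R := HB.pack G (isCumulative.Build R _ R G G_nd G_rc).

Let muG : {measure set (measurableTypeR R) -> \bar R} := lebesgue_stieltjes_measure Gc.

Let muG_itv x y : x <= y -> muG `]x, y]%classic = (G y - G x)%:E.
Proof.
by move=> xy; exact: (lebesgue_stieltjes_measure_oc Gc xy).
Qed.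

Let muG_fin : (muG `]a, b]%classic < +oo)%E.
Proof. by rewrite muG_itv ?ltry// ltW. Qed.

Let itv_meas : measurable (`]a, b]%classic : set (measurableTypeR R)).
Proof. exact: measurable_itv. Qed.

Let nu := mfrestr itv_meas muG_fin.

(** A null set is contained in open sets of arbitrarily small measure, to which
   absolute continuity applies through [measure_open_le]. *)
Let nu_dominated : nu `<< leb.
Proof.
apply/null_content_dominatesP => N mN N0.
apply/eqP; rewrite eq_le measure_ge0 andbT; apply/lee_addgt0Pr => eps eps0.
rewrite add0e; have [delta d0 H] := Fac eps0.
have N0' : (leb N < +oo)%E by rewrite N0.
have [U [oU NU UN]] := lebesgue_regularity_outer mN N0' d0.
have Ud : (leb U < delta%:E)%E.
  have -> : U = (U `\` N) `|` N by rewrite setUDl setDv setD0; apply/esym/setUidPl.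
  apply: le_lt_trans UN.
  have mUN : measurable (U `\` N : set (measurableTypeR R)).
    by apply: measurableD => //; exact: open_measurable.
  by rewrite measureU0.
change (muG (N `&` `]a, b]%classic) <= eps%:E)%E.
apply: le_trans (measure_open_le (mu := muG) ab _ H oU Ud).
  apply: le_measure; last exact: setSI.
    by rewrite inE; exact: measurableI.
  by rewrite inE; apply: measurableI => //; exact: open_measurable.
by move=> x y ax xy yb; rewrite muG_itv// /G !clampE// ?(le_trans xy)// (le_trans ax).
Qed.

Lemma monotone_density : exists h : R -> R,
  leb.-integrable setT (EFin \o h) /\
  forall x y, a <= x -> x <= y -> y <= b ->
    \int[leb]_(t in `]x, y]) h t = F y - F x.
Proof.
have [f [f0 ffin fint fE]] := radon_nikodym_sigma_finite nu_dominated.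
have hf : EFin \o (fine \o f) = f by apply/funext => x /=; rewrite fineK.
exists (fine \o f); split; first by rewrite hf.
move=> x y ax xy yb.
have nuE : nu `]x, y]%classic = (F y - F x)%:E.
  rewrite /nu /mfrestr /mrestr setIidl; last first.
    by move=> z /=; rewrite !in_itv /= => /andP[h1 h2]; rewrite (le_lt_trans ax) //= (le_trans h2).
  by rewrite muG_itv//= /G !clampE// ?(le_trans xy)// (le_trans ax).
rewrite -[RHS]/(fine (F y - F x)%:E) -nuE; congr fine.
etransitivity; last exact/esym/(fE _ (measurable_itv `]x, y])).
by apply: eq_integral => z _; rewrite -[in RHS]hf.
Qed.

End monotone_density.

(** The positive variation [P] and [P - g] are both nondecreasing and absolutely
   continuous, so their Stieltjes measures have densities; the Lebesgue
   differentiation theorem identifies the difference of these with [g']. *)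
Lemma abs_continuous_FTC g a b : a < b -> abs_continuous_on g a b ->
  exists h : R -> R, [/\ leb.-integrable setT (EFin \o h),
    forall x y, a <= x -> x <= y -> y <= b ->
      \int[leb]_(t in `]x, y]) h t = g y - g x
  & {ae leb, forall x, a < x < b -> derivable g x 1 /\ derive1 g x = h x}].
Proof.
move=> ab /abs_continuous_on_ac_above[gac gNac].
pose P := positive_variation g a.
have Pac : ac_above P a b by exact: (positive_variation_ac (ltW ab) gac).
have Qac : ac_above (fun x => P x + - g x) a b by exact: ac_aboveD.
have Pnd x y : a <= x -> x <= y -> y <= b -> P x <= P y.
  exact: (positive_variation_nondecreasing (ltW ab) gac).
have Qnd x y : a <= x -> x <= y -> y <= b -> P x + - g x <= P y + - g y.
  move=> ax xy yb.
  have := positive_variation_ge (ltW ab) gac ax xy yb; rewrite -/P; lra.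
have [h1 [ih1 h1E]] := monotone_density ab Pac Pnd.
have [h2 [ih2 h2E]] := monotone_density ab Qac Qnd.
pose h t := h1 t - h2 t.
have ih : leb.-integrable setT (EFin \o h).
  exact: (integrableB measurableT ih1 ih2).
have hE x y : a <= x -> x <= y -> y <= b -> \int[leb]_(t in `]x, y]) h t = g y - g x.
  move=> ax xy yb; rewrite RintegralB//; last 2 first.
  - exact: integrableS ih1.
  - exact: integrableS ih2.
  rewrite h1E// h2E//; lra.
exists h; split => //.
have ihI (i : interval R) : leb.-integrable [set` i] (EFin \o h).
  by apply: integrableS ih => //; exact: measurable_itv.
have := @FTC1Ny R h (fun y => ihI `]-oo, y]) (open_integrable_locally openT ih).
apply: filterS; first exact: (ae_filter_ringOfSetsType (lebesgue_measure : measure _ _)).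
move=> x hx /andP[ax xb].
pose H z := \int[leb]_(t in `]-oo, z]) h t.
have gH : \forall z \near x, H z + cst (g a - H a) z = g z.
  near=> z.
  have az : a <= z by apply/ltW; near: z; exact: lt_nbhsr.
  have zb : z <= b by apply/ltW; near: z; exact: lt_nbhsl.
  have : H z = H a + (g z - g a).
    rewrite -hE// /H (@itv_bndbnd_setU _ _ -oo%O (BRight a) (BRight z))//.
    rewrite Rintegral_setU//=.
    - by rewrite -itv_bndbnd_setU//; exact: ihI.
    - apply/disj_setPS => t [] /=; rewrite !in_itv /= => ta /andP[at' _].
      by have := lt_le_trans at' ta; rewrite ltxx.
  by rewrite /cst; lra.
have dH : derivable (fun z => H z + cst (g a - H a) z) x 1.
  by apply: derivableD; [exact: hx.1|exact: derivable_cst].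
split; first exact: near_eq_derivable gH dH.
have -> : derive1 g x = derive1 (fun z => H z + cst (g a - H a) z) x.
  by rewrite !derive1E; apply/esym/near_eq_derive.
rewrite derive1E deriveD//; [|exact: hx.1].
by rewrite derive_cst addr0 -derive1E; exact: hx.2.
Unshelve. all: by end_near. Qed.

End density_of_absolutely_continuous_functions.

(** * The extended real line *)
Section extended_real_line.
Context {R : realType}.
Implicit Types (x y z j l r : \bar R) (B : set (\bar R)).

(** Splitting a neighbourhood into its two sides lets infinite and finite
   points be treated alike. *)
Lemma nbhs_ereal_sides j B : nbhs j B ->
  (j = -oo%E \/ exists2 a, (a < j)%E & forall x, (a < x)%E -> (x <= j)%E -> B x) /\
  (j = +oo%E \/ exists2 b, (j < b)%E & forall x, (x < b)%E -> (j <= x)%E -> B x).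
Proof.
case: j => [c||] nB; split; try by left.
- right; move: nB => /nbhs_EFin/nbhs_ballP[d /= d0 hd].
  exists (c - d)%:E; first by rewrite lte_fin; lra.
  move=> [x||]; rewrite ?lte_fin ?lee_fin//= => h1 h2; apply: hd.
  by rewrite /ball /= ger0_norm; lra.
- right; move: nB => /nbhs_EFin/nbhs_ballP[d /= d0 hd].
  exists (c + d)%:E; first by rewrite lte_fin; lra.
  move=> [x||]; rewrite ?lte_fin ?lee_fin//= => h1 h2; apply: hd.
  by rewrite /ball /= ler0_norm; lra.
- right; case: nB => M [_ hM]; exists M%:E; first exact: ltry.
  by move=> x Mx _; exact: hM.
- right; case: nB => M [_ hM]; exists M%:E; first exact: ltNyr.
  by move=> x Mx _; exact: hM.
Qed.

(** The supremum of the points [x] for which [[x, +oo]] belongs to the filter is a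
   cluster point. *)
Lemma compact_ereal : compact [set: \bar R].
Proof.
move=> F PF _; pose A := [set x | F [set y | (x <= y)%E]].
have A0 : A -oo%E.
  by rewrite /A /=; apply: filterS filterT => y _ /=; exact: leNye.
pose p := ereal_sup A; exists p; split => // C B FC nB.
have [lo hi] := nbhs_ereal_sides nB.
have [C1 FC1 hC1] : exists2 C1, F C1 & forall x, C1 x -> C x /\ ((x <= p)%E -> B x).
  case: lo => [pNy|[a ap ha]].
    exists C => // x Cx; split => //; rewrite pNy leeNy_eq => /eqP ->.
    by rewrite -pNy; exact: nbhs_singleton.
  have [x Ax ax] := ereal_sup_gt ap.
  exists (C `&` [set y | (x <= y)%E]); first exact: filterI.
  by move=> y [Cy xy]; split => // yp; apply: ha => //; exact: lt_le_trans xy.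
case: hi => [py|[b pb hb]].
  have [x /hC1[Cx Bx]] := filter_ex FC1.
  by exists x; split => //; apply: Bx; rewrite py leey.
apply: contrapT => CB0; suff Ab : A b by have := ereal_sup_ubound Ab; rewrite -/p leNgt pb.
rewrite /A /=; apply: filterS FC1 => y /hC1[Cy By] /=; rewrite leNgt; apply/negP => yb.
apply: CB0; exists y; split => //.
by have [yp|py] := leP y p; [exact: By|apply: hb => //; exact: ltW].
Qed.

Lemma compact_ereal_itv x y : compact `[x, y]%classic.
Proof.
apply: (subclosed_compact _ compact_ereal) => //; exact: itv_closed.
Qed.

Lemma ereal_between x y : (x < y)%E -> exists2 c : R, (x < c%:E)%E & (c%:E < y)%E.
Proof.
case: x => [a||]; case: y => [b||] //.
- by rewrite lte_fin => ab; exists ((a + b) / 2); rewrite lte_fin; lra.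
- by move=> _; exists (a + 1); rewrite ?ltry// lte_fin; lra.
- by move=> _; exists (b - 1); rewrite ?ltNyr// lte_fin; lra.
- by move=> _; exists 0; rewrite ?ltry// ltNyr.
Qed.

Lemma continuous_EFin (u : R) : EFin v @[v --> u] --> u%:E.
Proof. by apply: cvg_EFin; [exact: nearW|exact: cvg_id]. Qed.

End extended_real_line.

(** * Neighbourhoods of the ends of an open interval *)
Section open_interval.
Context {R : realType}.
Variables l r e : \bar R.
Hypotheses (le_e : (l < e)%E) (lt_er : (e < r)%E).
Implicit Types (x y j a : \bar R).

Local Notation D := (`]l, r[%classic : set (\bar R)).

Definition is_end j := j = l \/ j = r.

(** The points of the open interval between [a] and the end [j]; these sets are
   a base of the neighbourhoods of [j] seen from inside. *)
Definition tail j a : set (\bar R) :=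
  [set x | [/\ D x, j = r -> (a < x)%E & j = l -> (x < a)%E]].

Lemma in_openP x : D x <-> (l < x)%E /\ (x < r)%E.
Proof. by rewrite /= in_itv /=; split => [/andP[]|[-> ->]]. Qed.

Lemma in_open_e : D e.
Proof. exact/in_openP. Qed.

Lemma in_open_between x y z : D x -> D y -> (x <= z)%E -> (z <= y)%E -> D z.
Proof.
move=> /in_openP[lx _] /in_openP[_ yr] xz zy; apply/in_openP.
by split; [exact: lt_le_trans xz|exact: le_lt_trans yr].
Qed.

Lemma open_open : open D. Proof. exact: itv_open. Qed.

Lemma measurable_open : measurable D. Proof. exact: emeasurable_itv. Qed.

Lemma in_open_fin x : D x -> x \is a fin_num.
Proof.
move=> /in_openP[lx xr]; rewrite fin_numE; apply/andP; split; apply/eqP => xE.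
  by move: lx; rewrite xE ltNge leNye.
by move: xr; rewrite xE ltNge leey.
Qed.

Lemma end_neq : l <> r.
Proof. by move=> lr; have := lt_trans le_e lt_er; rewrite lr ltxx. Qed.

Lemma inner_interior x : D x -> inner l r x = nbhs x.
Proof. by move=> Dx; apply: within_interior; exact: open_open. Qed.

Lemma tail_sub j a : tail j a `<=` D. Proof. by move=> x []. Qed.

Lemma inner_open j : inner l r j D.
Proof. exact: withinT. Qed.

Lemma inner_tail j a : is_end j -> D a -> inner l r j (tail j a).
Proof.
move=> [->|->] /in_openP[la ar]; rewrite /inner /within /=.
- near=> x => Dx; split => //; first by move/end_neq.
  by move=> _; near: x; exact: open_ereal_lt'.
- near=> x => Dx; split => // [_|/esym/end_neq//].
  by near: x; exact: open_ereal_gt'.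
Unshelve. all: by end_near. Qed.

Lemma innerP j (P : set (\bar R)) : is_end j -> inner l r j P ->
  exists2 a, D a & tail j a `<=` P.
Proof.
move=> jend /nbhs_ereal_sides[lo hi]; case: jend => jE; subst j.
- case: hi => [ly|[b lb hb]]; first by move: le_e; rewrite ly ltNge leey.
  exists (Order.min b e).
    apply/in_openP; rewrite lt_min lb le_e; split => //.
    by rewrite gt_min lt_er orbT.
  move=> x [Dx _ /(_ erefl)]; rewrite lt_min => /andP[xb _]; apply: (hb x xb) => //.
  by move/in_openP: Dx => [/ltW].
- case: lo => [ry|[a ar ha]]; first by move: lt_er; rewrite ry ltNge leNye.
  exists (Order.max a e).
    apply/in_openP; rewrite gt_max ar lt_er; split => //.
    by rewrite lt_max le_e orbT.
  move=> x [Dx /(_ erefl) + _]; rewrite gt_max => /andP[ax _]; apply: (ha x ax) => //.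
  by move/in_openP: Dx => [_ /ltW].
Qed.

Lemma tail_neq0 j a : is_end j -> D a -> tail j a !=set0.
Proof.
move=> [->|->] /in_openP[la ar].
- have [c lc ca] := ereal_between la; exists c%:E; split => //; last by move/end_neq.
  by apply/in_openP; split => //; exact: lt_trans ar.
- have [c ac cr] := ereal_between ar; exists c%:E; split => //; last by move/esym/end_neq.
  by apply/in_openP; split => //; exact: lt_trans ac.
Qed.

Lemma inner_proper j : is_end j -> ProperFilter (inner l r j).
Proof.
move=> jend; apply: Build_ProperFilter_ex => P /(innerP jend)[a Da aP].
by have [x /aP Px] := tail_neq0 jend Da; exists x.
Qed.

Lemma inner_filter j : Filter (inner l r j).
Proof. exact: within_filter. Qed.

Lemma tail_open j a : is_end j -> open (tail j a).
Proof.
move=> [->|->].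
- rewrite (_ : tail l a = D `&` [set x | (x < a)%E]).
    by apply: openI; [exact: open_open|exact: open_ereal_lt_ereal].
  apply/seteqP; split => x; first by move=> [Dx _ /(_ erefl)].
  by move=> [Dx xa]; split => //; move/end_neq.
- rewrite (_ : tail r a = D `&` [set x | (a < x)%E]).
    by apply: openI; [exact: open_open|exact: open_ereal_gt_ereal].
  apply/seteqP; split => x; first by move=> [Dx /(_ erefl)].
  by move=> [Dx xa]; split => //; move/esym/end_neq.
Qed.

(** Points of the open interval that tend monotonically to its ends. The branches
   returning [e] correspond to ends excluded by [l < e] and [e < r]. *)
Definition left_point (n : nat) : \bar R :=
  match l with
  | l'%:E => (l' + (fine e - l') / n.+1%:R)%:E
  | -oo%E => (fine e - n%:R)%:E
  | +oo%E => e
  end.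

Definition right_point (n : nat) : \bar R :=
  match r with
  | r'%:E => (r' - (r' - fine e) / n.+1%:R)%:E
  | +oo%E => (fine e + n%:R)%:E
  | -oo%E => e
  end.

Lemma inv_natS_le (n k : nat) : (n <= k)%N -> k.+1%:R^-1 <= n.+1%:R^-1 :> R.
Proof. by move=> nk; rewrite lef_pV2 ?posrE ?ltr0n// ler_nat. Qed.

Lemma left_point_spec :
  [/\ forall n, (l < left_point n)%E, forall n, (left_point n <= e)%E,
     forall n k, (n <= k)%N -> (left_point k <= left_point n)%E &
     forall x, (l < x)%E -> exists n, (left_point n < x)%E].
Proof.
have ee := fineK (in_open_fin in_open_e); rewrite /left_point.
move: le_e; rewrite -{1 2}ee; case: l => [c||] //= ce.
- rewrite lte_fin in ce; have ec : 0 < fine e - c by rewrite subr_gt0.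
  split => [n|n|n k nk|x cx].
  + by rewrite lte_fin ltrDl divr_gt0.
  + rewrite -[leRHS]ee lee_fin -lerBrDl ler_pdivrMr// ler_peMr ?ler1n//.
    exact: ltW.
  + by rewrite lee_fin lerD2l ler_pM2l// inv_natS_le.
  + have [d cd dx] := ereal_between cx; rewrite lte_fin in cd.
    have dc0 : 0 < (d - c) / (fine e - c) by rewrite divr_gt0// subr_gt0.
    have [n _ hn] := near_infty_natSinv_lt (PosNum dc0).
    exists n; apply: lt_trans dx; rewrite lte_fin.
    by rewrite -ltrBrDl mulrC -ltr_pdivlMr//; exact: (hn n (leqnn n)).
- split => [n|n|n k nk|x cx].
  + exact: ltNyr.
  + by rewrite -[leRHS]ee lee_fin gerBl.
  + by rewrite lee_fin lerD2l lerN2 ler_nat.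
  + have [d cd dx] := ereal_between cx.
    exists (Num.trunc (fine e - d)).+1; apply: lt_trans dx; rewrite lte_fin.
    by have := truncnS_gt (fine e - d); lra.
Qed.

Lemma right_point_spec :
  [/\ forall n, (right_point n < r)%E, forall n, (e <= right_point n)%E,
     forall n k, (n <= k)%N -> (right_point n <= right_point k)%E &
     forall x, (x < r)%E -> exists n, (x < right_point n)%E].
Proof.
have ee := fineK (in_open_fin in_open_e); rewrite /right_point.
move: lt_er; rewrite -{1 2}ee; case: r => [c||] //= ce.
- rewrite lte_fin in ce; have ec : 0 < c - fine e by rewrite subr_gt0.
  split => [n|n|n k nk|x cx].
  + by rewrite lte_fin gtrBl divr_gt0.
  + rewrite -[leLHS]ee lee_fin lerBrDr -lerBrDl ler_pdivrMr// ler_peMr ?ler1n//.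
    exact: ltW.
  + by rewrite lee_fin lerD2l lerN2 ler_pM2l// inv_natS_le.
  + have [d cd dx] := ereal_between cx; rewrite lte_fin in dx.
    have dc0 : 0 < (c - d) / (c - fine e) by rewrite divr_gt0// subr_gt0.
    have [n _ hn] := near_infty_natSinv_lt (PosNum dc0).
    exists n; apply: lt_trans cd _; rewrite lte_fin.
    rewrite ltrBrDl -ltrBrDr mulrC -ltr_pdivlMr//; exact: (hn n (leqnn n)).
- split => [n|n|n k nk|x cx].
  + exact: ltry.
  + by rewrite -[leLHS]ee lee_fin lerDl.
  + by rewrite lee_fin lerD2l ler_nat.
  + have [d cd dx] := ereal_between cx.
    exists (Num.trunc (d - fine e)).+1; apply: lt_trans cd _; rewrite lte_fin.
    by have := truncnS_gt (d - fine e); lra.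
Qed.

Definition exhaustion (n : nat) : set (\bar R) := `]left_point n, right_point n]%classic.

Lemma in_open_left_point n : D (left_point n).
Proof.
have [h1 h2 _ _] := left_point_spec.
by apply/in_openP; split => //; exact: le_lt_trans lt_er.
Qed.

Lemma in_open_right_point n : D (right_point n).
Proof.
have [h1 h2 _ _] := right_point_spec.
by apply/in_openP; split => //; exact: lt_le_trans le_e _.
Qed.

Lemma left_right_point n : (left_point n <= right_point n)%E.
Proof.
have [_ h2 _ _] := left_point_spec; have [_ h3 _ _] := right_point_spec.
exact: le_trans (h2 n) (h3 n).
Qed.

Lemma measurable_exhaustion n : measurable (exhaustion n).
Proof. exact: emeasurable_itv. Qed.

Lemma exhaustion_nd n k : (n <= k)%N -> exhaustion n `<=` exhaustion k.
Proof.
have [_ _ h1 _] := left_point_spec; have [_ _ h2 _] := right_point_spec.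
move=> nk x; rewrite /exhaustion /= !in_itv /= => /andP[h3 h4].
by rewrite (le_lt_trans (h1 _ _ nk) h3) (le_trans h4 (h2 _ _ nk)).
Qed.

Lemma exhaustion_sub n : exhaustion n `<=` D.
Proof.
move=> x; rewrite /exhaustion /= in_itv /= => /andP[h1 h2].
exact: in_open_between (in_open_left_point n) (in_open_right_point n) (ltW h1) h2.
Qed.

Lemma bigcup_exhaustion : \bigcup_n exhaustion n = D.
Proof.
apply/seteqP; split => [x [n _]|x /in_openP[lx xr]]; first exact: exhaustion_sub.
have [_ _ h1 /(_ _ lx)[n hn]] := left_point_spec.
have [_ _ h2 /(_ _ xr)[k hk]] := right_point_spec.
exists (maxn n k) => //; rewrite /exhaustion /= in_itv /=.
by rewrite (le_lt_trans (h1 _ _ (leq_maxl n k)) hn) (le_trans (ltW hk) (h2 _ _ (leq_maxr n k))).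
Qed.

End open_interval.

(** * Scale functions *)
Section scale_functions.
Context {R : realType}.
Variables (l r e : \bar R) (s : \bar R -> R).
Hypotheses (le_e : (l < e)%E) (lt_er : (e < r)%E) (hs : scale_function l r e s).
Implicit Types (x y z j a : \bar R).

Local Notation D := (`]l, r[%classic : set (\bar R)).
Local Notation sv := (scale_value l r s).

Lemma scale_lt x y : D x -> D y -> (x < y)%E -> s x < s y.
Proof. by move=> Dx Dy; case: hs => _ h _; apply: h. Qed.

Lemma scale_le x y : D x -> D y -> (x <= y)%E -> s x <= s y.
Proof.
by move=> Dx Dy; rewrite le_eqVlt => /predU1P[->//|xy]; apply/ltW/scale_lt.
Qed.

Lemma scale_lt_mono x y : D x -> D y -> (s x < s y) = (x < y)%E.
Proof.
move=> Dx Dy; apply/idP/idP; last exact: scale_lt.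
by rewrite !ltNge; apply: contra; exact: scale_le.
Qed.

Lemma scale_le_mono x y : D x -> D y -> (s x <= s y) = (x <= y)%E.
Proof. by move=> Dx Dy; rewrite leNgt scale_lt_mono// -leNgt. Qed.

Lemma scale_function_continuous x : D x -> s y @[y --> x] --> s x.
Proof.
move=> Dx; have [] := hs; rewrite continuous_open_subspace; last exact: open_open.
by move=> h _ _; apply: h; rewrite inE.
Qed.

Lemma scale_valueE x : D x -> sv x = (s x)%:E.
Proof.
move=> Dx; rewrite /scale_value inner_interior//; apply: cvg_lim => //.
apply: cvg_EFin; first exact: nearW.
exact: scale_function_continuous.
Qed.

Lemma scale_cvg_value j : is_end l r j -> (s y)%:E @[y --> inner l r j] --> sv j.
Proof.
move=> jend; have PF := inner_proper le_e lt_er jend.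
suff [v hv] : exists v : \bar R, (s y)%:E @[y --> inner l r j] --> v.
  by rewrite /scale_value (cvg_lim (@ereal_hausdorff R) hv).
have tail_near a : D a -> inner l r j (tail l r j a).
  by move=> Da; exact: (inner_tail le_e lt_er jend Da).
case: (jend) => jE.
- exists (ereal_inf [set (s y)%:E | y in D]) => B /nbhs_ereal_sides[_ hi].
  set v := ereal_inf _ in hi.
  have vle y : D y -> (v <= (s y)%:E)%E by move=> Dy; apply: ereal_inf_lbound; exists y.
  case: hi => [vy|[b vb hb]].
    by have := vle e (in_open_e le_e lt_er); rewrite vy leye_eq.
  have [_ [a Da <-] ab] := ereal_inf_lt vb.
  rewrite /fmap /=; apply: filterS (tail_near a Da) => y [Dy _ /(_ jE) ya].
  by apply: hb; [apply: lt_trans ab; rewrite lte_fin scale_lt|exact: vle].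
- exists (ereal_sup [set (s y)%:E | y in D]) => B /nbhs_ereal_sides[lo _].
  set v := ereal_sup _ in lo.
  have vle y : D y -> ((s y)%:E <= v)%E by move=> Dy; apply: ereal_sup_ubound; exists y.
  case: lo => [vy|[b vb hb]].
    by have := vle e (in_open_e le_e lt_er); rewrite vy leeNy_eq.
  have [_ [a Da <-] ab] := ereal_sup_gt vb.
  rewrite /fmap /=; apply: filterS (tail_near a Da) => y [Dy /(_ jE) ya _].
  by apply: hb; [apply: lt_trans ab _; rewrite lte_fin scale_lt|exact: vle].
Qed.

Lemma scale_cvg_end j : is_end l r j -> sv j \is a fin_num ->
  s y @[y --> inner l r j] --> fine (sv j).
Proof.
move=> jend jfin; have PF := inner_proper le_e lt_er jend.
have := scale_cvg_value jend; rewrite -{1}(fineK jfin).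
by move=> /fine_cvgP[_]; apply: cvg_trans; apply: near_eq_cvg; exact: nearW.
Qed.

Lemma scale_value_left_lt x : D x -> (sv l < (s x)%:E)%E.
Proof.
move=> Dx; have lend : is_end l r l by left.
have PF := inner_proper le_e lt_er lend.
have /in_openP[lx xr] := Dx.
have [c lc cx] := ereal_between lx.
have Dc : D c%:E by apply/in_openP; split => //; exact: lt_trans xr.
apply: (@le_lt_trans _ _ (s c%:E)%:E); last by rewrite lte_fin scale_lt.
apply: (cvge_to_le (scale_cvg_value lend)).
apply: filterS (inner_tail le_e lt_er lend Dc) => y [Dy _ /(_ erefl) yc].
by rewrite lee_fin ltW// scale_lt.
Qed.

Lemma scale_value_right_gt x : D x -> ((s x)%:E < sv r)%E.
Proof.
move=> Dx; have rend : is_end l r r by right.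
have PF := inner_proper le_e lt_er rend.
have /in_openP[lx xr] := Dx.
have [c xc cr] := ereal_between xr.
have Dc : D c%:E by apply/in_openP; split => //; exact: lt_trans xc.
apply: (@lt_le_trans _ _ (s c%:E)%:E); first by rewrite lte_fin scale_lt.
apply: (cvge_to_ge (scale_cvg_value rend)).
apply: filterS (inner_tail le_e lt_er rend Dc) => y [Dy /(_ erefl) yc _].
by rewrite lee_fin ltW// scale_lt.
Qed.

Lemma scale_value_left_fin : (sv l \is a fin_num) = (-oo < sv l)%E.
Proof.
rewrite fin_numE -ltNye; case: (ltP -oo%E (sv l)) => // _ /=.
have := scale_value_left_lt (in_open_e le_e lt_er).
by case: (sv l) => [t||] //=; rewrite ltNge leey.
Qed.

Lemma scale_value_right_fin : (sv r \is a fin_num) = (sv r < +oo)%E.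
Proof.
have := scale_value_right_gt (in_open_e le_e lt_er).
by case: (sv r) => [t||] //=; rewrite ?ltry// ltNge leNye.
Qed.

Lemma scale_IVT x y (t : R) : D x -> D y -> (x <= y)%E -> s x <= t <= s y ->
  exists z, [/\ D z, (x <= z)%E, (z <= y)%E & s z = t].
Proof.
move=> Dx Dy xy /andP[xt ty].
have xfin := fineK (in_open_fin Dx); have yfin := fineK (in_open_fin Dy).
have fxy : fine x <= fine y by rewrite -lee_fin xfin yfin.
have [||z zxy zt] := @IVT R (fun u => s u%:E) (fine x) (fine y) t fxy.
- apply: continuous_in_subspaceT => u /set_mem/=; rewrite in_itv /= => /andP[xu uy].
  apply: (@cvg_comp _ _ _ EFin s _ (nbhs u%:E)); first exact: continuous_EFin.
  apply: scale_function_continuous; apply: in_open_between Dx Dy _ _.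
  + by rewrite -xfin lee_fin.
  + by rewrite -yfin lee_fin.
- rewrite xfin yfin min_l ?scale_le// max_r ?scale_le//; exact/andP.
move: zxy; rewrite in_itv /= => /andP[xz zy].
have xzE : (x <= z%:E)%E by rewrite -xfin lee_fin.
have zyE : (z%:E <= y)%E by rewrite -yfin lee_fin.
by exists z%:E; split => //; exact: in_open_between Dx Dy xzE zyE.
Qed.

Lemma measurable_fun_open (f : \bar R -> R) :
  (forall x, D x -> f y @[y --> x] --> f x) -> measurable_fun D f.
Proof.
move=> cf; pose A : set R := EFin @^-1` D.
have oA : open A by apply: open_comp (@open_open R l r) => t _; exact: continuous_EFin.
apply: (@eq_measurable_fun _ _ _ _ _ ((fun t => f t%:E) \o fine)).
  by move=> x; rewrite inE => Dx /=; rewrite fineK ?(in_open_fin Dx).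
apply: (@measurable_comp _ _ _ _ _ _ A) => //.
- exact: open_measurable.
- by move=> _ [x Dx <-]; rewrite /A /= fineK//; exact: in_open_fin Dx.
- apply: open_continuous_measurable_fun => // t /set_mem At.
  by apply: (@cvg_comp _ _ _ EFin f _ (nbhs t%:E)); [exact: continuous_EFin|exact: cf].
- by apply: fine_measurable; exact: measurable_open.
Qed.

Lemma measurable_scale : measurable_fun D s.
Proof. by apply: measurable_fun_open => x; exact: scale_function_continuous. Qed.

End scale_functions.

(** * The scale measure *)
Section scale_measure.
Context {R : realType}.
Variables (l r e : \bar R) (s : \bar R -> R).
Variable ds : {measure set (\bar R) -> \bar R}.
Hypotheses (le_e : (l < e)%E) (lt_er : (e < r)%E) (hs : scale_function l r e s).
Hypothesis hds : is_scale_measure l r s ds.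
Implicit Types (x y z j a : \bar R).

Local Notation D := (`]l, r[%classic : set (\bar R)).
Local Notation leb := (@lebesgue_measure R).

Lemma scale_measure_itv x y : D x -> D y -> (x <= y)%E ->
  ds `]x, y]%classic = (s y - s x)%:E.
Proof.
by move=> /in_openP[lx _] /in_openP[_ yr] xy; case: hds => _; apply.
Qed.

Lemma scale_measure_fin x y : D x -> D y -> (ds `]x, y]%classic < +oo)%E.
Proof.
move=> Dx Dy; have [xy|yx] := leP x y; first by rewrite scale_measure_itv// ltry.
by rewrite set_itv_ge ?measure0// -leNgt bnd_simp ltW.
Qed.

Section change_of_variables.
Variables x y : \bar R.
Hypotheses (Dx : D x) (Dy : D y) (xy : (x <= y)%E).

(** Outside the interval, [s] is given a value that is avoided by the half-open
   target interval. *)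
Let phi z : measurableTypeR R := if z \in D then s z else s x.

Let mphi : measurable_fun setT phi.
Proof.
move=> _ B mB; rewrite setTI.
have mDB : measurable (D `&` s @^-1` B).
  by apply: (measurable_scale hs) => //; exact: measurable_open.
have phiD z : D z -> phi z = s z by move=> Dz; rewrite /phi mem_set.
have phinD z : ~ D z -> phi z = s x by move=> Dz; rewrite /phi memNset.
have [Bx|nBx] := pselect (B (s x)).
  rewrite (_ : _ @^-1` _ = (D `&` s @^-1` B) `|` ~` D).
    by apply: measurableU => //; apply: measurableC; exact: measurable_open.
  apply/seteqP; split => z /=.
    by have [Dz|Dz] := pselect (D z); [rewrite phiD//; left|right].
  by move=> [[Dz Bz]|Dz]; [rewrite phiD|rewrite phinD].
rewrite (_ : _ @^-1` _ = D `&` s @^-1` B)//.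
apply/seteqP; split => z /=.
  by have [Dz|Dz] := pselect (D z); [rewrite phiD|rewrite phinD].
by move=> [Dz Bz]; rewrite phiD.
Qed.

Let nu : {measure set (measurableTypeR R) -> \bar R} :=
  measure_function_pushforward__canonical__measure_function_Measure ds mphi.

Let phi_preimage (a b : R) : s x <= a -> b <= s y ->
  phi @^-1` `]a, b]%classic = `]x, y]%classic `&` [set z | a < s z <= b].
Proof.
move=> xa by_; apply/seteqP; split => z; rewrite /phi /= !in_itv /=.
  case: ifPn => [|_]; last by move=> /andP[h _]; have := lt_le_trans h (le_trans xa _); lra.
  rewrite inE => Dz /andP[az zb]; rewrite az zb; split => //.
  rewrite -(scale_lt_mono hs Dx Dz) -(scale_le_mono hs Dz Dy).
  by rewrite (le_lt_trans xa az) (le_trans zb by_).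
move=> [/andP[xz zy] ab]; rewrite ifT// inE.
exact: in_open_between Dx Dy (ltW xz) zy.
Qed.

(** The scale takes every value between [s x] and [s y], so the preimage of a
   half-open interval is again one, and both measures agree on it. *)
Let scale_measure_phi (A : set (measurableTypeR R)) : measurable A ->
  A `<=` `]s x, s y]%classic -> ds (phi @^-1` A) = leb A.
Proof.
move=> mA Axy; have mI : measurable (`]s x, s y]%classic : set (measurableTypeR R)).
  exact: measurable_itv.
pose m1 : {measure set (measurableTypeR R) -> \bar R} := mrestr nu mI.
pose m2 : {measure set (measurableTypeR R) -> \bar R} := mrestr leb mI.
suff H : m1 A = m2 A.
  by move: H; rewrite /m1 /m2 /= /mrestr setIidl.
refine (@measure_unique _ R (measurableTypeR R) (@ocitv R) (fun n : nat => `]- n%:R, n%:R]%classic) erefl _ _ _ m1 m2 _ _ A mA).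
- exact: ocitvI.
- by move=> n; exact: is_ocitv.
- apply/seteqP; split => // t _; exists (Num.trunc `|t|).+1 => //=; rewrite in_itv /=.
  have := truncnS_gt `|t|; rewrite ltr_norml => /andP[-> h]; exact: ltW.
- move=> _ [[a b] _ <-] /=; rewrite /m1 /m2 /= /mrestr /=.
  rewrite (_ : `]a, b]%classic `&` _ = `]Num.max a (s x), Num.min b (s y)]%classic); last first.
    apply/seteqP; split => t /=; rewrite !in_itv /= gt_max le_min.
      by move=> [/andP[-> ->] /andP[-> ->]].
    by move=> /andP[/andP[-> ->] /andP[-> ->]].
  set a' := Num.max _ _; set b' := Num.min _ _.
  have [ba|ab] := leP b' a'.
    by rewrite set_itv_ge ?bnd_simp -?leNgt// /pushforward preimage_set0 !measure0.
  have sxa : s x <= a' by rewrite le_max lexx orbT.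
  have bsy : b' <= s y by rewrite ge_min lexx orbT.
  have [x' [Dx' _ _ x'E]] : exists z, [/\ D z, (x <= z)%E, (z <= y)%E & s z = a'].
    by apply: (scale_IVT hs Dx Dy xy); rewrite sxa (le_trans (ltW ab)).
  have [y' [Dy' _ _ y'E]] : exists z, [/\ D z, (x <= z)%E, (z <= y)%E & s z = b'].
    by apply: (scale_IVT hs Dx Dy xy); rewrite bsy (le_trans sxa (ltW ab)).
  have xy' : (x' <= y')%E by rewrite -(scale_le_mono hs)// x'E y'E ltW.
  rewrite /pushforward phi_preimage//.
  rewrite (_ : _ `&` _ = `]x', y']%classic).
    by rewrite scale_measure_itv// x'E y'E lebesgue_measure_oc// ltW.
  apply/seteqP; split => z /=; rewrite !in_itv /=.
    move=> [/andP[xz zy] /andP[az zb]]; have Dz := in_open_between Dx Dy (ltW xz) zy.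
    by rewrite -(scale_lt_mono hs Dx' Dz) -(scale_le_mono hs Dz Dy') x'E y'E az.
  move=> /andP[xz zy]; have Dz := in_open_between Dx' Dy' (ltW xz) zy.
  have az : a' < s z by rewrite -x'E (scale_lt_mono hs).
  have zb : s z <= b' by rewrite -y'E (scale_le_mono hs).
  rewrite -(scale_lt_mono hs Dx Dz) -(scale_le_mono hs Dz Dy) az zb.
  by rewrite (le_lt_trans sxa az) (le_trans zb bsy).
- move=> n; rewrite /m1 /= /mrestr /= /pushforward.
  apply: le_lt_trans (scale_measure_fin Dx Dy); apply: le_measure.
  + by rewrite inE -[X in measurable X]setTI; apply: mphi => //; apply: measurableI => //; exact: measurable_itv.
  + by rewrite inE; exact: emeasurable_itv.
  + apply: (@subset_trans _ (phi @^-1` `]s x, s y]%classic)); first by apply: preimage_subset.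
    by rewrite phi_preimage//; exact: subIsetl.
Qed.

Let phi_preimageI (B : set R) :
  phi @^-1` (B `&` `]s x, s y]%classic) = `]x, y]%classic `&` s @^-1` B.
Proof.
apply/seteqP; split => z.
  move=> [Bz /= zxy]; have : (phi @^-1` `]s x, s y]%classic) z by [].
  rewrite phi_preimage// => -[xyz _]; split => //.
  move: Bz; rewrite /phi ifT// inE; move: xyz; rewrite /= in_itv /= => /andP[xz zy].
  exact: in_open_between Dx Dy (ltW xz) zy.
move=> [xyz Bz]; move: (xyz); rewrite /= in_itv /= => /andP[xz zy].
have Dz := in_open_between Dx Dy (ltW xz) zy.
have phiz : phi z = s z by rewrite /phi mem_set.
split; rewrite /preimage /= phiz// in_itv /=.
by rewrite (scale_lt hs)// (scale_le hs).
Qed.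

Lemma scale_measure_preimage (B : set (measurableTypeR R)) : measurable B ->
  ds (`]x, y]%classic `&` s @^-1` B) = leb (B `&` `]s x, s y]%classic).
Proof.
move=> mB; rewrite -phi_preimageI scale_measure_phi//.
by apply: measurableI => //; exact: measurable_itv.
Qed.

Lemma scale_measure_null_itv (N : set (measurableTypeR R)) : measurable N -> leb N = 0%E ->
  ds (`]x, y]%classic `&` s @^-1` N) = 0%E.
Proof.
move=> mN N0; rewrite scale_measure_preimage//.
apply: subset_measure0 N0 => //; first by apply: measurableI => //; exact: measurable_itv.
Qed.

Lemma scale_measure_level_itv (a b : R) : a <= b ->
  (ds (`]x, y]%classic `&` [set z | (a < s z <= b)%R]) <= (b - a)%:E)%E.
Proof.
move=> ab.
have -> : [set z | (a < s z <= b)%R] = s @^-1` `]a, b]%classic.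
  by apply/seteqP; split => z /=; rewrite in_itv.
rewrite scale_measure_preimage; last exact: measurable_itv.
rewrite -lebesgue_measure_oc//; apply: le_measure; rewrite ?inE.
- by apply: measurableI => //; exact: measurable_itv.
- exact: measurable_itv.
- exact: subIsetl.
Qed.

Let nu_leb (f : measurableTypeR R -> \bar R) :
  (\int[nu]_(t in `]s x, s y]) f t = \int[leb]_(t in `]s x, s y]) f t)%E.
Proof.
by apply: eq_measure_integral => A mA Axy; exact: scale_measure_phi.
Qed.

Let preimage_full : phi @^-1` `]s x, s y]%classic = `]x, y]%classic.
Proof.
by have := phi_preimageI setT; rewrite setTI preimage_setT setIT.
Qed.

Lemma scale_integral (h : R -> R) : leb.-integrable setT (EFin \o h) ->
  ds.-integrable `]x, y]%classic (EFin \o (h \o s)) /\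
  \int[ds]_(z in `]x, y]%classic) h (s z) = \int[leb]_(t in `]s x, s y]) h t.
Proof.
move=> ih; have mI : measurable (`]s x, s y]%classic : set (measurableTypeR R)).
  exact: measurable_itv.
have mh : measurable_fun setT (EFin \o h : measurableTypeR R -> \bar R).
  exact: measurable_int ih.
have phiE z : z \in `]x, y]%classic -> phi z = s z.
  rewrite inE /= in_itv /= => /andP[xz zy].
  by rewrite /phi mem_set//; exact: in_open_between Dx Dy (ltW xz) zy.
have mxy : measurable (`]x, y]%classic : set (\bar R)) by exact: emeasurable_itv.
have iphi : ds.-integrable (phi @^-1` `]s x, s y]%classic) ((EFin \o h) \o phi).
  apply/integrableP; split.
    rewrite preimage_full; apply: measurable_funTS.
    exact: (measurableT_comp mh mphi).
  rewrite -(ge0_integral_pushforward mphi ds (f := fun t => `|(h t)%:E|)%E)//; last first.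
    by apply: measurable_funTS; exact: measurableT_comp.
  rewrite nu_leb; apply: le_lt_trans (proj2 (integrableP _ _ _ ih)).
  apply: ge0_subset_integral => //; exact: measurableT_comp.
split.
  move: iphi; rewrite preimage_full; apply: (eq_integrable mxy) => z zxy /=.
  by rewrite phiE.
rewrite /Rintegral -nu_leb; congr fine.
rewrite (integral_pushforward mphi mh iphi mI) preimage_full.
by apply: eq_integral => z zxy /=; rewrite phiE.
Qed.

End change_of_variables.

Lemma open_setI_exhaustion (A : set (\bar R)) :
  D `&` A = \bigcup_n (exhaustion l r e n `&` A).
Proof. by rewrite -setI_bigcupl bigcup_exhaustion. Qed.

(** A bound for the trace of a set on every compact part of the interval is a
   bound for the whole of it. *)
Lemma exhaustion_measure_le (mu : {measure set (\bar R) -> \bar R}) (A : set (\bar R)) (c : \bar R) :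
  measurable (D `&` A) ->
  (forall x y, D x -> D y -> (x <= y)%E -> (mu (`]x, y]%classic `&` A) <= c)%E) ->
  (mu (D `&` A) <= c)%E.
Proof.
move=> mA H; pose F n := exhaustion l r e n `&` A.
have mF n : measurable (F n).
  have -> : F n = exhaustion l r e n `&` (D `&` A).
    by rewrite setIA (setIidl (@exhaustion_sub _ _ _ _ le_e lt_er n)).
  by apply: measurableI => //; exact: measurable_exhaustion.
have ndF : {homo F : n k / (n <= k)%N >-> (n <= k)%O}.
  by move=> n k nk; apply/subsetPset; apply: setSI; exact: exhaustion_nd.
have mbF : measurable (\bigcup_n F n) by rewrite -open_setI_exhaustion.
have cv := nondecreasing_cvg_mu (mu := mu) mF mbF ndF.
rewrite open_setI_exhaustion -(cvg_lim _ cv)//.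
apply: lime_le; first by apply/cvg_ex; exists (mu (\bigcup_n F n)).
apply: nearW => n /=; apply: H.
- exact: in_open_left_point.
- exact: in_open_right_point.
- exact: left_right_point.
Qed.

Lemma scale_measure_null (N : set (measurableTypeR R)) : measurable N -> leb N = 0%E ->
  ds (D `&` s @^-1` N) = 0%E.
Proof.
move=> mN N0; apply/eqP; rewrite eq_le measure_ge0 andbT.
apply: exhaustion_measure_le.
  by apply: (measurable_scale hs) => //; exact: measurable_open.
by move=> x y Dx Dy xy; rewrite scale_measure_null_itv.
Qed.

Lemma scale_measure_level (a b : R) : a <= b ->
  (ds (D `&` [set z | (a < s z <= b)%R]) <= (b - a)%:E)%E.
Proof.
move=> ab; apply: exhaustion_measure_le.
  have -> : [set z | (a < s z <= b)%R] = s @^-1` `]a, b]%classic.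
    by apply/seteqP; split => z /=; rewrite in_itv.
  by apply: (measurable_scale hs) => //; exact: measurable_open.
by move=> x y Dx Dy xy; exact: scale_measure_level_itv.
Qed.

Lemma ae_scale (P : R -> Prop) : {ae leb, forall t, P t} ->
  {ae ds, forall x, D x -> P (s x)}.
Proof.
move=> [N [mN N0 PN]]; exists (D `&` s @^-1` N); split.
- by apply: (measurable_scale hs) => //; exact: measurable_open.
- exact: scale_measure_null.
- by move=> x /= /not_implyP[Dx nP]; split => //; exact: PN.
Qed.

(** The complement of the open interval is null for [ds], whatever [A] is. *)
Lemma ae_open (A : set (\bar R)) (P : \bar R -> Prop) :
  {ae ds, forall x, D x -> P x} -> {ae ds, forall x, A x -> P x}.
Proof.
move=> [N [mN N0 PN]]; exists (N `|` ~` D); split.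
- by apply: measurableU => //; apply: measurableC; exact: measurable_open.
- rewrite measureU0//; last by case: hds.
  by apply: measurableC; exact: measurable_open.
- move=> x /= /not_implyP[Ax nP]; have [Dx|Dx] := pselect (D x); last by right.
  by left; apply: PN => /= /(_ Dx).
Qed.

(** Upper half-lines are stable under intersection and generate the Borel sets, so
   the integral of [p] vanishes over every Borel subset of [E]. *)
Lemma dynkin_integral0 (E : set (\bar R)) (p : \bar R -> R) : measurable E ->
  ds.-integrable E (EFin \o p) -> \int[ds]_(x in E) p x = 0 ->
  (forall c : R, \int[ds]_(x in E `&` [set x | (c%:E < x)%E]) p x = 0) ->
  ae_eq ds E (EFin \o p) (cst 0%E).
Proof.
move=> mE ip E0 Ec.
pose P (A : set (\bar R)) := (\int[ds]_(x in E `&` A) (p x)%:E)%E = 0%E.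
have iA A : measurable A -> ds.-integrable (E `&` A) (EFin \o p).
  by move=> mA; apply: integrableS ip => //; exact: measurableI.
have toE A : measurable A -> \int[ds]_(x in E `&` A) p x = 0 -> P A.
  move=> mA; rewrite /Rintegral /P => h.
  by rewrite -[LHS]fineK ?h//; apply: integrable_fin_num; [exact: measurableI|exact: iA].
have PE A : measurable A -> P A.
  move=> mA; apply: (dynkin_induction (G := @ErealGenOInfty.G R) (P := P)).
  - exact: ErealGenOInfty.measurableE.
  - move=> _ _ [a ->] [b ->]; exists (Num.max a b); apply/seteqP; split => x /=;
      rewrite !in_itv /= !andbT EFin_max gt_max; first by move=> [-> ->].
    by move=> /andP[-> ->].
  - by apply: toE => //; rewrite setIT.
  - move=> _ [c ->]; apply: toE; first exact: emeasurable_itv.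
    rewrite -[RHS](Ec c); congr Rintegral; congr (_ `&` _).
    by apply/seteqP; split => x /=; rewrite in_itv /= andbT.
  - move=> S mS PS.
    have : (\int[ds]_(x in E) (p x)%:E)%E = 0%E by have := toE setT measurableT; rewrite /P setIT; apply.
    rewrite -{1}(setIT E) -(setUv S) setIUr integral_setU//.
    + by rewrite [X in (X + _)%E]PS add0e.
    + exact: measurableI.
    + by apply: measurableI => //; exact: measurableC.
    + by rewrite -setIUr setUv setIT; exact: measurable_int ip.
    + by apply/disj_setPS => x [[_ Sx] [_ nSx]]; exact: (nSx Sx).
  - move=> F mF tF PF; rewrite /P setI_bigcupr integral_bigcup.
    + by apply: eseries0 => n _ _; exact: PF.
    + exact: trivIset_setIl.
    + by move=> n; exact: measurableI.
    + by rewrite -setI_bigcupr; apply: iA; exact: bigcup_measurable.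
  - by move: mA; rewrite /measurable /= ErealGenOInfty.measurableE.
apply: integral_ae_eq => // A AE mA; rewrite [RHS]integral0.
by have := PE A mA; rewrite /P (setIidr AE).
Qed.

Lemma scale_density_unique (p : \bar R -> R) :
  (forall x y, D x -> D y -> (x <= y)%E -> ds.-integrable `]x, y]%classic (EFin \o p)) ->
  (forall x y, D x -> D y -> (x <= y)%E -> \int[ds]_(z in `]x, y]%classic) p z = 0) ->
  ae_eq ds D p (cst 0).
Proof.
move=> ip p0.
have H n : ds.-negligible (exhaustion l r e n `&` [set x | p x != 0]).
  have Dx := in_open_left_point le_e lt_er n; have Dy := in_open_right_point le_e lt_er n.
  have xy := left_right_point le_e lt_er n.
  have [||N [mN N0 hN]] := dynkin_integral0 (measurable_exhaustion l r e n) (ip _ _ Dx Dy xy).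
  - exact: p0.
  - move=> c; rewrite (_ : _ `&` _ = `]Order.max c%:E (left_point l e n), right_point r e n]%classic); last first.
      by apply/seteqP; split => x; rewrite /exhaustion /= !in_itv /= gt_max;
        [move=> [/andP[-> ->] ->]|move=> /andP[/andP[-> ->] ->]].
    have [h|h] := leP (Order.max c%:E (left_point l e n)) (right_point r e n).
      apply: p0 => //; apply: in_open_between Dx Dy _ h.
      by rewrite le_max lexx orbT.
    by rewrite set_itv_ge ?Rintegral_set0// -leNgt bnd_simp ltW.
  exists N; split => // x [xn /= px]; apply: hN => /= /(_ xn) [] px0.
  by rewrite px0 eqxx in px.
have [N [mN N0 hN]] := negligible_bigcup H; exists N; split => //.
move=> x /= /not_implyP[Dx /eqP px]; apply: hN.
by rewrite -open_setI_exhaustion.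
Qed.

End scale_measure.

(** * Functions with a derivative along the scale *)
Section scale_densities.
Context {R : realType}.
Variables (l r e : \bar R) (I : set (\bar R)) (s : \bar R -> R).
Variable ds : {measure set (\bar R) -> \bar R}.
Hypotheses (hI : interval_with_endpoints l r I).
Hypotheses (le_e : (l < e)%E) (lt_er : (e < r)%E) (hs : scale_function l r e s).
Hypothesis hds : is_scale_measure l r s ds.
Implicit Types (x y z j a : \bar R) (u f p : \bar R -> R).

Local Notation D := (`]l, r[%classic : set (\bar R)).
Local Notation sv := (scale_value l r s).
Local Notation L2 := (L2fun ds I).
Local Notation "<< p , q >>" := (inner_product ds I p q).

Lemma open_sub_I : D `<=` I. Proof. by case: hI. Qed.

Lemma in_I_cases x : I x -> D x \/ is_end l r x.
Proof.
case: hI => _ _ h /h /=; rewrite in_itv /= => /andP[].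
rewrite le_eqVlt => /predU1P[<-|lx]; first by right; left.
by rewrite le_eqVlt => /predU1P[->|xr]; [right; right|left; apply/in_openP].
Qed.

Lemma I_decomp (A : set (\bar R)) : A `<=` I ->
  A = (A `&` D) `|` ((A `&` [set l]) `|` (A `&` [set r])).
Proof.
move=> AI; apply/seteqP; split => x; last by move=> [[]|[[]|[]]].
move=> Ax; have [Dx|[xl|xr]] := in_I_cases (AI _ Ax); first by left.
  by right; left.
by right; right.
Qed.

Lemma measurable_setI1 (A : set (\bar R)) x : measurable (A `&` [set x]).
Proof.
have [Ax|Ax] := pselect (A x).
  rewrite (_ : _ `&` _ = [set x]); first exact: emeasurable_set1.
  by apply/seteqP; split => z; [case|move=> ->].
rewrite (_ : _ `&` _ = set0)//; apply/seteqP; split => z // -[Az zx].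
by apply: Ax; rewrite -zx.
Qed.

Lemma measurable_I : measurable I.
Proof.
rewrite (I_decomp (@subset_refl _ I)) (setIidr open_sub_I).
by apply: measurableU; [exact: measurable_open|apply: measurableU; exact: measurable_setI1].
Qed.

(** [I] adds at most two points to the open interval. *)
Lemma measurable_fun_I f : measurable_fun D f -> measurable_fun I f.
Proof.
move=> mf _ B mB; rewrite (I_decomp (@subIsetl _ I (f @^-1` B))).
apply: measurableU; last by apply: measurableU; exact: measurable_setI1.
rewrite setIAC (setIidr open_sub_I); apply: mf => //; exact: measurable_open.
Qed.

Lemma measurable_itv_oc x y : measurable (`]x, y]%classic : set (\bar R)).
Proof. exact: emeasurable_itv. Qed.

Lemma itv_sub_open x y : D x -> D y -> `]x, y]%classic `<=` D.
Proof.
move=> Dx Dy z; rewrite /= in_itv /= => /andP[xz zy].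
exact: in_open_between Dx Dy (ltW xz) zy.
Qed.

Lemma itv_sub_I x y : D x -> D y -> `]x, y]%classic `<=` I.
Proof. by move=> Dx Dy; apply: subset_trans (itv_sub_open Dx Dy) open_sub_I. Qed.

(** [p] is the derivative of [u] with respect to the scale, in integrated form. *)
Definition scale_density u p := L2 p /\
  forall x y, D x -> D y -> (x <= y)%E -> \int[ds]_(z in `]x, y]%classic) p z = u y - u x.

Lemma L2_integrable_itv x y p : D x -> D y -> L2 p ->
  ds.-integrable `]x, y]%classic (EFin \o p).
Proof.
move=> Dx Dy; apply: (L2fun_integrable measurable_I).
- exact: measurable_itv_oc.
- exact: itv_sub_I.
- exact: (scale_measure_fin hds).
Qed.

Lemma scale_density_holder u p x y : scale_density u p -> D x -> D y ->
  (u y - u x) ^+ 2 <= <<p, p>> * `|s y - s x|.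
Proof.
move=> [hp up]; wlog xy : x y / (x <= y)%E => [wl|] Dx Dy.
  have [xy|/ltW yx] := leP x y; first exact: wl.
  by rewrite -sqrrN opprB -normrN opprB; exact: wl.
rewrite -up// ger0_norm ?subr_ge0 ?(scale_le hs)//.
rewrite -[s y - s x]/(fine (s y - s x)%:E) -(scale_measure_itv hds)//.
apply: sqr_Rintegral_le => //.
- exact: measurable_I.
- exact: measurable_itv_oc.
- exact: itv_sub_I.
- exact: (scale_measure_fin hds).
Qed.

Lemma scale_density_unique_ae u p p' : scale_density u p -> scale_density u p' ->
  ae_eq ds I p p'.
Proof.
move=> [hp up] [hp' up'].
have := @scale_density_unique R l r e ds le_e lt_er (fun x => p x - p' x).
case=> [x y Dx Dy xy|x y Dx Dy xy|N hN].
- by apply: L2_integrable_itv => //; apply: (L2funB measurable_I).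
- rewrite RintegralB ?up ?up' ?subrr//; first exact: measurable_itv_oc.
  + exact: L2_integrable_itv.
  + exact: L2_integrable_itv.
apply: (ae_open hds); exists N => //; case: hN => mN N0 hN; split => //.
move=> x /= /not_implyP[Dx pp']; apply: hN => /= /(_ Dx) /eqP.
by rewrite subr_eq0 => /eqP.
Qed.

(** A bound on increments by the square root of an increment of [s], which is
   what an element of finite energy satisfies. *)
Definition scale_holder u C := forall x y, D x -> D y -> (u y - u x) ^+ 2 <= C * `|s y - s x|.

Lemma sqr_lt_norm_lt (a b : R) : 0 < b -> a ^+ 2 < b ^+ 2 -> `|a| < b.
Proof.
move=> b0; rewrite -[a ^+ 2]real_normK ?num_real// ltr_pXn2r// nnegrE ?normr_ge0//.
exact: ltW.
Qed.

Lemma scale_holder_continuous u C x : scale_holder u C -> D x -> u y @[y --> x] --> u x.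
Proof.
move=> hu Dx; apply/cvgrPdist_lt => eps eps0.
pose K := `|C| + 1; have K0 : 0 < K by rewrite /K; have := normr_ge0 C; lra.
have d0 : 0 < eps ^+ 2 / K by rewrite divr_gt0// exprn_gt0.
have /cvgrPdist_lt/(_ _ d0) := scale_function_continuous hs Dx.
have nD : \forall y \near x, D y by apply: open_nbhs_nbhs; split => //; exact: open_open.
move: nD; apply: filterS2 => y Dy; rewrite ltr_pdivlMr// => h.
rewrite distrC; apply: sqr_lt_norm_lt => //; apply: le_lt_trans (hu _ _ Dx Dy) _.
apply: le_lt_trans h; rewrite distrC mulrC; apply: ler_wpM2l => //.
by rewrite /K; have := ler_norm C; lra.
Qed.

(** Where the scale has a finite limit, a function of finite energy has one as
   well, and it is attained at an explicit rate. *)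
Lemma scale_holder_end u C j : scale_holder u C -> is_end l r j -> sv j \is a fin_num ->
  exists2 v : R, u y @[y --> inner l r j] --> v &
    forall y, D y -> (u y - v) ^+ 2 <= C * `|s y - fine (sv j)|.
Proof.
move=> hu jend jfin; have PF := inner_proper le_e lt_er jend.
have sj := scale_cvg_end le_e lt_er hs jend jfin.
have inD : \forall y \near inner l r j, D y by exact: inner_open.
have [v hv] : exists v : R, u y @[y --> inner l r j] --> v.
  apply/cvg_ex/cauchy_cvgP/cauchy_ballP => eps eps0.
  pose K := `|C| + 1; have K0 : 0 < K by rewrite /K; have := normr_ge0 C; lra.
  have d0 : 0 < eps ^+ 2 / K / 2 by rewrite !divr_gt0// exprn_gt0.
  have /cvgrPdist_lt/(_ _ d0) sd := sj.
  pose Q := [set y | D y /\ `|fine (sv j) - s y| < eps ^+ 2 / K / 2].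
  have nQ : inner l r j Q by near=> y; split; near: y.
  exists (u @` Q, u @` Q) => /=.
    by split; apply: filterS nQ => y Qy; exists y.
  move=> [_ _] /= [[x [Dx hx] <-] [y [Dy hy] <-]].
  rewrite /ball /= distrC; apply: sqr_lt_norm_lt => //.
  apply: le_lt_trans (hu _ _ Dx Dy) _.
  have h1 : `|s y - s x| < eps ^+ 2 / K.
    have -> : s y - s x = (fine (sv j) - s x) - (fine (sv j) - s y) by lra.
    apply: le_lt_trans (ler_normB _ _) _; lra.
  rewrite ltr_pdivlMr// in h1; apply: le_lt_trans h1; rewrite mulrC.
  by apply: ler_wpM2l => //; rewrite /K; have := ler_norm C; lra.
exists v => // y Dy.
have c1 : (u y - u x) ^+ 2 @[x --> inner l r j] --> (u y - v) ^+ 2.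
  have h : u y - u x @[x --> inner l r j] --> u y - v by apply: cvgB => //; exact: cvg_cst.
  by rewrite expr2; under eq_fun do rewrite expr2; exact: (cvgM h h).
have c2 : C * `|s y - s x| @[x --> inner l r j] --> C * `|s y - fine (sv j)|.
  apply: cvgM; first exact: cvg_cst.
  by apply: cvg_norm; apply: cvgB => //; exact: cvg_cst.
apply: (ler_cvg_to c1 c2); near=> x; apply: hu => //; near: x; exact: inD.
Unshelve. all: by end_near. Qed.

End scale_densities.

(** * Derivatives of functions that factor through the scale *)
Section domain_elements.
Context {R : realType}.
Variables (l r e : \bar R) (I : set (\bar R)) (s : \bar R -> R).
Variable ds : {measure set (\bar R) -> \bar R}.
Hypotheses (hI : interval_with_endpoints l r I).
Hypotheses (le_e : (l < e)%E) (lt_er : (e < r)%E) (hs : scale_function l r e s).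
Hypothesis hds : is_scale_measure l r s ds.
Implicit Types (x y z j a : \bar R) (u f p k : \bar R -> R).

Local Notation D := (`]l, r[%classic : set (\bar R)).
Local Notation L2 := (L2fun ds I).
Local Notation "<< p , q >>" := (inner_product ds I p q).
Local Notation J := (scale_range l r I s).
Local Notation derivative := (scale_derivative l r I s).

Lemma open_factor f g x : factors_through_scale l r I s f g -> D x -> f x = g (s x).
Proof.
move=> [_ fg] Dx; rewrite (fg _ (open_sub_I hI Dx)) (scale_valueE hs Dx)//.
Qed.

Lemma scale_range_itv x y : D x -> D y -> (x <= y)%E -> `[s x, s y]%classic `<=` J.
Proof.
move=> Dx Dy xy t; rewrite /= in_itv /= => /(scale_IVT hs Dx Dy xy)[z [Dz _ _ <-]].
exists z; last by rewrite (scale_valueE hs Dz).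
by split; [exact: (open_sub_I hI)|rewrite (scale_valueE hs Dz)].
Qed.

Lemma scale_range_near x : D x -> \forall t \near s x, J t.
Proof.
move=> Dx; have /in_openP[lx xr] := Dx.
have [a la ax] := ereal_between lx; have [b xb br] := ereal_between xr.
have Da : D a%:E by apply/in_openP; split => //; exact: lt_trans xr.
have Db : D b%:E by apply/in_openP; split => //; exact: lt_trans xb.
have ab : (a%:E <= b%:E)%E by apply/ltW/(lt_trans ax).
near=> t; apply: (scale_range_itv Da Db ab); rewrite /= in_itv /=.
by apply/andP; split; apply/ltW; near: t;
  [apply: lt_nbhsr|apply: lt_nbhsl]; exact: (scale_lt hs).
Unshelve. all: by end_near. Qed.

Lemma scale_factorP f : scale_abs_continuous l r I s f ->
  factors_through_scale l r I s f (scale_factor l r I s f).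
Proof. by move=> [g hg]; exact: (getPex (ex_intro _ g hg)). Qed.

Lemma factor_unique f g g' : factors_through_scale l r I s f g ->
  factors_through_scale l r I s f g' -> {in J, g =1 g'}.
Proof.
by move=> [_ fg] [_ fg'] t /set_mem[x [Ix xfin] <-]; rewrite -fg// -fg'.
Qed.

Lemma derive1_near_eq (g g' : R -> R) (t : R) : (\forall u \near t, g u = g' u) ->
  derive1 g t = derive1 g' t.
Proof. by move=> gg'; rewrite !derive1E; exact: near_eq_derive. Qed.

(** The factor selected by the definition agrees with any other one on the scale
   range, which is a neighbourhood of [s x]. *)
Lemma scale_derivativeE f g x : factors_through_scale l r I s f g -> D x ->
  derivative f x = derive1 g (s x).
Proof.
move=> fg Dx; rewrite /scale_derivative (scale_valueE hs Dx) /=.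
apply: derive1_near_eq; apply: filterS (scale_range_near Dx) => t Jt.
exact: (factor_unique (scale_factorP (ex_intro _ g fg)) fg (mem_set Jt)).
Qed.

Lemma locally_abs_continuousB (g g' : R -> R) : locally_abs_continuous J g ->
  locally_abs_continuous J g' -> locally_abs_continuous J (fun t => g t - g' t).
Proof.
move=> hg hg' a b ab abJ eps eps0; have eps2 : 0 < eps / 2 by rewrite divr_gt0.
have [d1 d10 H1] := hg a b ab abJ _ eps2; have [d2 d20 H2] := hg' a b ab abJ _ eps2.
exists (Num.min d1 d2); first by rewrite lt_min d10.
move=> n p q hpq dpq; rewrite lt_min => /andP[l1 l2].
have := H1 n p q hpq dpq l1; have := H2 n p q hpq dpq l2.
suff : \sum_(i < n) `|g (q i) - g' (q i) - (g (p i) - g' (p i))| <=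
  \sum_(i < n) `|g (q i) - g (p i)| + \sum_(i < n) `|g' (q i) - g' (p i)| by lra.
rewrite -big_split /=; apply: ler_sum => i _.
have -> : g (q i) - g' (q i) - (g (p i) - g' (p i)) = (g (q i) - g (p i)) - (g' (q i) - g' (p i)) by lra.
exact: ler_normB.
Qed.

Lemma factors_throughB f k g g' : factors_through_scale l r I s f g ->
  factors_through_scale l r I s k g' ->
  factors_through_scale l r I s (f \- k) (fun t => g t - g' t).
Proof.
move=> [gac fg] [gac' kg']; split; first exact: locally_abs_continuousB.
by move=> x Ix xfin /=; rewrite fg// kg'.
Qed.

Lemma factor_FTC f g x y : factors_through_scale l r I s f g -> D x -> D y -> (x < y)%E ->
  exists h : R -> R, [/\ ds.-integrable `]x, y]%classic (EFin \o (h \o s)),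
    \int[ds]_(z in `]x, y]%classic) h (s z) = f y - f x
  & {ae ds, forall z, D z -> s x < s z < s y -> derivable g (s z) 1 /\ derive1 g (s z) = h (s z)}].
Proof.
move=> fg Dx Dy xy; have sxy := scale_lt hs Dx Dy xy.
have gac : abs_continuous_on g (s x) (s y).
  by apply: fg.1; [exact: ltW|exact: scale_range_itv (ltW xy)].
have [h [ih hE haw]] := abs_continuous_FTC sxy gac.
have [h1 h2] := scale_integral hs hds Dx Dy (ltW xy) ih.
exists h; split => //.
  by rewrite h2 hE ?(ltW sxy)// (open_factor fg Dx) (open_factor fg Dy).
exact: (ae_scale le_e lt_er hs hds haw).
Qed.

Lemma factor_ae_derivable f g : factors_through_scale l r I s f g ->
  {ae ds, forall z, D z -> derivable g (s z) 1}.
Proof.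
move=> fg.
have H n : ds.-negligible (exhaustion l r e n `&` [set z | ~ derivable g (s z) 1]).
  have Dx := in_open_left_point le_e lt_er n.
  have /in_openP[_ yr] := in_open_right_point le_e lt_er n.
  have [b yb br] := ereal_between yr.
  have xy := left_right_point le_e lt_er n.
  have Db : D b%:E.
    by apply/in_openP; split => //; move/in_openP: Dx => [lx _]; apply: lt_le_trans lx _; exact: le_trans xy (ltW yb).
  have [h [_ _ [N [mN N0 hN]]]] := factor_FTC fg Dx Db (le_lt_trans xy yb).
  exists N; split => // z [zn ngz]; apply: hN => /=.
  have Dz := exhaustion_sub le_e lt_er zn.
  move=> /(_ Dz); case; last by [].
  move: zn; rewrite /exhaustion /= in_itv /= => /andP[xz zy].
  rewrite !(scale_lt_mono hs)//; apply/andP; split => //.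
  exact: le_lt_trans zy yb.
have [N [mN N0 hN]] := negligible_bigcup H; exists N; split => //.
move=> z /= /not_implyP[Dz nz]; apply: hN.
by rewrite -open_setI_exhaustion.
Qed.

Lemma scale_derivativeB_ae f k : scale_abs_continuous l r I s f ->
  scale_abs_continuous l r I s k ->
  ae_eq ds I (derivative (f \- k)) (fun x => derivative f x - derivative k x).
Proof.
move=> /scale_factorP fg /scale_factorP kg; apply: (ae_open hds).
have af := factor_ae_derivable fg; have ak := factor_ae_derivable kg.
apply: filterS2 af ak => x df dk Dx.
rewrite (scale_derivativeE (factors_throughB fg kg) Dx).
rewrite (scale_derivativeE fg Dx) (scale_derivativeE kg Dx).
by rewrite !derive1E -deriveB//; [exact: df|exact: dk].
Qed.

(** The fundamental theorem of calculus in the scale variable, transported to [ds]. *)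
Lemma scale_density_derivative f : scale_abs_continuous l r I s f ->
  L2 (derivative f) -> scale_density l r I ds f (derivative f).
Proof.
move=> /scale_factorP fg hp; split => // x y Dx Dy.
rewrite le_eqVlt => /predU1P[->|xy].
  by rewrite set_itvoc0 Rintegral_set0 subrr.
have [h [ih hE hae]] := factor_FTC fg Dx Dy xy.
rewrite -hE /Rintegral; congr fine.
have ip := L2_integrable_itv hI hds Dx Dy hp.
apply: ae_eq_integral.
- exact: measurable_itv_oc.
- exact: measurable_int ip.
- exact: measurable_int ih.
(* The differentiability of the factor is known strictly between [s x] and [s y],
   which leaves out the point [y] of the half-open interval. *)
have y0 : {ae ds, forall z, z <> y}.
  exists [set y]; split; [exact: emeasurable_set1| |by move=> z /= /contrapT].
  apply/eqP; rewrite eq_le measure_ge0 andbT; apply/lee_addgt0Pr => eps eps0.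
  rewrite add0e.
  have [z [Dz xz zy sz]] : exists z, [/\ D z, (x <= z)%E, (z < y)%E & s y - s z <= eps].
    have sxy := scale_lt hs Dx Dy xy.
    have mx : s x <= Num.max (s x) (s y - eps) <= s y.
      by rewrite le_max lexx /= ge_max (ltW sxy) gerBl (ltW eps0).
    have [z [Dz xz zy sz]] := scale_IVT hs Dx Dy (ltW xy) mx.
    exists z; split => //.
    - by rewrite -(scale_lt_mono hs Dz Dy) sz gt_max sxy gtrBl.
    - have : s y - eps <= Num.max (s x) (s y - eps) by rewrite le_max lexx orbT.
      by rewrite sz; lra.
  apply: (@le_trans _ _ (ds `]z, y]%classic)).
    apply: le_measure; rewrite ?inE; [exact: emeasurable_set1|exact: measurable_itv_oc|].
    by move=> _ ->; rewrite /= in_itv /= zy lexx.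
  by rewrite (scale_measure_itv hds Dz Dy (ltW zy)) lee_fin.
apply: filterS2 hae y0 => z hz zy /=; rewrite in_itv /= => /andP[xz zley].
have Dz := in_open_between Dx Dy (ltW xz) zley.
have zlty : (z < y)%E by rewrite lt_neqAle zley andbT; apply/eqP.
have [] := hz Dz; first by rewrite !(scale_lt_mono hs)// xz.
by move=> _ <-; rewrite (scale_derivativeE fg Dz).
Qed.

Lemma inner_product_ae p p' : ae_eq ds I p p' -> <<p, p>> = <<p', p'>>.
Proof.
move=> pp'; rewrite /inner_product /Rintegral; congr fine.
apply: ge0_ae_eq_integral_nomeas.
- by move=> x _; rewrite lee_fin -expr2 sqr_ge0.
- by move=> x _; rewrite lee_fin -expr2 sqr_ge0.
by apply: filterS pp' => x /[apply] ->.
Qed.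

Lemma dirichlet_formE f k :
  dirichlet_form l r I s ds f k = 2^-1 * <<derivative f, derivative k>>.
Proof. by []. Qed.

Lemma dirichlet_formB f k : scale_abs_continuous l r I s f ->
  scale_abs_continuous l r I s k ->
  dirichlet_form l r I s ds (f \- k) (f \- k) =
  2^-1 * <<fun x => derivative f x - derivative k x, fun x => derivative f x - derivative k x>>.
Proof.
by move=> hf hk; rewrite dirichlet_formE (inner_product_ae (scale_derivativeB_ae hf hk)).
Qed.

Lemma scale_density_scale_holder f p : scale_density l r I ds f p ->
  scale_holder l r s f <<p, p>>.
Proof. by move=> fp x y; exact: (scale_density_holder hI hs hds fp). Qed.

End domain_elements.

(** * Feller integrals *)
Section feller_integrals.
Context {R : realType}.
Variables (l r e : \bar R).
Hypotheses (le_e : (l < e)%E) (lt_er : (e < r)%E).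
Implicit Types (x y z j c : \bar R) (mu nu : {measure set (\bar R) -> \bar R}).
Local Open Scope ereal_scope.


Definition segment x : set (\bar R) :=
  if e <= x then `]e, x]%classic else `]x, e]%classic.

Lemma measurable_segment x : measurable (segment x).
Proof. by rewrite /segment; case: ifP => _; exact: emeasurable_itv. Qed.

Lemma oriented_integral_cst1 nu x :
  oriented_integral nu e x (cst 1%E) = if e <= x then nu (segment x) else - nu (segment x).
Proof.
rewrite /oriented_integral /segment; case: ifP => _.
  by rewrite integral_cst ?mul1e//; exact: emeasurable_itv.
by rewrite integral_cst ?mul1e//; exact: emeasurable_itv.
Qed.

(** The two minus signs to the left of the base point cancel. *)
Lemma double_oriented_integral mu nu x :
  oriented_integral mu e x (fun y => oriented_integral nu e y (cst 1%E)) =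
  \int[mu]_(y in segment x) nu (segment y).
Proof.
rewrite [LHS]/oriented_integral; case: ifPn => ex.
  rewrite /segment ex; apply: eq_integral => y; rewrite inE /= in_itv /= => /andP[ey yx].
  by rewrite oriented_integral_cst1 /segment (ltW ey).
rewrite [segment x in RHS]/segment (negbTE ex).
transitivity (- (\int[mu]_(y in `]x, e]%classic) - nu (segment y))); last first.
  by rewrite integral_ge0N ?oppeK// => y _; exact: measure_ge0.
congr (- _); apply: eq_integral => y; rewrite inE /= in_itv /= => /andP[xy ye].
rewrite oriented_integral_cst1; case: ifPn => // ey.
have -> : y = e by apply/eqP; rewrite eq_le ye.
by rewrite /segment lexx set_itvoc0 measure0 oppe0.
Qed.

Lemma segment_sub x y : segment x y -> segment y `<=` segment x.
Proof.
rewrite /segment; case: ifPn => [ex|nex] /=; rewrite in_itv /= => /andP[h1 h2].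
  rewrite (ltW h1) => z /=; rewrite !in_itv /= => /andP[-> zy].
  exact: le_trans h2.
case: ifPn => [ey|_] z /=; rewrite !in_itv /= => /andP[h3 h4].
  by have := lt_le_trans h3 (le_trans h4 h2); rewrite ltxx.
by rewrite h4 andbT (lt_trans h1).
Qed.

Lemma double_oriented_integral_le mu nu x :
  oriented_integral mu e x (fun y => oriented_integral nu e y (cst 1%E)) <=
  nu (segment x) * mu (segment x).
Proof.
rewrite double_oriented_integral -integral_cst; last exact: measurable_segment.
apply: ge0_le_integral_nomeas => // y xy.
apply: le_measure; rewrite ?inE; [exact: measurable_segment..|exact: segment_sub].
Qed.

(** Beyond [c], the inner measure is at least that of the segment from [e] to [c]. *)
Lemma double_oriented_integral_ge mu nu x c : segment x c ->
  nu (segment c) * mu (segment x `\` segment c) <=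
  oriented_integral mu e x (fun y => oriented_integral nu e y (cst 1%E)).
Proof.
move=> xc; have mx := measurable_segment x; have mc := measurable_segment c.
rewrite double_oriented_integral -integral_cst; last exact: measurableD.
rewrite setDE integral_mkcondr; apply: ge0_le_integral_nomeas => [y _|y xy].
  by rewrite /patch; case: ifP.
rewrite /patch; case: ifPn => [/set_mem yc|_]; last exact: measure_ge0.
apply: le_measure; rewrite ?inE.
- exact: measurable_segment.
- exact: measurable_segment.
- move: xc xy yc; rewrite /segment; case: ifPn => [ex|ex] /=; rewrite !in_itv /= => /andP[h1 h2] /andP[h3 h4].
    rewrite (ltW h1) (ltW h3) /= in_itv /= h3 /= => /negP; rewrite -ltNge => cy z /=.
    by rewrite !in_itv /= => /andP[-> zc]; rewrite (le_trans zc (ltW cy)).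
  case: ifPn => [ec|ec].
    have -> : c = e by apply/eqP; rewrite eq_le h2.
    by rewrite set_itvoc0 => _ z.
  rewrite /= in_itv /= h4 andbT => /negP; rewrite -leNgt => yc z /=; rewrite in_itv /= => /andP[cz ze].
  case: ifPn => ey.
    by have := le_trans ey yc; rewrite (negbTE ec).
  by rewrite /= in_itv /= ze andbT (le_lt_trans yc).
Qed.

Lemma segment_tail j x : is_end l r j -> tail l r j e x -> segment x `<=` [set e] `|` tail l r j e.
Proof.
move=> jend [Dx xr xl] z; case: (jend) => jE; subst j.
  rewrite /segment leNgt (xl erefl) /= in_itv /= => /andP[xz].
  rewrite le_eqVlt => /predU1P[->|ze]; [by left|right].
  split => //; last by move/(end_neq le_e lt_er).
  exact: in_open_between Dx (in_open_e le_e lt_er) (ltW xz) (ltW ze).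
rewrite /segment (ltW (xr erefl)) /= in_itv /= => /andP[ez zx]; right.
split => //; last by move/esym/(end_neq le_e lt_er).
exact: in_open_between (in_open_e le_e lt_er) Dx (ltW ez) zx.
Qed.

Lemma lime_lty (F : set_system (\bar R)) (PF : ProperFilter F) (f : \bar R -> \bar R) (K : R) :
  (\forall x \near F, f x <= K%:E) -> lim (f x @[x --> F]) < +oo.
Proof.
move=> fK; have [cf|ncf] := pselect (cvg (f x @[x --> F])).
  by apply: (@le_lt_trans _ _ K%:E); [exact: lime_le|exact: ltry].
by rewrite (dvgP ncf) ltry.
Qed.

End feller_integrals.

(** * Classification of the ends *)
Section end_classification.
Context {R : realType}.
Variables (l r e : \bar R) (I : set (\bar R)) (s : \bar R -> R).
Variables (m ds : {measure set (\bar R) -> \bar R}).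
Hypotheses (hI : interval_with_endpoints l r I) (hm : radon_full_support I m).
Hypotheses (le_e : (l < e)%E) (lt_er : (e < r)%E) (hs : scale_function l r e s).
Hypothesis hds : is_scale_measure l r s ds.
Implicit Types (x y z j a c : \bar R).
Local Open Scope ereal_scope.

Local Notation D := (`]l, r[%classic : set (\bar R)).
Local Notation sv := (scale_value l r s).
Local Notation tail := (tail l r).

Lemma m_itv_fin x y : I x -> I y -> m `[x, y]%classic < +oo.
Proof.
move=> Ix Iy; case: hm => _ h _; apply: h; first exact: compact_ereal_itv.
move=> z; rewrite /= in_itv /= => /andP[xz zy].
have [Dz|zend] := pselect (D z); first exact: (open_sub_I hI).
have [xE|xz'] := eqVneq x z; first by rewrite -xE.
have [yE|yz'] := eqVneq z y; first by rewrite yE.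
exfalso; apply: zend; apply/in_openP; case: hI => _ _ hlr.
have /= := hlr _ Ix; have /= := hlr _ Iy; rewrite !in_itv /= => /andP[_ yr] /andP[lx _].
split; first by apply: le_lt_trans lx _; rewrite lt_neqAle xz'.
by apply: lt_le_trans yr; rewrite lt_neqAle yz'.
Qed.

Lemma measurable_tail j a : is_end l r j -> measurable (tail j a).
Proof.
have mD := @measurable_open R l r.
move=> [->|->].
- rewrite (_ : tail l a = D `&` [set x | x < a]).
    by apply: measurableI => //; rewrite -set_itvNyo; exact: emeasurable_itv.
  apply/seteqP; split => x; first by move=> [Dx _ /(_ erefl)].
  by move=> [Dx xa]; split => // lr; case: (end_neq le_e lt_er lr).
- rewrite (_ : tail r a = D `&` [set x | a < x]).
    by apply: measurableI => //; rewrite -set_itvoy; exact: emeasurable_itv.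
  apply/seteqP; split => x; first by move=> [Dx /(_ erefl)].
  by move=> [Dx xa]; split => // lr; case: (end_neq le_e lt_er (esym lr)).
Qed.

Lemma scale_measure_segment x : D x -> ds (segment e x) = `|s x - s e|%:E.
Proof.
move=> Dx; have De := in_open_e le_e lt_er; rewrite /segment; case: ifPn => [ex|].
  by rewrite (scale_measure_itv hds)// ger0_norm// subr_ge0 (scale_le hs).
rewrite -ltNge => /ltW xe; rewrite (scale_measure_itv hds)// distrC ger0_norm//.
by rewrite subr_ge0 (scale_le hs).
Qed.

(** Both iterated integrals are at most the product of the masses that [m] and [ds]
   give to the part of the interval between [e] and [j]. *)
Lemma regular_of_finite j : is_end l r j -> sv j \is a fin_num -> m (tail j e) < +oo ->
  regular_endpoint l r m ds e j.
Proof.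
move=> jend jfin mfin; have PF := inner_proper le_e lt_er jend.
have De := in_open_e le_e lt_er.
have me : m [set e] < +oo.
  by rewrite -set_itv1; apply: m_itv_fin; exact: (open_sub_I hI).
have mK : m ([set e] `|` tail j e) < +oo.
  apply: le_lt_trans (measureU2 _ _ _) _; [exact: emeasurable_set1|exact: measurable_tail|].
  exact: lte_add_pinfty.
have mK' : m ([set e] `|` tail j e) \is a fin_num by rewrite ge0_fin_numE.
pose C := (`|fine (sv j) - s e| + 1)%R.
have nds : \forall x \near inner l r j, ds (segment e x) <= C%:E.
  have sj := scale_cvg_end le_e lt_er hs jend jfin.
  have /cvgrPdist_lt/(_ _ ltr01) := sj.
  apply: filterS2 (inner_open l r j) => x Dx h; rewrite scale_measure_segment// lee_fin /C.
  have -> : (s x - s e = (fine (sv j) - s e) - (fine (sv j) - s x))%R by lra.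
  by apply: le_trans (ler_normB _ _) _; rewrite lerD2l ltW.
have nm : \forall x \near inner l r j, m (segment e x) <= m ([set e] `|` tail j e).
  apply: filterS (inner_tail le_e lt_er jend De) => x xt; apply: le_measure; rewrite ?inE.
  - exact: measurable_segment.
  - by apply: measurableU; [exact: emeasurable_set1|exact: measurable_tail].
  - exact: (segment_tail le_e lt_er jend).
have C0 : 0 <= C%:E by rewrite lee_fin /C addr_ge0.
split; apply: (@lime_lty _ _ _ _ (C * fine (m ([set e] `|` tail j e))%classic)%R).
- near=> x; apply: le_trans (double_oriented_integral_le _ _ _ _) _.
  rewrite EFinM fineK// muleC; apply: lee_pmul => //; near: x; assumption.
- near=> x; apply: le_trans (double_oriented_integral_le _ _ _ _) _.
  by rewrite EFinM fineK//; apply: lee_pmul => //; near: x; assumption.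
Unshelve. all: by end_near. Qed.

Lemma m_open_pos (U : set (\bar R)) : open U -> U `<=` D -> U !=set0 -> 0 < m U.
Proof.
move=> oU UD [x Ux]; case: hm => _ _ /(_ _ oU).
rewrite (setIidl (subset_trans UD (open_sub_I hI))); apply.
by exists x.
Qed.

(** By full support, [m] has some positive mass [k] between [e] and an interior
   point [c], so that [feller_sigma] grows at least like [k] times the scale. *)
Lemma regular_finite j : is_end l r j -> regular_endpoint l r m ds e j -> sv j \is a fin_num.
Proof.
move=> jend [reg _]; have PF := inner_proper le_e lt_er jend.
have De := in_open_e le_e lt_er.
have [c tc] := tail_neq0 le_e lt_er jend De; have Dc := tail_sub tc.
have mc0 : 0 < m (segment e c).
  case: (jend) tc => jE [_ ]; rewrite jE => cr cl; rewrite /segment.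
  - rewrite leNgt (cl erefl); apply: (@lt_le_trans _ _ (m `]c, e[%classic)).
      apply: m_open_pos; first exact: itv_open.
        by move=> z; rewrite /= in_itv /= => /andP[cz ze]; exact: in_open_between Dc De (ltW cz) (ltW ze).
      by have [t ct te] := ereal_between (cl erefl); exists t%:E; rewrite /= in_itv /= ct.
    apply: le_measure; rewrite ?inE; [exact: emeasurable_itv..|].
    by move=> z; rewrite /= !in_itv /= => /andP[-> /ltW].
  - rewrite (ltW (cr erefl)); apply: (@lt_le_trans _ _ (m `]e, c[%classic)).
      apply: m_open_pos; first exact: itv_open.
        by move=> z; rewrite /= in_itv /= => /andP[cz ze]; exact: in_open_between De Dc (ltW cz) (ltW ze).
      by have [t ct te] := ereal_between (cr erefl); exists t%:E; rewrite /= in_itv /= ct.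
    apply: le_measure; rewrite ?inE; [exact: emeasurable_itv..|].
    by move=> z; rewrite /= !in_itv /= => /andP[-> /ltW].
apply: contrapT => jinf.
suff : feller_sigma m ds e x @[x --> inner l r j] --> +oo.
  by move=> /(cvg_lim (@ereal_hausdorff R)) E; rewrite E in reg.
(* Truncating the mass at 1 makes it a real number. *)
pose k := fine (mine (m (segment e c)) 1).
have kE : k%:E = mine (m (segment e c)) 1.
  rewrite fineK// ge0_fin_numE; last by rewrite le_min measure_ge0 lee01.
  by rewrite gt_min ltry orbT.
have k0 : (0 < k)%R by rewrite -lte_fin kE lt_min mc0 lte01.
have lower x : tail j c x -> (k * (`|s x - s c|))%:E <= feller_sigma m ds e x.
  move=> tx; have Dx := tail_sub tx.
  have xc : segment e x c.
    case: (jend) tc tx => jE; rewrite jE => -[_ cr cl] [_ xr xl]; rewrite /segment.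
      rewrite leNgt (lt_trans (xl erefl) (cl erefl)) /= in_itv /= (xl erefl).
      by rewrite (ltW (cl erefl)).
    rewrite (ltW (lt_trans (cr erefl) (xr erefl))) /= in_itv /= (cr erefl).
    by rewrite (ltW (xr erefl)).
  apply: le_trans (double_oriented_integral_ge _ _ xc).
  rewrite EFinM; apply: lee_pmul => //.
  - by rewrite lee_fin ltW.
  - by rewrite kE ge_min lexx.
  rewrite le_eqVlt; apply/orP; left; apply/eqP.
  case: (jend) tc tx => jE; rewrite jE => -[_ cr cl] [_ xr xl].
    rewrite (_ : _ `\` _ = `]x, c]%classic).
      have xc' := ltW (xl erefl).
      by rewrite (scale_measure_itv hds)// distrC ger0_norm// subr_ge0 (scale_le hs).
    rewrite /segment leNgt (lt_trans (xl erefl) (cl erefl)) leNgt (cl erefl) /=.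
    apply/seteqP; split => z /=; rewrite !in_itv /=.
      by move=> [/andP[-> ze]]; rewrite ze andbT => /negP; rewrite -leNgt.
    move=> /andP[xz zc]; rewrite xz (le_trans zc (ltW (cl erefl))); split => //.
    by apply/negP; rewrite andbT -leNgt.
  rewrite (_ : _ `\` _ = `]c, x]%classic).
    have xc' := ltW (xr erefl).
    by rewrite (scale_measure_itv hds)// ger0_norm// subr_ge0 (scale_le hs).
  rewrite /segment (ltW (lt_trans (cr erefl) (xr erefl))) (ltW (cr erefl)) /=.
  apply/seteqP; split => z /=; rewrite !in_itv /=.
    by move=> [/andP[ez ->]]; rewrite ez andbT => /negP; rewrite -ltNge.
  move=> /andP[cz zx]; rewrite zx (lt_trans (cr erefl) cz); split => //.
  by apply/negP; rewrite /= -ltNge.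
have norm_infty : `|s x - s c|%:E @[x --> inner l r j] --> +oo.
  have sj := scale_cvg_value le_e lt_er hs jend.
  apply/cvgeyPge => A; case: (jend) => jE.
    have svj : sv j = -oo.
      have := scale_value_left_fin le_e lt_er hs; have jl : sv j = sv l by rewrite jE.
      by move: jinf; rewrite jl; case: (sv l) => [t nt|_|//]; [case: nt|rewrite ?ltNye].
    move: sj; rewrite svj => /cvgeNyPle/(_ (s c - A)%R); apply: filterS => x.
    by rewrite !lee_fin => h; have := ler_norm (s c - s x)%R; rewrite distrC; lra.
  have svj : sv j = +oo.
    have := scale_value_right_fin le_e lt_er hs; have jr : sv j = sv r by rewrite jE.
    by move: jinf; rewrite jr; case: (sv r) => [t nt|//|_]; [case: nt|rewrite ?ltNye].
  move: sj; rewrite svj => /cvgeyPge/(_ (s c + A)%R); apply: filterS => x.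
  by rewrite !lee_fin => h; have := ler_norm (s x - s c)%R; lra.
apply/cvgeyPge => A; move/cvgeyPge: norm_infty => /(_ (A / k)%R).
apply: filterS2 (inner_tail le_e lt_er jend Dc) => x tx.
rewrite lee_fin ler_pdivrMr// => h; apply: le_trans (lower x tx).
by rewrite lee_fin mulrC.
Qed.

Lemma tail_in_I j a : is_end l r j -> I j -> D a -> m (tail j a) < +oo.
Proof.
move=> jend Ij Da; have Ia := open_sub_I hI Da.
case: (jend) => jE; subst j.
  apply: le_lt_trans (m_itv_fin Ij Ia); apply: le_measure; rewrite ?inE.
  - exact: measurable_tail.
  - exact: emeasurable_itv.
  - move=> x [/in_openP[lx _] _ /(_ erefl) xa].
    by rewrite /= in_itv /= !ltW.
apply: le_lt_trans (m_itv_fin Ia Ij); apply: le_measure; rewrite ?inE.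
- exact: measurable_tail.
- exact: emeasurable_itv.
- move=> x [/in_openP[_ xr] /(_ erefl) ax _].
  by rewrite /= in_itv /= !ltW.
Qed.

Lemma tail_lty j a : is_end l r j -> D a -> m (tail j a) < +oo -> m (tail j e) < +oo.
Proof.
move=> jend Da ma; have De := in_open_e le_e lt_er.
have K : m `[Order.min a e, Order.max a e]%classic < +oo.
  apply: m_itv_fin; apply: (open_sub_I hI).
    by rewrite /Order.min; case: ifP.
  by rewrite /Order.max; case: ifP.
apply: le_lt_trans (_ : _ <= m (tail j a `|` `[Order.min a e, Order.max a e]%classic)) _.
  apply: le_measure; rewrite ?inE.
  - exact: measurable_tail.
  - by apply: measurableU; [exact: measurable_tail|exact: emeasurable_itv].
  - move=> x [Dx xr xl]; have [h|h] := pselect (tail j a x); [by left|right].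
    case: (jend) => jE; subst j.
      have xe := xl erefl; rewrite /= in_itv /= ge_min le_max (ltW xe) !orbT andbT.
      rewrite leNgt; apply/orP; left; apply/negP => xa; apply: h; split => // lr; case: (end_neq le_e lt_er lr).
    have xe := xr erefl; rewrite /= in_itv /= ge_min le_max (ltW xe) !orbT /=.
    rewrite leNgt; apply/orP; left; apply/negP => xa; apply: h; split => // lr; case: (end_neq le_e lt_er (esym lr)).
apply: le_lt_trans (measureU2 _ _ _) _; [exact: measurable_tail|exact: emeasurable_itv|].
exact: lte_add_pinfty.
Qed.

(** A Radon measure is finite near an included end, so only the scale can prevent
   that end from being regular. *)
Lemma reflectingP j : is_end l r j ->
  reflecting l r I m ds e j <-> I j /\ sv j \is a fin_num.
Proof.
move=> jend; split => [[reg Ij]|[Ij jfin]]; first by split => //; exact: regular_finite.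
split => //; apply: regular_of_finite => //; apply: tail_in_I => //.
exact: in_open_e.
Qed.

End end_classification.

(** * Piecewise smooth functions of the scale variable *)
Section lipschitz_primitives.
Context {R : realType}.
Implicit Types (g h : R -> R) (a c d t : R).

(** A primitive [g] of the slope [h], with countably many kinks: a class that
   contains the ramps and is stable under linear combinations, so that cutoffs,
   truncations and tents belong to it by construction. *)
Definition lipschitz_primitive g h := exists (K : set R) (M : R),
  [/\ countable K, forall t u, `|g u - g t| <= M * `|u - t|,
      forall t, ~ K t -> is_derive t 1 g (h t), measurable_fun setT h &
      forall t, `|h t| <= M].

Lemma lipschitz_primitive_affine c d :
  lipschitz_primitive (fun t => c * t + d) (cst c).
Proof.
exists set0, `|c|; split => // [t u|t _].
  by rewrite -normrM (_ : _ - _ = c * (u - t))//; lra.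
have h := is_deriveD (is_deriveZ c (is_derive_id t 1)) (is_derive_cst d t 1).
by apply: (is_derive_eq h); rewrite addr0 /GRing.scale /= mulr1.
Qed.

Lemma lipschitz_primitive_ramp a :
  lipschitz_primitive (fun t => Num.max (t - a) 0) (\1_`]a, +oo[).
Proof.
exists [set a], 1; split.
- exact: finite_set_countable.
- move=> t u; rewrite mul1r; case: (leP (t - a) 0) => h1; case: (leP (u - a) 0) => h2.
  + by rewrite subrr normr0.
  + by rewrite subr0 gtr0_norm// ger0_norm; lra.
  + by rewrite sub0r normrN gtr0_norm// ler0_norm; lra.
  + by rewrite (_ : _ - _ = u - t)//; lra.
- move=> t /eqP ta; rewrite indicE; case: (ltgtP t a) ta => // [ta _|at_ _].
    rewrite memNset /=; last by rewrite in_itv /= andbT; lra.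
    have d0 : is_derive t 1 (cst 0 : R -> R) 0 by exact: is_derive_cst.
    apply: near_eq_is_derive d0; near=> u.
    have ua : u < a by near: u; exact: lt_nbhsl.
    by rewrite /= max_r//; lra.
  rewrite mem_set /=; last by rewrite in_itv /= andbT.
  have d1 : is_derive t 1 (fun u : R => 1 * u + - a) 1.
    have h := is_deriveD (is_deriveZ 1 (is_derive_id t 1)) (is_derive_cst (- a) t 1).
    by apply: (is_derive_eq h); rewrite addr0 /GRing.scale /= mulr1.
  apply: near_eq_is_derive d1; near=> u.
  have ua : a < u by near: u; exact: lt_nbhsr.
  by rewrite mul1r max_l//; lra.
- exact: measurable_indic.
- by move=> t; rewrite indicE; case: (_ \in _); rewrite ?normr1 ?normr0.
Unshelve. all: by end_near. Qed.

Lemma lipschitz_primitiveDZ c g h g' h' : lipschitz_primitive g h ->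
  lipschitz_primitive g' h' ->
  lipschitz_primitive (fun t => g t + c * g' t) (fun t => h t + c * h' t).
Proof.
move=> [K [M [cK gM gh mh hM]]] [K' [M' [cK' gM' gh' mh' hM']]].
exists (K `|` K'), (M + `|c| * M'); split.
- rewrite (_ : _ `|` _ = \bigcup_(b in [set: bool]) if b then K else K').
    by apply: bigcup_countable => // -[].
  apply/seteqP; split => [t [Kt|Kt]|t [[] _ Kt]]; [exists true|exists false|left|right] => //.
- move=> t u.
  have -> : g u + c * g' u - (g t + c * g' t) = (g u - g t) + c * (g' u - g' t) by lra.
  apply: le_trans (ler_normD _ _) _; rewrite normrM mulrDl -mulrA.
  by apply: lerD => //; apply: ler_wpM2l.
- move=> t /not_orP[nK nK'].
  exact: (is_deriveD (gh _ nK) (is_deriveZ c (gh' _ nK'))).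
- apply: measurable_funD => //; apply: measurable_funM => //; exact: measurable_cst.
- move=> t; apply: le_trans (ler_normD _ _) _; rewrite normrM.
  by apply: lerD => //; apply: ler_wpM2l.
Qed.

Lemma lipschitz_primitive_continuous g h : lipschitz_primitive g h -> continuous g.
Proof.
move=> [K [M [_ gM _ _ _]]] t; apply/cvgrPdist_lt => eps eps0.
pose L := `|M| + 1; have L0 : 0 < L by rewrite /L; have := normr_ge0 M; lra.
have d0 : 0 < eps / L by rewrite divr_gt0.
near=> u; rewrite distrC; apply: le_lt_trans (gM _ _) _.
have : `|u - t| < eps / L.
  by rewrite distrC; near: u; exact: (nbhsx_ballx t (eps / L) d0).
rewrite ltr_pdivlMr// => h1; apply: le_lt_trans h1; rewrite mulrC; apply: ler_wpM2l => //.
by rewrite /L; have := ler_norm M; lra.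
Unshelve. all: by end_near. Qed.

Lemma lipschitz_primitive_abs_continuous g h a c : lipschitz_primitive g h ->
  abs_continuous_on g a c.
Proof.
move=> [K [M [_ gM _ _ _]]] eps eps0.
pose L := `|M| + 1; have L0 : 0 < L by rewrite /L; have := normr_ge0 M; lra.
exists (eps / L); first by rewrite divr_gt0.
move=> n p q hpq _; rewrite ltr_pdivlMr// => h1; apply: le_lt_trans h1.
rewrite mulrC mulr_sumr; apply: ler_sum => i _; apply: le_trans (gM _ _) _.
have [_ pq _] := hpq i; rewrite ger0_norm ?subr_ge0//.
apply: ler_wpM2r; first by rewrite subr_ge0.
by rewrite /L; have := ler_norm M; lra.
Qed.

Lemma lipschitz_primitive_derive1 g h : lipschitz_primitive g h ->
  exists2 K : set R, countable K & forall t, ~ K t -> derive1 g t = h t.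
Proof.
move=> [K [M [cK _ gh _ _]]]; exists K => // t /gh d.
by rewrite derive1E derive_val.
Qed.

(** At the kinks the derivative has an arbitrary value, but countable sets are Borel. *)
Lemma lipschitz_primitive_measurable g h : lipschitz_primitive g h ->
  measurable_fun setT (derive1 g).
Proof.
move=> gh; have [K cK Kgh] := lipschitz_primitive_derive1 gh.
have [_ [M [_ _ _ mh _]]] := gh.
have mc (A : set R) : countable A -> measurable A by apply: countable_measurable.
move=> _ B mB; rewrite setTI.
rewrite (_ : _ @^-1` B = (h @^-1` B `\` K) `|` (K `&` derive1 g @^-1` B)).
  apply: measurableU; last by apply: mc; apply: sub_countable cK; exact: subset_card_le.
  by apply: measurableD; [rewrite -[X in measurable X]setTI; exact: mh|exact: mc].
apply/seteqP; split => t /=.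
  by have [Kt|nKt] := pselect (K t); [right|left; rewrite -Kgh].
by move=> [[hB /Kgh ->]|[]].
Qed.

End lipschitz_primitives.

(** * The extended Dirichlet space *)
Section extended_space.
Context {R : realType}.
Variables (l r e : \bar R) (I : set (\bar R)) (s : \bar R -> R).
Variables (m ds : {measure set (\bar R) -> \bar R}).
Hypotheses (hI : interval_with_endpoints l r I) (hm : radon_full_support I m).
Hypotheses (le_e : (l < e)%E) (lt_er : (e < r)%E) (hs : scale_function l r e s).
Hypothesis hds : is_scale_measure l r s ds.
Implicit Types (x y z j a : \bar R) (c d : R) (u v w f p q : \bar R -> R).

Local Notation D := (`]l, r[%classic : set (\bar R)).
Local Notation sv := (scale_value l r s).
Local Notation L2 := (L2fun ds I).
Local Notation "<< p , q >>" := (inner_product ds I p q).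
Local Notation derivative := (scale_derivative l r I s).
Local Notation domain := (dirichlet_domain l r I m s ds e).
Local Notation density := (scale_density l r I ds).
Local Notation tail := (tail l r).
Local Notation approx := (approximating l r I m s ds e).

Let mI : measurable I := measurable_I hI.

Lemma domain_density f : domain f -> density f (derivative f).
Proof. by move=> [_ hf hp _]; exact: (scale_density_derivative hI le_e lt_er hs hds). Qed.

Lemma domain_holder f : domain f -> scale_holder l r s f <<derivative f, derivative f>>.
Proof. by move=> /domain_density hf; exact: (scale_density_scale_holder hI hs hds hf). Qed.

(** At an end that the interval omits but the scale reaches, either the end is
   absorbing and the boundary condition is imposed, or [m] is infinite near it
   and square integrability leaves no other possible limit. *)
Lemma domain_zero_end f j : domain f -> is_end l r j -> sv j \is a fin_num -> ~ I j ->
  f y @[y --> inner l r j] --> (0 : R).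
Proof.
move=> hf jend jfin nIj; have PF := inner_proper le_e lt_er jend.
have De := in_open_e le_e lt_er.
have [mfin|/negP minf] := boolP (m (tail j e) < +oo)%E.
  case: hf => _ _ _; apply => //; split => //.
  exact: (regular_of_finite hI hm le_e lt_er hs hds).
have [v hv _] := scale_holder_end le_e lt_er hs (domain_holder hf) jend jfin.
suff v0 : v = 0 by rewrite -v0.
apply: contrapT => /eqP v0.
have v2 : 0 < `|v| / 2 by rewrite divr_gt0// normr_gt0.
move/cvgrPdist_lt : hv => /(_ _ v2) /(innerP le_e lt_er jend)[a Da ha].
apply: minf; apply: (tail_lty hI hm le_e lt_er jend Da).
have mt := measurable_tail le_e lt_er a jend.
have tI : tail j a `<=` I.
  by move=> x /tail_sub Dx; exact: (open_sub_I hI).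
case: hf => -[mf if2] _ _ _.
have K0 : 0 < (v / 2) ^+ 2 by rewrite exprn_even_gt0//= mulf_neq0// invr_neq0.
rewrite -(@lte_pmul2l _ ((v / 2) ^+ 2)%:E) ?lte_fin//.
rewrite gt0_muley ?lte_fin//; apply: le_lt_trans if2.
rewrite -integral_cst// -[X in (\int[m]_(x in X) _)%E](setIidr tI) integral_mkcondr.
apply: ge0_le_integral_nomeas => [x _|x Ix].
  by rewrite /patch; case: ifP => // _; rewrite lee_fin sqr_ge0.
rewrite /patch; case: ifPn => [/set_mem xt|_]; last by rewrite lee_fin sqr_ge0.
rewrite lee_fin; have /= h := ha _ xt.
rewrite -[leLHS]real_normK ?num_real// -[leRHS]real_normK ?num_real//.
rewrite ler_pXn2r ?nnegrE ?normr_ge0// normrM [`|2^-1|]ger0_norm ?invr_ge0//.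
have := ler_normD (v - f x) (f x); rewrite subrK; lra.
Qed.

(** An open subset of the interval has positive mass and cannot be null. *)
Lemma ae_dense (P : \bar R -> Prop) (U : set (\bar R)) : {ae m, forall x, I x -> P x} ->
  open U -> U `<=` D -> U !=set0 -> exists2 x, U x & P x.
Proof.
move=> [N [mN N0 hN]] oU UD U0; apply: contrapT => nU.
have UN : U `<=` N.
  move=> x Ux; apply: hN => /= H; apply: nU; exists x => //; apply: H.
  by apply: (open_sub_I hI); exact: UD.
have mU : measurable U.
  have -> : U = EFin @` (EFin @^-1` U).
    apply/seteqP; split => [x Ux|_ [t Ut <-] //].
    by have xf := fineK (in_open_fin (UD _ Ux)); exists (fine x); rewrite /= xf.
  apply: measurable_image_EFin; apply: open_measurable.
  by apply: open_comp oU => t _; exact: continuous_EFin.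
have := m_open_pos hI hm oU UD U0; rewrite ltNge => /negP; apply.
by rewrite -N0; apply: le_measure; rewrite ?inE.
Qed.

Lemma ae_continuous_eq v w : (forall x, D x -> v y @[y --> x] --> v x) ->
  (forall x, D x -> w y @[y --> x] --> w x) ->
  {ae m, forall x, I x -> D x -> v x = w x} -> forall x, D x -> v x = w x.
Proof.
move=> cv cw vw x Dx; apply: contrapT => /eqP vwx.
have d0 : 0 < `|v x - w x| / 2 by rewrite divr_gt0// normr_gt0 subr_eq0.
have /cvgrPdist_lt/(_ _ d0) hv := cv x Dx; have /cvgrPdist_lt/(_ _ d0) hw := cw x Dx.
have nD : \forall y \near x, D y by apply: open_nbhs_nbhs; split => //; exact: open_open.
pose Q := [set y | [/\ D y, `|v x - v y| < `|v x - w x| / 2 & `|w x - w y| < `|v x - w x| / 2]].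
have nQ : nbhs x Q by near=> y; split; near: y.
have [||y Uy hy] := ae_dense vw (@open_interior _ Q).
- by move=> y /interior_subset[].
- by exists x.
have [Dy h1 h2] := interior_subset Uy; have E := hy Dy.
have : `|v x - w x| <= `|v x - v y| + `|w x - w y|.
  have -> : v x - w x = (v x - v y) - (w x - w y) by rewrite E; lra.
  exact: ler_normB.
lra.
Unshelve. all: by end_near. Qed.

Lemma scale_bound_cvg0 v C j : is_end l r j -> sv j \is a fin_num ->
  (forall y, D y -> (v y) ^+ 2 <= C * `|s y - fine (sv j)|) ->
  v y @[y --> inner l r j] --> (0 : R).
Proof.
move=> jend jfin hv; have PF := inner_proper le_e lt_er jend.
apply/cvgrPdist_lt => eps eps0.
pose K := `|C| + 1; have K0 : 0 < K by rewrite /K; have := normr_ge0 C; lra.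
have d0 : 0 < eps ^+ 2 / K by rewrite divr_gt0// exprn_gt0.
have /cvgrPdist_lt/(_ _ d0) := scale_cvg_end le_e lt_er hs jend jfin.
apply: filterS2 (inner_open l r j) => y Dy; rewrite ltr_pdivlMr// => h.
rewrite sub0r normrN; apply: sqr_lt_norm_lt => //; apply: le_lt_trans (hv _ Dy) _.
apply: le_lt_trans h; rewrite distrC mulrC; apply: ler_wpM2l => //.
by rewrite /K; have := ler_norm C; lra.
Qed.

Lemma cvgL2_ae (p_ : nat -> \bar R -> R) p p' : ae_eq ds I p p' ->
  cvgL2 ds I p_ p -> cvgL2 ds I p_ p'.
Proof.
move=> pp'; rewrite /cvgL2 => h.
rewrite (_ : (fun n => _) = (fun n => <<fun x => p_ n x - p x, fun x => p_ n x - p x>>))//.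
apply/funext => n; apply: inner_product_ae; apply: filterS pp' => x /[apply].
by move=> ->.
Qed.

Definition zero_at_omitted_ends v := forall j, is_end l r j -> sv j \is a fin_num ->
  ~ I j -> v y @[y --> inner l r j] --> (0 : R).

(** The derivatives converge by completeness. The sequence converges at one point,
   hence everywhere inside, its increments being integrals of its derivatives; the
   Hoelder bounds are uniform and carry the vanishing boundary values to the limit. *)
Lemma approximating_limit u (f_ : nat -> \bar R -> R) : approx u f_ ->
  exists v p, [/\ density v p, cvgL2 ds I (fun n => derivative (f_ n)) p,
    forall x, D x -> f_ n x @[n --> \oo] --> v x & zero_at_omitted_ends v].
Proof.
move=> [hf hC hu].
pose p_ n := derivative (f_ n).
have dp n : density (f_ n) (p_ n) by exact: domain_density.
have hp n : L2 (p_ n) by exact: (dp n).1.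
have hCp eps : 0 < eps -> exists N : nat, forall n k : nat, (N <= n)%N -> (N <= k)%N ->
    <<fun x => p_ n x - p_ k x, fun x => p_ n x - p_ k x>> < eps.
  move=> eps0; have eps2 : 0 < eps / 2 by rewrite divr_gt0.
  have [N hN] := hC _ eps2; exists N => n k Nn Nk.
  have := hN n k Nn Nk; rewrite (dirichlet_formB hI le_e lt_er hs hds); last 2 first.
  - by case: (hf n).
  - by case: (hf k).
  rewrite /p_; lra.
have [p L2p pp] := L2_complete mI hp hCp.
have [x0 Dx0 hx0] := ae_dense hu (@open_open R l r) (@subset_refl _ _) (ex_intro _ e (in_open_e le_e lt_er)).
have cvi x y : D x -> D y -> (x <= y)%E ->
    f_ n y - f_ n x @[n --> \oo] --> \int[ds]_(z in `]x, y]%classic) p z.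
  move=> Dx Dy xy; rewrite (_ : (fun n => _) = (fun n => \int[ds]_(z in `]x, y]%classic) p_ n z)).
    apply: (cvgL2_Rintegral mI _ _ _ hp L2p pp).
    - exact: measurable_itv_oc.
    - exact: (itv_sub_I hI).
    - exact: (scale_measure_fin hds).
  by apply/funext => n; rewrite (dp n).2.
have cf x : D x -> cvg (f_ n x @[n --> \oo]).
  move=> Dx; have [xx0|/ltW x0x] := leP x x0.
    rewrite (_ : (fun n => _) = (fun n => f_ n x0 - (f_ n x0 - f_ n x))); last first.
      by apply/funext => n; lra.
    by apply: is_cvgB; apply/cvg_ex; [exists (u x0)|eexists; exact: cvi].
  rewrite (_ : (fun n => _) = (fun n => f_ n x0 + (f_ n x - f_ n x0))); last first.
    by apply/funext => n; lra.
  by apply: is_cvgD; apply/cvg_ex; [exists (u x0)|eexists; exact: cvi].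
pose v x := lim (f_ n x @[n --> \oo]).
have fv x : D x -> f_ n x @[n --> \oo] --> v x by move=> Dx; exact: cf.
have pv : density v p.
  split => // x y Dx Dy xy; apply/esym; apply: (cvg_unique _ _ (cvi x y Dx Dy xy)) => //.
  by apply: cvgB; exact: fv.
exists v, p; split => // j jend jfin nIj.
have PF := inner_proper le_e lt_er jend.
apply: (scale_bound_cvg0 (C := <<p, p>>) jend jfin) => y Dy.
have c1 : (f_ n y) ^+ 2 @[n --> \oo] --> (v y) ^+ 2.
  by rewrite expr2; under eq_fun do rewrite expr2; apply: cvgM; exact: fv.
have c2 : <<p_ n, p_ n>> * `|s y - fine (sv j)| @[n --> \oo] --> <<p, p>> * `|s y - fine (sv j)|.
  by apply: cvgM; [exact: (cvgL2_inner_product mI)|exact: cvg_cst].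
apply: (ler_cvg_to c1 c2); apply: nearW => n.
have [w hw hwb] := scale_holder_end le_e lt_er hs (domain_holder (hf n)) jend jfin.
have w0 : w = 0.
  apply: (cvg_unique _ hw) => //; exact: domain_zero_end.
by have := hwb y Dy; rewrite w0 subr0.
Qed.

(** The last clause, over all approximating sequences, is what makes the value of
   the extended form independent of their choice. *)
Definition extended_version u v p := [/\ density v p,
  {ae m, forall x, I x -> D x -> u x = v x}, zero_at_omitted_ends v &
  forall f_ : nat -> \bar R -> R, approx u f_ -> cvgL2 ds I (fun n => derivative (f_ n)) p].

Lemma density_continuous v p : density v p -> forall x, D x -> v y @[y --> x] --> v x.
Proof.
move=> vp x Dx; apply: (scale_holder_continuous hs _ Dx).
exact: (scale_density_scale_holder hI hs hds vp).
Qed.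

Lemma density_ext v w p : (forall x, D x -> v x = w x) -> density v p -> density w p.
Proof. by move=> vw [hp vp]; split => // x y Dx Dy xy; rewrite vp// !vw. Qed.

Lemma approximating_ae u v (f_ : nat -> \bar R -> R) : approx u f_ ->
  (forall x, D x -> f_ n x @[n --> \oo] --> v x) ->
  {ae m, forall x, I x -> D x -> u x = v x}.
Proof.
move=> [_ _ hu] fv; apply: filterS hu => x hx Ix Dx.
by apply: (cvg_unique _ (hx Ix)) => //; exact: fv.
Qed.

(** The limits of two approximating sequences agree [m]-almost everywhere, hence
   everywhere inside by continuity and full support; the limits of the derivatives
   are then derivatives of one and the same function. *)
Lemma extended_versionP u : extended_domain l r I m s ds e u ->
  exists v p, extended_version u v p.
Proof.
move=> [f_ hf]; have [v [p [vp pp fv v0]]] := approximating_limit hf.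
have uv := approximating_ae hf fv.
exists v, p; split; [exact: vp|exact: uv|exact: v0|move=> g_ hg].
have [w [q [wq qq gw w0]]] := approximating_limit hg.
have uw := approximating_ae hg gw.
have wv : forall x, D x -> w x = v x.
  apply: ae_continuous_eq; [exact: density_continuous wq|exact: density_continuous vp|].
  by apply: filterS2 uv uw => x h1 h2 Ix Dx; rewrite -h1// -h2.
apply: cvgL2_ae qq; apply: (scale_density_unique_ae hI le_e lt_er hds _ vp).
exact: density_ext wv wq.
Qed.

Lemma extended_version_unique u v p w q : extended_version u v p -> density w q ->
  {ae m, forall x, I x -> D x -> u x = w x} ->
  (forall x, D x -> v x = w x) /\ ae_eq ds I p q.
Proof.
move=> [vp uv _ _] wq uw.
have vw : forall x, D x -> v x = w x.
  apply: ae_continuous_eq; [exact: density_continuous vp|exact: density_continuous wq|].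
  by apply: filterS2 uv uw => x h1 h2 Ix Dx; rewrite -h1// -h2.
split => //; apply: (scale_density_unique_ae hI le_e lt_er hds _ wq).
exact: density_ext vw vp.
Qed.

Lemma extended_formE u v p u' v' p' : extended_domain l r I m s ds e u ->
  extended_domain l r I m s ds e u' ->
  extended_version u v p -> extended_version u' v' p' ->
  extended_form l r I m s ds e u u' = 2^-1 * <<p, p'>>.
Proof.
move=> [f_ hf] [f'_ hf'] [vp _ _ up] [vp' _ _ up'].
have conv (g_ g'_ : nat -> \bar R -> R) : approx u g_ -> approx u' g'_ ->
    dirichlet_form l r I s ds (g_ n) (g'_ n) @[n --> \oo] --> 2^-1 * <<p, p'>>.
  move=> hg hg'; apply: cvgM; first exact: cvg_cst.
  apply: (cvgL2_inner_product mI).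
  - by case: hg => hg _ _ n; exact: (domain_density (hg n)).1.
  - exact: vp.1.
  - by case: hg' => hg' _ _ n; exact: (domain_density (hg' n)).1.
  - exact: vp'.1.
  - exact: up.
  - exact: up'.
have ex : exists b : R, [set b : R | exists f_ g_ : nat -> \bar R -> R,
    [/\ approx u f_, approx u' g_ &
      dirichlet_form l r I s ds (f_ n) (g_ n) @[n --> \oo] --> b]] b.
  by exists (2^-1 * <<p, p'>>); exists f_, f'_; split => //; exact: conv.
have [g_ [g'_ [hg hg' ha]]] := getPex ex.
by apply: (cvg_unique _ ha) => //; exact: conv.
Qed.

Lemma extended_domain_ae u u' : ae_eq m I u u' -> extended_domain l r I m s ds e u ->
  extended_domain l r I m s ds e u'.
Proof.
move=> uu' [f_ [h1 h2 h3]]; exists f_; split => //.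
by apply: filterS2 uu' h3 => x h4 h5 Ix; rewrite -(h4 Ix); exact: h5.
Qed.

(** * Boundary values and affine harmonic functions *)

Lemma end_notin j : is_end l r j -> ~ D j.
Proof. by move=> [->|->] /in_openP[]; rewrite ltxx. Qed.

(** A function of small energy that is at least 1 at some point close to [j]
   is at least 1/2 on a fixed neighbourhood of [j], which has positive mass. *)
Lemma capacity_pos j (A : set (\bar R)) : is_end l r j -> I j -> sv j \is a fin_num ->
  A j -> (0 < capacity l r I m s ds e A)%E.
Proof.
move=> jend Ij jfin Aj; have PF := inner_proper le_e lt_er jend.
have /cvgrPdist_lt/(_ _ ltr01) := scale_cvg_end le_e lt_er hs jend jfin.
move=> /(innerP le_e lt_er jend)[a Da ha].
have mfin := tail_in_I hI hm le_e lt_er jend Ij Da.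
have oT : open (tail j a) by exact: (tail_open le_e lt_er jend).
have TD := @tail_sub R l r j a.
have mpos := m_open_pos hI hm oT TD (tail_neq0 le_e lt_er jend Da).
have mT := measurable_tail le_e lt_er a jend.
(* Where the scale varies by at most 2, a squared norm of at most 1/8 for the
   derivative keeps the oscillation of the function within 1/2. *)
pose c0 := Num.min (16^-1) (fine (m (tail j a)) / 4).
have c00 : 0 < c0.
  by rewrite lt_min invr_gt0 ltr0n /= divr_gt0// fine_gt0// mpos.
suff H : (c0%:E <= capacity l r I m s ds e A)%E.
  by apply: lt_le_trans H; rewrite lte_fin.
apply: le_ereal_inf_tmp => _ [U [oU AU] <-].
apply: le_ereal_inf_tmp => _ [f [hf f1] <-]; rewrite lee_fin.
have hfp := domain_density hf.
set E := <<derivative f, derivative f>>.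
have E0 : 0 <= E by exact: inner_product_ge0.
have if2 : m.-integrable I (EFin \o (fun x => f x ^+ 2)).
  by case: hf => hf2 _ _ _; exact: (L2fun_sqr_integrable hf2).
have if0 : 0 <= \int[m]_(x in I) (f x ^+ 2).
  by apply: Rintegral_ge0 => x _; exact: sqr_ge0.
rewrite /energy1 dirichlet_formE -/E.
have [y [Uy ty] fy] : exists2 y, (U `&` tail j a) y & 1 <= f y.
  have [|||y [Uy ty] h] := ae_dense (P := fun x => U x -> 1 <= f x) (U := U `&` tail j a) _ (openI oU oT).
  - by apply: filterS f1 => x h Ix Ux; apply: h.
  - by move=> y [_ /TD].
  - have nU : inner l r j U.
      have nU : nbhs j U by apply: open_nbhs_nbhs; split => //; exact: AU.
      by rewrite /inner /within /=; apply: filterS nU => x Ux _.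
    have [y [Uy ty]] := filter_ex (filterI nU (inner_tail le_e lt_er jend Da)).
    by exists y.
  - by exists y => //; exact: h.
have [big|small] := leP (8^-1) E.
  have : c0 <= 16^-1 by rewrite /c0 ge_min lexx.
  lra.
have fhalf x : tail j a x -> 2^-1 <= f x.
  move=> tx; have h1 := scale_density_holder hI hs hds hfp (TD _ ty) (TD _ tx).
  have h2 : `|s x - s y| <= 2.
    have -> : s x - s y = (fine (sv j) - s y) - (fine (sv j) - s x) by lra.
    apply: le_trans (ler_normB _ _) _.
    have /= := ha _ tx; have /= := ha _ ty; lra.
  have h3 : (f x - f y) ^+ 2 <= 4^-1.
    apply: le_trans h1 _; rewrite -/E; have := normr_ge0 (s x - s y); nra.
  rewrite leNgt; apply/negP => fx; move: h3; nra.
have : fine (m (tail j a)) / 4 <= \int[m]_(x in I) (f x ^+ 2).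
  rewrite mulrC; have <- : \int[m]_(x in tail j a) (4^-1) = 4^-1 * fine (m (tail j a)).
    by rewrite Rintegral_cst.
  have tI : tail j a `<=` I by apply: subset_trans TD (open_sub_I hI).
  rewrite -lee_fin /Rintegral !fineK; last 2 first.
  - exact: (integrable_fin_num mI if2).
  - apply: (integrable_fin_num mT); apply/integrableP; split; first exact: measurable_cst.
    under eq_integral do rewrite gee0_abs ?lee_fin ?invr_ge0//.
    by rewrite integral_cst// lte_mul_pinfty// lee_fin invr_ge0.
  rewrite -[X in (\int[m]_(x in X) _ <= _)%E](setIidr tI) integral_mkcondr.
  apply: ge0_le_integral_nomeas => [x _|x Ix].
    by rewrite /patch; case: ifP => // _; rewrite lee_fin invr_ge0.
  rewrite /patch; case: ifPn => [/set_mem xt|_]; last by rewrite lee_fin sqr_ge0.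
  by rewrite lee_fin; have := fhalf _ xt; nra.
have : c0 <= fine (m (tail j a)) / 4 by rewrite /c0 ge_min lexx orbT.
lra.
Qed.

Lemma in_effective j : is_end l r j -> I j -> sv j \is a fin_num ->
  effective_interval l r I m ds e j.
Proof.
by move=> jend Ij jfin; right; split => //; apply/(reflectingP hI hm le_e lt_er hs hds).
Qed.

(** An exceptional set of zero capacity cannot contain an included end of finite
   scale; at an omitted one, every element of the extended space vanishes. *)
Lemma extended_domain0_zero_end u v p j : extended_domain0 l r I m s ds e u ->
  extended_version u v p -> is_end l r j -> sv j \is a fin_num ->
  v y @[y --> inner l r j] --> (0 : R).
Proof.
move=> [_ [w [cw uw] capw]] [vp uv v0 _] jend jfin.
have [Ij|nIj] := pselect (I j); last exact: v0.
have jIe := in_effective jend Ij jfin.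
have DIe : D `<=` effective_interval l r I m ds e by move=> x; left.
have wj : w j = 0.
  apply: contrapT => /eqP wj0.
  have /(capacity_pos jend Ij jfin) : ((I `\` D) `&` [set x | w x != 0]) j.
    by split => //; split => //; exact: end_notin.
  by rewrite capw ltxx.
have vw : forall x, D x -> v x = w x.
  apply: ae_continuous_eq.
  - exact: (density_continuous vp).
  - move=> x Dx; have := continuous_subspaceW DIe cw.
    rewrite continuous_open_subspace; last exact: open_open.
    by move=> h; apply: h; rewrite inE.
  - by apply: filterS2 uv uw => x h1 h2 Ix Dx; rewrite -h1// h2.
have cwj : w y @[y --> inner l r j] --> w j.
  have cj := (subspace_continuousP _ w).1 cw j jIe.
  move=> B /cj hB; have hB' : \forall x \near j, effective_interval l r I m ds e x -> B (w x) := hB.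
  by rewrite /inner /fmap /within /=; apply: filterS hB' => x h Dx; apply: h; exact: DIe.
rewrite wj in cwj; apply: cvg_trans cwj; apply: near_eq_cvg.
by apply: filterS (inner_open l r j) => x Dx; rewrite vw.
Qed.

Lemma affine_density c d : L2 (cst c) -> density (fun x => c * s x + d) (cst c).
Proof.
move=> hc; split => // x y Dx Dy xy.
rewrite Rintegral_cst; last exact: measurable_itv_oc.
by rewrite (scale_measure_itv hds)//=; lra.
Qed.

Lemma cvg_left_point : left_point l e n @[n --> \oo] --> inner l r l.
Proof.
move=> P /(innerP le_e lt_er (or_introl erefl))[a Da aP].
have [lx _] := (in_openP l r a).1 Da.
have [h1 h2 h3 /(_ _ lx)[N hN]] := left_point_spec le_e lt_er.
exists N => // n /= Nn; apply: aP; split.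
- exact: (in_open_left_point le_e lt_er).
- by move=> lr; case: (end_neq le_e lt_er lr).
- by move=> _; apply: le_lt_trans hN; exact: h3.
Qed.

Lemma cvg_right_point : right_point r e n @[n --> \oo] --> inner l r r.
Proof.
move=> P /(innerP le_e lt_er (or_intror erefl))[a Da aP].
have [_ xr] := (in_openP l r a).1 Da.
have [h1 h2 h3 /(_ _ xr)[N hN]] := right_point_spec le_e lt_er.
exists N => // n /= Nn; apply: aP; split.
- exact: (in_open_right_point le_e lt_er).
- by move=> _; apply: (lt_le_trans hN); exact: h3.
- by move=> lr; case: (end_neq le_e lt_er (esym lr)).
Qed.

Lemma scale_measure_I : ds I = ds D.
Proof.
have mDc : measurable (I `\` D) by apply: measurableD => //; exact: measurable_open.
rewrite -[in LHS](setDUK (open_sub_I hI)) measureU0//; first exact: measurable_open.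
by apply: subset_measure0 (proj1 hds) => //; apply: measurableC; exact: measurable_open.
Qed.

Lemma scale_measure_total : sv l \is a fin_num -> sv r \is a fin_num ->
  (ds I < +oo)%E.
Proof.
move=> lfin rfin; rewrite scale_measure_I -[X in ds X]setIT.
apply: (@le_lt_trans _ _ (fine (sv r) - fine (sv l))%:E); last exact: ltry.
apply: (exhaustion_measure_le le_e lt_er); first by rewrite setIT; exact: measurable_open.
move=> x y Dx Dy xy; rewrite setIT (scale_measure_itv hds)// lee_fin.
have h1 := scale_value_left_lt le_e lt_er hs Dx; have h2 := scale_value_right_gt le_e lt_er hs Dy.
rewrite -(fineK lfin) lte_fin in h1; rewrite -(fineK rfin) lte_fin in h2; lra.
Qed.

Lemma L2_cst c : (ds I < +oo)%E -> L2 (cst c).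
Proof.
move=> dsI; split; first exact: measurable_cst.
rewrite (_ : (fun x => _) = cst (c ^+ 2)%:E)// integral_cst//.
by rewrite lte_mul_pinfty// lee_fin sqr_ge0.
Qed.

Lemma inner_product_ael p p' q : L2 p -> L2 p' -> L2 q -> ae_eq ds I p p' ->
  <<p, q>> = <<p', q>>.
Proof.
move=> L2p L2p' L2q pp'; rewrite /inner_product /Rintegral; congr fine.
apply: ae_eq_integral => //.
- exact: measurable_int (L2fun_mul_integrable mI L2p L2q).
- exact: measurable_int (L2fun_mul_integrable mI L2p' L2q).
- by apply: filterS pp' => x /[apply] ->.
Qed.

Lemma cvgL2_cst p : cvgL2 ds I (fun=> p) p.
Proof.
rewrite /cvgL2 [X in X @ _](_ : _ = cst 0); first exact: cvg_cst.
apply/funext => n; rewrite /inner_product (@eq_Rintegral _ _ _ _ _ (cst 0)) /=.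
  by rewrite Rintegral_cst// mul0r.
by move=> x _; rewrite subrr mul0r.
Qed.

(** Passage to the limit along the exhaustion, in the quadratic mean because [ds]
   is finite. *)
Lemma density_total v p (a b : R) : density v p ->
  sv l \is a fin_num -> sv r \is a fin_num ->
  v y @[y --> inner l r l] --> a -> v y @[y --> inner l r r] --> b ->
  <<cst 1, p>> = b - a.
Proof.
move=> vp lfin rfin va vb; have dsI := scale_measure_total lfin rfin.
pose E n := exhaustion l r e n.
have mE n : measurable (E n) by exact: measurable_exhaustion.
have EI n : E n `<=` I by apply: subset_trans (open_sub_I hI); exact: (exhaustion_sub le_e lt_er).
have dsE n : (ds (E n) < +oo)%E by apply: le_lt_trans dsI; apply: le_measure; rewrite ?inE.
have L2E n : L2 (\1_(E n)) by exact: (L2fun_indic mI).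
have L21 := L2_cst 1 dsI.
have c1 : <<\1_(E n), p>> @[n --> \oo] --> b - a.
  rewrite (_ : (fun n => _) = (fun n => v (right_point r e n) - v (left_point l e n))).
    apply: cvgB.
      exact: (cvg_comp _ _ cvg_right_point vb).
    exact: (cvg_comp _ _ cvg_left_point va).
  apply/funext => n; rewrite inner_productC inner_product_indic// vp.2//.
  - exact: (in_open_left_point le_e lt_er).
  - exact: (in_open_right_point le_e lt_er).
  - exact: (left_right_point le_e lt_er).
have mEc n : measurable (I `\` E n) by exact: measurableD.
have c2 : <<\1_(E n), p>> @[n --> \oo] --> <<cst 1, p>>.
  apply: (cvgL2_inner_product mI L2E L21 (fun=> vp.1) vp.1); last exact: cvgL2_cst.
  rewrite /cvgL2 [X in X @ _](_ : _ = (fun n => fine (ds (I `\` E n)))).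
    have dsIf : ds I \is a fin_num by rewrite ge0_fin_numE.
    have cE : ds (E n) @[n --> \oo] --> ds I.
      have nd : {homo E : n k / (n <= k)%N >-> (n <= k)%O}.
        by move=> n k nk; apply/subsetPset; exact: exhaustion_nd.
      have mU : measurable (\bigcup_n E n) by exact: bigcup_measurable.
      have := nondecreasing_cvg_mu (mu := ds) mE mU nd.
      by rewrite (bigcup_exhaustion le_e lt_er) -scale_measure_I.
    have : fine (ds I) - fine (ds (E n)) @[n --> \oo] --> fine (ds I) - fine (ds I).
      by apply: cvgB; [exact: cvg_cst|by apply: fine_cvg; rewrite fineK].
    rewrite subrr; apply: cvg_trans; apply: near_eq_cvg; apply: nearW => n.
    rewrite measureD// ?(setIidr (EI n))// fineB// ge0_fin_numE//; exact: dsE.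
  apply/funext => n; rewrite /inner_product -[RHS]mul1r -(Rintegral_cst _ (mEc n)).
  rewrite setDE Rintegral_mkcondr; apply: eq_Rintegral => x _.
  rewrite indicE /patch in_setC; case: (x \in E n) => /=; rewrite ?subrr ?mul0r// sub0r; lra.
exact: (cvg_unique _ c2 c1).
Qed.

(** The energy of [u] and [f] is [c / 2] times the difference of the two boundary
   values of [f], and both are zero. *)
Lemma affine_harmonic u c d : extended_domain l r I m s ds e u ->
  {ae m, forall x, I x -> D x -> u x = c * s x + d} ->
  (c = 0 \/ (sv l \is a fin_num /\ sv r \is a fin_num)) ->
  harmonic_space l r I m s ds e u.
Proof.
move=> hu ucd hc; split => // f hf0.
have hf := hf0.1.
have [v [p uvp]] := extended_versionP hu.
have [w [q fwq]] := extended_versionP hf.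
rewrite (extended_formE hu hf uvp fwq).
have L2c : L2 (cst c).
  case: hc => [->|[lfin rfin]]; last by apply: L2_cst; exact: scale_measure_total.
  split; first exact: measurable_cst.
  rewrite (_ : (fun x => _) = cst 0%E) ?integral0 ?ltry//.
  by apply/funext => x /=; rewrite expr0n.
have [_ pc] := extended_version_unique uvp (affine_density d L2c) ucd.
have L2p : L2 p by case: uvp => -[].
have L2q : L2 q by case: fwq => -[].
rewrite (inner_product_ael L2p L2c L2q pc).
case: hc => [c0|[lfin rfin]].
  rewrite /inner_product (@eq_Rintegral _ _ _ _ _ (cst 0)) /=.
    by rewrite Rintegral_cst// mul0r mulr0.
  by move=> x _; rewrite c0 mul0r.
have -> : <<cst c, q>> = c * <<cst 1, q>>.
  rewrite -inner_productZl//; last by apply: L2_cst; exact: scale_measure_total.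
  by apply: eq_Rintegral => x _ /=; rewrite mulr1.
have wq : density w q by case: fwq.
have lend : is_end l r l by left.
have rend : is_end l r r by right.
rewrite (density_total wq lfin rfin (extended_domain0_zero_end hf0 fwq lend lfin)
  (extended_domain0_zero_end hf0 fwq rend rfin)).
by rewrite subrr !mulr0.
Qed.

End extended_space.

(** * Elements of the Dirichlet space *)
Section harmonic_functions.
Context {R : realType}.
Variables (l r e : \bar R) (I : set (\bar R)) (s : \bar R -> R).
Variables (m ds : {measure set (\bar R) -> \bar R}).
Hypotheses (hI : interval_with_endpoints l r I) (hm : radon_full_support I m).
Hypotheses (le_e : (l < e)%E) (lt_er : (e < r)%E) (hs : scale_function l r e s).
Hypothesis hds : is_scale_measure l r s ds.
Implicit Types (x y z j : \bar R) (a b c d t : R) (u v w f p q : \bar R -> R).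

Local Notation D := (`]l, r[%classic : set (\bar R)).
Local Notation sv := (scale_value l r s).
Local Notation L2 := (L2fun ds I).
Local Notation "<< p , q >>" := (inner_product ds I p q).
Local Notation derivative := (scale_derivative l r I s).
Local Notation domain := (dirichlet_domain l r I m s ds e).
Local Notation extended := (extended_domain l r I m s ds e).
Local Notation version := (extended_version l r e I s m ds).

Let mI : measurable I := measurable_I hI.

Definition vanishes_at_omitted_ends f :=
  forall j, is_end l r j -> ~ I j -> \forall x \near inner l r j, f x = 0.

Lemma vanishes_left f : vanishes_at_omitted_ends f ->
  exists2 a, I a & forall x, I x -> (x < a)%E -> f x = 0.
Proof.
move=> f0; have [Il|nIl] := pselect (I l).
  exists l => // x /(in_I_cases hI)[/in_openP[lx _]|[->|->]]; rewrite ?ltxx//.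
    by rewrite ltNge (ltW lx).
  by rewrite ltNge (ltW (lt_trans le_e lt_er)).
have lend : is_end l r l by left.
have /(innerP le_e lt_er lend)[a Da af] := f0 _ lend nIl.
exists a; first exact: (open_sub_I hI).
move=> x Ix xa; apply: af; have /in_openP[_ ar] := Da.
have [Dx|[xl|xr]] := in_I_cases hI Ix.
- by split => // lr; case: (end_neq le_e lt_er lr).
- by case: nIl; rewrite -xl.
- by move: xa; rewrite xr ltNge (ltW ar).
Qed.

Lemma vanishes_right f : vanishes_at_omitted_ends f ->
  exists2 b, I b & forall x, I x -> (b < x)%E -> f x = 0.
Proof.
move=> f0; have [Ir|nIr] := pselect (I r).
  exists r => // x /(in_I_cases hI)[/in_openP[_ xr]|[->|->]]; rewrite ?ltxx//.
    by rewrite ltNge (ltW xr).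
  by rewrite ltNge (ltW (lt_trans le_e lt_er)).
have rend : is_end l r r by right.
have /(innerP le_e lt_er rend)[b Db bf] := f0 _ rend nIr.
exists b; first exact: (open_sub_I hI).
move=> x Ix bx; apply: bf; have /in_openP[lb _] := Db.
have [Dx|[xl|xr]] := in_I_cases hI Ix.
- by split => // /esym lr; case: (end_neq le_e lt_er lr).
- by move: bx; rewrite xl ltNge (ltW lb).
- by case: nIr; rewrite -xr.
Qed.

Lemma factor_continuous f (g : R -> R) x : continuous g ->
  (forall y, I y -> sv y \is a fin_num -> f y = g (fine (sv y))) ->
  D x -> f y @[y --> x] --> f x.
Proof.
move=> cg fg Dx.
have fgs y : D y -> f y = g (s y).
  by move=> Dy; rewrite (fg _ (open_sub_I hI Dy)) (scale_valueE hs Dy).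
rewrite (fgs _ Dx); have c := cvg_comp _ _ (scale_function_continuous hs Dx) (cg (s x)).
apply: cvg_trans c; apply: near_eq_cvg.
have nD : \forall y \near x, D y by apply: open_nbhs_nbhs; split => //; exact: open_open.
by apply: filterS nD => y Dy /=; rewrite fgs.
Qed.

(** Vanishing near the omitted ends confines [f] to a compact part of [I], which has
   finite mass, and takes care of the boundary conditions as well. *)
Lemma domain_of_factor f (g h : R -> R) (M : R) : lipschitz_primitive g h ->
  (forall x, I x -> sv x \is a fin_num -> f x = g (fine (sv x))) ->
  (forall x, I x -> `|f x| <= M) -> vanishes_at_omitted_ends f -> L2 (h \o s) ->
  domain f /\ ae_eq ds I (derivative f) (h \o s).
Proof.
move=> gh fg fM f0 hL2; have mD := @measurable_open R l r.
have fac : factors_through_scale l r I s f g.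
  by split => // a b _ _; exact: (lipschitz_primitive_abs_continuous _ _ gh).
have dD x : D x -> derivative f x = derive1 g (s x).
  by move=> Dx; rewrite (scale_derivativeE hI hs fac Dx).
have dae : ae_eq ds I (derivative f) (h \o s).
  apply: (ae_open hds); have [K cK Kg] := lipschitz_primitive_derive1 gh.
  have aeg : {ae (@lebesgue_measure R), forall t, derive1 g t = h t}.
    exists K; split; last by move=> t /= nt; apply: contrapT => /Kg.
    - by apply: countable_measurable cK => t; exact: measurable_set1.
    - exact: countable_lebesgue_measure0.
  by apply: filterS (ae_scale le_e lt_er hs hds aeg) => x hx Dx; rewrite dD// hx.
split => //; split.
- split.
    apply: (measurable_fun_I hI); apply: measurable_fun_open => x Dx.
    exact: (factor_continuous (lipschitz_primitive_continuous gh) fg Dx).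
  have [a Ia fa] := vanishes_left f0; have [b Ib fb] := vanishes_right f0.
  have mab : measurable (`[a, b]%classic : set (\bar R)) by exact: emeasurable_itv.
  apply: (@le_lt_trans _ _ (\int[m]_(x in I `&` `[a, b]%classic) cst (M ^+ 2)%:E x)%E); last first.
    rewrite integral_cst; last exact: measurableI.
    rewrite lte_mul_pinfty// ?lee_fin ?sqr_ge0//.
    apply: le_lt_trans (m_itv_fin hI hm Ia Ib); apply: le_measure; rewrite ?inE//.
    exact: measurableI.
  rewrite integral_mkcondr; apply: ge0_le_integral_nomeas => x Ix.
    by rewrite lee_fin sqr_ge0.
  rewrite /patch; case: ifPn => [_|/negP xab].
    rewrite lee_fin -[leLHS]real_normK ?num_real//.
    by have := fM _ Ix; have := normr_ge0 (f x); nra.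
  have -> : f x = 0; last by rewrite expr0n.
  have [xa|ax] := ltP x a; first exact: fa.
  have [bx|xb] := ltP b x; first exact: fb.
  by case: xab; rewrite inE /= in_itv /= ax.
- by exists g.
- split.
    apply: (measurable_fun_I hI).
    apply: (@eq_measurable_fun _ _ _ _ _ (derive1 g \o s)).
      by move=> x /set_mem Dx; rewrite dD.
    apply: (measurable_comp measurableT); first by [].
      exact: (lipschitz_primitive_measurable gh).
    exact: (measurable_scale hs).
  apply: le_lt_trans hL2.2; apply: ge0_ae_le_integral_nomeas.
  + by move=> x _; rewrite lee_fin sqr_ge0.
  + by move=> x _; rewrite lee_fin sqr_ge0.
  + by apply: filterS dae => x /[apply] ->.
- move=> j jend [_ nIj]; have PF := inner_proper le_e lt_er jend.
  have c0 : (0 : R) @[x --> inner l r j] --> (0 : R) by exact: cvg_cst.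
  apply: cvg_trans c0; apply: near_eq_cvg.
  by apply: filterS (f0 j jend nIj) => x ->.
Qed.

(** The scale carries [ds] to Lebesgue measure, so the energy of a function of
   the scale is controlled by the length of the set where its slope lives. *)
Lemma L2_level (h : R -> R) (K a b : R) : a <= b -> measurable_fun setT h ->
  (forall t, `|h t| <= K) ->
  (forall x, D x -> ~ (a < s x <= b) -> h (s x) = 0) ->
  L2 (h \o s) /\ <<h \o s, h \o s>> <= K ^+ 2 * (b - a).
Proof.
move=> ab mh hK h0; have mD := @measurable_open R l r.
have mhs : measurable_fun I (h \o s).
  apply: (measurable_fun_I hI); apply: (measurable_comp measurableT) => //.
  exact: (measurable_scale hs).
set A := [set z | (a < s z <= b)%R].
have AE : A = s @^-1` `]a, b]%classic by apply/seteqP; split => z /=; rewrite in_itv.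
have mDA : measurable (D `&` A) by rewrite AE; apply: (measurable_scale hs).
have bd : (\int[ds]_(x in I) (((h \o s) x) ^+ 2)%:E <= (K ^+ 2 * (b - a))%:E)%E.
  apply: (@le_trans _ _ (\int[ds]_(x in D `&` A) cst (K ^+ 2)%:E x)%E); last first.
    rewrite integral_cst// [in leRHS]EFinM; apply: lee_wpmul2l; first by rewrite lee_fin sqr_ge0.
    exact: (scale_measure_level le_e lt_er hs hds).
  have DAI : D `&` A `<=` I by apply: subset_trans (open_sub_I hI); exact: subIsetl.
  rewrite -[X in (_ <= \int[ds]_(x in X) _)%E](setIidr DAI) integral_mkcondr.
  apply: ge0_ae_le_integral_nomeas.
  - by move=> x _; rewrite lee_fin sqr_ge0.
  - by move=> x _; rewrite /patch; case: ifP => // _; rewrite lee_fin sqr_ge0.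
  apply: (ae_open hds); apply: nearW => x Dx.
  rewrite /patch /=; case: ifPn => [_|/negP nA].
    rewrite lee_fin -[leLHS]real_normK ?num_real//.
    by have := hK (s x); have := normr_ge0 (h (s x)); nra.
  rewrite h0 ?expr0n// => sx; apply: nA; rewrite inE; split => //.
have L2h : L2 (h \o s) by split => //; apply: le_lt_trans bd _; exact: ltry.
by split => //; rewrite -lee_fin (inner_product_EFin mI L2h).
Qed.

Lemma extended_domain_limit u (f_ q_ : nat -> \bar R -> R) q :
  (forall n, domain (f_ n)) -> (forall n, ae_eq ds I (derivative (f_ n)) (q_ n)) ->
  (forall n, L2 (q_ n)) -> L2 q -> cvgL2 ds I q_ q ->
  {ae m, forall x, I x -> f_ n x @[n --> \oo] --> u x} ->
  extended_domain l r I m s ds e u.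
Proof.
move=> hf fq hq_ hq qq fu; exists f_; split => // eps eps0.
have eps4 : 0 < eps / 4 by rewrite divr_gt0.
have /cvgr0Pnorm_lt/(_ _ eps4)[N _ hN] := qq.
exists N => n k Nn Nk.
have hac i : scale_abs_continuous l r I s (f_ i) by case: (hf i).
rewrite (dirichlet_formB hI le_e lt_er hs hds)//.
rewrite (_ : <<_, _>> = <<fun x => q_ n x - q_ k x, fun x => q_ n x - q_ k x>>); last first.
  apply: inner_product_ae; apply: filterS2 (fq n) (fq k) => x h1 h2 Ix.
  by rewrite h1// h2.
have := inner_product_sub_le mI (hq_ n) hq (hq_ k).
have -> : <<fun x => q x - q_ k x, fun x => q x - q_ k x>> =
    <<fun x => q_ k x - q x, fun x => q_ k x - q x>>.
  by apply: eq_Rintegral => x _; ring.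
have := hN n Nn; have := hN k Nk; rewrite /= !ger0_norm ?inner_product_ge0//; lra.
Qed.

Lemma domain_extended f : domain f -> extended_domain l r I m s ds e f.
Proof.
move=> hf; have [hL _] := domain_density hI le_e lt_er hs hds hf.
apply: (@extended_domain_limit f (fun=> f) (fun=> derivative f) (derivative f)) => //.
- by move=> _; exact: ae_eq_refl.
- exact: (cvgL2_cst _ hI).
- by apply: nearW => x _; exact: cvg_cst.
Qed.

Lemma L2_zero : L2 (cst 0).
Proof.
split; first exact: measurable_cst.
rewrite (_ : (fun x => _) = cst 0%E) ?integral0 ?ltry//.
by apply/funext => x /=; rewrite expr0n.
Qed.

Lemma domain_zero : domain (cst 0) /\ ae_eq ds I (derivative (cst 0)) (cst 0).
Proof.
have := @domain_of_factor (cst 0) (fun t => 0 * t + 0) (cst 0) 0.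
apply.
- exact: lipschitz_primitive_affine.
- by move=> x _ _ /=; rewrite mul0r addr0.
- by move=> x _ /=; rewrite normr0.
- by move=> j _ _; exact: nearW.
- exact: L2_zero.
Qed.

Lemma capacity0 : capacity l r I m s ds e set0 = 0%E.
Proof.
have if0 f : 0 <= \int[m]_(x in I) (f x ^+ 2).
  by apply: Rintegral_ge0 => x _; exact: sqr_ge0.
have e0 f : 0 <= energy1 l r I m s ds f.
  by rewrite /energy1 dirichlet_formE addr_ge0// mulr_ge0// ?invr_ge0// inner_product_ge0.
apply/eqP; rewrite eq_le; apply/andP; split; last first.
  apply: le_ereal_inf_tmp => _ [U _ <-].
  by apply: le_ereal_inf_tmp => _ [f _ <-]; rewrite lee_fin.
have [hz dz] := domain_zero.
apply: (@le_trans _ _ (capacity_open l r I m s ds e set0)).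
  by apply: ereal_inf_lbound; exists set0 => //; split => //; exact: open0.
apply: ereal_inf_lbound; exists (cst 0).
  by split => //; apply: nearW => x [].
congr EFin; rewrite /energy1 dirichlet_formE (inner_product_ae dz).
rewrite /inner_product !(@eq_Rintegral _ _ _ _ _ (cst 0)) /=.
- by rewrite !Rintegral_cst// !mul0r mulr0 addr0.
- by move=> x _; rewrite expr0n.
- by move=> x _; rewrite mulr0.
Qed.

(** * Constants and affine functions in the extended space *)

Lemma near_scale_left a : (sv l < a%:E)%E -> \forall x \near inner l r l, s x < a.
Proof.
move=> la; have h := scale_cvg_value le_e lt_er hs (or_introl erefl : is_end l r l).
have n1 : nbhs (sv l) [set y | (y < a%:E)%E] by exact: open_ereal_lt'.
have H : \forall x \near inner l r l, ((s x)%:E < a%:E)%E by exact: (h _ n1).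
by apply: filterS H => x; rewrite lte_fin.
Qed.

Lemma near_scale_right a : (a%:E < sv r)%E -> \forall x \near inner l r r, a < s x.
Proof.
move=> la; have h := scale_cvg_value le_e lt_er hs (or_intror erefl : is_end l r r).
have n1 : nbhs (sv r) [set y | (a%:E < y)%E] by exact: open_ereal_gt'.
have H : \forall x \near inner l r r, (a%:E < (s x)%:E)%E by exact: (h _ n1).
by apply: filterS H => x; rewrite lte_fin.
Qed.

Lemma lipschitz_primitive_bounded (g h : R -> R) a b : lipschitz_primitive g h ->
  exists M : R, 0 <= M /\ forall t, a <= t <= b -> `|g t| <= M.
Proof.
move=> [K [M [_ gM _ _ _]]]; exists (`|g a| + `|M| * `|b - a|); split.
  by rewrite addr_ge0// mulr_ge0.
move=> t /andP[at_ tb]; rewrite -[g t](subrK (g a)) addrC.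
apply: le_trans (ler_normD _ _) _; apply: lerD => //; apply: le_trans (gM _ _) _.
apply: (@le_trans _ _ (`|M| * `|t - a|)).
  by apply: ler_wpM2r => //; exact: ler_norm.
by apply: ler_wpM2l => //; rewrite !ger0_norm; lra.
Qed.

(** The slopes differ from [c] by at most [K n] on a set of scale length at most
   [b n - a n], hence tend to [c] in the quadratic mean. *)
Lemma extended_domain_of_factors u (g_ h_ : nat -> R -> R) (c : R) (K a b : nat -> R) :
  L2 (cst c) -> (forall n, lipschitz_primitive (g_ n) (h_ n)) ->
  (forall n, exists M : R, forall x, I x -> `|g_ n (fine (sv x))| <= M) ->
  (forall n, vanishes_at_omitted_ends (fun x => g_ n (fine (sv x)))) ->
  (forall n, a n <= b n) -> (forall n t, `|h_ n t - c| <= K n) ->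
  (forall n x, D x -> ~ (a n < s x <= b n) -> h_ n (s x) = c) ->
  K n ^+ 2 * (b n - a n) @[n --> \oo] --> (0 : R) ->
  (forall x, I x -> g_ n (fine (sv x)) @[n --> \oo] --> u x) -> extended u.
Proof.
move=> L2c gh gM g0 ab hK hc Kab gu.
have mh n : measurable_fun setT (h_ n) by case: (gh n) => [? [? []]].
have lev n : L2 ((fun t => h_ n t - c) \o s) /\
    <<(fun t => h_ n t - c) \o s, (fun t => h_ n t - c) \o s>> <= K n ^+ 2 * (b n - a n).
  apply: L2_level => //.
    by apply: measurable_funB => //; exact: measurable_cst.
  by move=> x Dx /hc ->//; rewrite subrr.
have L2h n : L2 (h_ n \o s).
  have := L2funD mI (lev n).1 L2c.
  by congr L2fun; apply/funext => x /=; rewrite subrK.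
have H n : dirichlet_domain l r I m s ds e (fun x => g_ n (fine (sv x))) /\
    ae_eq ds I (scale_derivative l r I s (fun x => g_ n (fine (sv x)))) (h_ n \o s).
  have [M hM] := gM n.
  exact: (domain_of_factor (gh n)) hM (g0 n) (L2h n).
apply: (extended_domain_limit (fun n => (H n).1) (fun n => (H n).2) L2h L2c).
  rewrite /cvgL2; apply: (squeeze_cvgr _ (cvg_cst 0) Kab); apply: nearW => n /=.
  by rewrite inner_product_ge0 /=; have [_] := lev n.
by apply: nearW => x; exact: gu.
Qed.

(** Cutoffs equal to [d] for [|t| <= N] and to 0 for [|t| >= 2N] have slopes [d / N]
   over a length of [2N], and so an energy of order [1 / N]. They vanish near an end
   of infinite scale; near an end of finite scale nothing is required, as that end
   belongs to the interval. *)
Lemma extended_domain_cst d : (forall j, is_end l r j -> sv j \is a fin_num -> I j) ->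
  extended (cst d).
Proof.
move=> finI.
pose N n : R := n.+1%:R; have N0 n : 0 < N n by rewrite ltr0n.
pose k n := d / N n.
pose g n t := 0 * t + 0 + k n * Num.max (t - - (2 * N n)) 0 + - k n * Num.max (t - - N n) 0 +
  - k n * Num.max (t - N n) 0 + k n * Num.max (t - 2 * N n) 0.
pose h n t := cst 0 t + k n * \1_`]- (2 * N n), +oo[ t + - k n * \1_`]- N n, +oo[ t +
  - k n * \1_`]N n, +oo[ t + k n * \1_`]2 * N n, +oo[ t.
have kN n : k n * N n = d by rewrite /k divfK// gt_eqF.
have gE n t : g n t = k n * (Num.max (t + 2 * N n) 0 - Num.max (t + N n) 0 -
    Num.max (t - N n) 0 + Num.max (t - 2 * N n) 0).
  by rewrite /g !opprK; ring.
have hE n t : h n t = k n * ((- (2 * N n) < t)%R%:R - (- N n < t)%R%:R - (N n < t)%R%:R + (2 * N n < t)%R%:R).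
  by rewrite /h !indicE !mem_setE !in_itv /= !andbT; ring.
have inner n t : - N n <= t <= N n -> g n t = d.
  move=> /andP[h1 h2]; have := N0 n => N0n; rewrite gE max_l; last lra.
  rewrite max_l; last lra.
  rewrite max_r; last lra.
  rewrite max_r; last lra.
  rewrite -[RHS](kN n); ring.
have outer n t : t <= - (2 * N n) \/ 2 * N n <= t -> g n t = 0.
  have := N0 n => N0n; rewrite gE => -[] ht.
    by rewrite !max_r; last (by lra); rewrite ?(subr0, addr0, mulr0)//; lra.
  rewrite !max_l; first ring; lra.
apply: (@extended_domain_of_factors _ g h 0 (fun n => `|k n|) (fun n => - (2 * N n)) (fun n => 2 * N n)).
- exact: L2_zero.
- move=> n; do 4 apply: (lipschitz_primitiveDZ _ _ (lipschitz_primitive_ramp _)).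
  exact: lipschitz_primitive_affine.
- move=> n; have [M [M0 hM]] : exists M : R, 0 <= M /\ forall t, - (2 * N n) <= t <= 2 * N n -> `|g n t| <= M.
    apply: (@lipschitz_primitive_bounded _ (h n)).
    do 4 apply: (lipschitz_primitiveDZ _ _ (lipschitz_primitive_ramp _)).
    exact: lipschitz_primitive_affine.
  exists M => x _; set t := fine _.
  have [h1|h1] := leP (- (2 * N n)) t; last by rewrite outer ?normr0//; left; exact: ltW.
  have [h2|h2] := leP t (2 * N n); last by rewrite outer ?normr0//; right; exact: ltW.
  by apply: hM; rewrite h1.
- move=> n j jend nIj.
  have nfin : ~ sv j \is a fin_num by move=> /(finI j jend).
  have inD := inner_open l r j; have IF := inner_filter l r j.
  case: jend => jE; subst j.
    have la : (sv l < (- (2 * N n))%:E)%E.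
      rewrite (@le_lt_trans _ _ -oo%E) ?ltNyr// leNgt -(scale_value_left_fin le_e lt_er hs).
      exact/negP.
    apply: filterS2 inD (near_scale_left la) => x Dx sx.
    by rewrite (scale_valueE hs Dx) /= outer//; left; exact: ltW.
  have ra : ((2 * N n)%:E < sv r)%E.
    rewrite (@lt_le_trans _ _ +oo%E) ?ltry// leNgt -(scale_value_right_fin le_e lt_er hs).
    exact/negP.
  apply: filterS2 inD (near_scale_right ra) => x Dx sx.
  by rewrite (scale_valueE hs Dx) /= outer//; right; exact: ltW.
- by move=> n; have := N0 n; lra.
- move=> n t; rewrite subr0 hE normrM ler_piMr//.
  have N0n := N0 n.
  case: (ltP (- (2 * N n)) t) => h1; case: (ltP (- N n) t) => h2; case: (ltP (N n) t) => h3;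
  case: (ltP (2 * N n) t) => h4; rewrite /= ?mulr1n ?mulr0n; try lra;
  rewrite ?(subrr, subr0, sub0r, addr0, add0r, normrN, normr1, normr0)//; try lra; by rewrite ler_norml; lra.
- move=> n x _ nx; rewrite hE; have N0n := N0 n.
  have [h1|h1] := leP (s x) (- (2 * N n)).
    have lF t : s x <= t -> (t < s x) = false by move=> ?; apply/negbTE; rewrite -leNgt.
    rewrite (lF (- N n)); last lra.
    rewrite (lF (N n)); last lra.
    by rewrite (lF (2 * N n)); [rewrite !subr0 addr0 mulr0|lra].
  have h2 : 2 * N n < s x by rewrite ltNge; apply/negP => h2; apply: nx; rewrite h1.
  have h3 : - N n < s x by lra.
  have h4 : N n < s x by lra.
  by rewrite h2 h3 h4 subrr sub0r addNr mulr0.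
- rewrite (_ : (fun n => _) = (fun n => 4 * d ^+ 2 * harmonic n)).
    rewrite -[0 in X in _ --> X](mulr0 (4 * d ^+ 2)).
    by apply: cvgM; [exact: cvg_cst|exact: cvg_harmonic].
  apply/funext => n; rewrite /harmonic /= real_normK ?num_real// /k -/(N n).
  by have := N0 n => /lt0r_neq0 Nn; field.
- move=> x _; set t := fine _.
  have ct : d @[_ --> \oo] --> (cst d x) by exact: cvg_cst.
  apply: cvg_trans ct; apply: near_eq_cvg; near=> n.
  apply/esym/inner; rewrite -ler_norml; apply/ltW.
  near: n; have [k0 hk0] : exists k : nat, `|t| < k%:R.
    by exists (Num.bound `|t|); exact: archi_boundP.
  exists k0 => // i /= ki; apply: lt_le_trans hk0 _; rewrite /N ler_nat.
  exact: leqW.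
Unshelve. all: by end_near. Qed.

Lemma scale_value_left_lt_right : (sv l < sv r)%E.
Proof.
have De := in_open_e le_e lt_er.
exact: lt_trans (scale_value_left_lt le_e lt_er hs De) (scale_value_right_gt le_e lt_er hs De).
Qed.

Lemma scale_value_bounds x : sv l \is a fin_num -> sv r \is a fin_num -> I x ->
  fine (sv l) <= fine (sv x) <= fine (sv r).
Proof.
move=> lfin rfin Ix; rewrite -!lee_fin !fineK//.
  have lr := ltW scale_value_left_lt_right.
  have [Dx|[->|->]] := in_I_cases hI Ix; rewrite ?lexx ?lr//.
  rewrite (scale_valueE hs Dx).
  apply/andP; split; apply/ltW; first exact: (scale_value_left_lt le_e lt_er hs Dx).
  exact: (scale_value_right_gt le_e lt_er hs Dx).
have [Dx|[->|->]] := in_I_cases hI Ix => //.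
by rewrite (scale_valueE hs Dx).
Qed.

(** Approximants have to vanish near an omitted end. The affine function has the
   value 0 there, so it can be flattened on a scale distance of [1 / (n + 1)] at the
   cost of an energy of that order. *)
Lemma extended_domain_affine c d : sv l \is a fin_num -> sv r \is a fin_num ->
  (forall j, is_end l r j -> ~ I j -> c * fine (sv j) + d = 0) ->
  extended (fun x => c * fine (sv x) + d).
Proof.
move=> lfin rfin cd0; pose A := fine (sv l); pose B := fine (sv r).
have AB : A < B by rewrite -lte_fin !fineK//; exact: scale_value_left_lt_right.
have sAB x : I x -> A <= fine (sv x) <= B by exact: scale_value_bounds.
have sD x : D x -> A < s x < B.
  move=> Dx; rewrite -!lte_fin !fineK//; apply/andP; split.
    exact: (scale_value_left_lt le_e lt_er hs Dx).
  exact: (scale_value_right_gt le_e lt_er hs Dx).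
have L2c : L2 (cst c) by apply: (L2_cst hI); exact: (scale_measure_total hI le_e lt_er hs hds).
have bdd (g h : R -> R) : lipschitz_primitive g h ->
    exists M : R, forall x, I x -> `|g (fine (sv x))| <= M.
  by move=> /(lipschitz_primitive_bounded A B)[M [_ hM]]; exists M => x /sAB /hM.
have delta n : 0 < harmonic n :> R by rewrite invr_gt0.
have lend : is_end l r l by left.
have rend : is_end l r r by right.
have cvgK (K : R) : K * harmonic n @[n --> \oo] --> (0 : R).
  rewrite -[0 in X in _ --> X](mulr0 K).
  by apply: cvgM; [exact: cvg_cst|exact: cvg_harmonic].
have cvgB (u_ : nat -> R) (u K : R) : (forall n, `|u_ n - u| <= K * harmonic n) ->
    u_ n @[n --> \oo] --> u.
  move=> hu; apply/subr_cvg0; apply/norm_cvg0P.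
  apply: (squeeze_cvgr _ (cvg_cst 0) (cvgK K)); apply: nearW => n /=.
  by rewrite normr_ge0 hu.
have [Il|nIl] := pselect (I l); have [Ir|nIr] := pselect (I r).
- have gh := lipschitz_primitive_affine c d.
  apply: (extended_domain_of_factors (g_ := fun=> _) (h_ := fun=> _)
    (K := cst 0) (a := cst 0) (b := cst 0) L2c (fun=> gh)).
  + by move=> _; exact: bdd gh.
  + by move=> _ j [->|->].
  + by [].
  + by move=> n t /=; rewrite subrr normr0.
  + by [].
  + by rewrite (_ : (fun n => _) = cst 0); [exact: cvg_cst|apply/funext => n /=; rewrite subrr mulr0].
  + by move=> x _; exact: cvg_cst.
- pose b n := B - harmonic n.
  pose g n t := c * t + - (c * b n) + - c * Num.max (t - b n) 0.
  pose h n t := cst c t + - c * \1_`]b n, +oo[ t.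
  have hE n t : h n t = c - c * (b n < t)%R%:R.
    by rewrite /h indicE mem_setE in_itv /= andbT mulNr.
  have gh n : lipschitz_primitive (g n) (h n).
    apply: (lipschitz_primitiveDZ _ _ (lipschitz_primitive_ramp _)).
    exact: lipschitz_primitive_affine.
  apply: (extended_domain_of_factors
    (K := cst `|c|) (a := b) (b := cst B) L2c gh).
  + by move=> n; exact: bdd (gh n).
  + move=> n j [->|->] // _.
    have br : ((b n)%:E < sv r)%E by rewrite -[ltRHS](fineK rfin) lte_fin -/B /b; have := delta n; lra.
    apply: filterS2 (inner_open l r r) (near_scale_right br) => x Dx sx.
    by rewrite (scale_valueE hs Dx) /= /g max_l; [ring|lra].
  + by move=> n /=; rewrite /b; have := delta n; lra.
  + move=> n t; rewrite hE /=; case: (_ < t)%R => /=.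
      by rewrite mulr1 subrr sub0r normrN.
    by rewrite mulr0 subr0 subrr normr0.
  + move=> n x /sD/andP[_ sB] nx; rewrite hE; case: ltP => bx /=; last by rewrite mulr0 subr0.
    by case: nx; rewrite bx ltW.
  + rewrite (_ : (fun n => _) = (fun n => c ^+ 2 * harmonic n)); first exact: cvgK.
    by apply/funext => n; rewrite /b /= real_normK ?num_real//; ring.
  + move=> x Ix; have := cd0 _ rend nIr; rewrite -/B => cB.
    have /andP[_] := sAB _ Ix; set t := fine (sv x) => tB.
    apply: (cvgB _ _ `|c|) => n.
    have -> : g n t - (c * t + d) = c * (B - b n - Num.max (t - b n) 0).
      by rewrite /g (_ : d = - (c * B)); [ring|lra].
    rewrite normrM; apply: ler_wpM2l => //; rewrite /b; have := delta n.
    by case: (leP (t - (B - harmonic n)) 0) => h1 h2; rewrite ger0_norm; lra.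
- pose a n := A + harmonic n.
  pose g n t := 0 * t + 0 + c * Num.max (t - a n) 0.
  pose h n t := cst 0 t + c * \1_`]a n, +oo[ t.
  have hE n t : h n t = c * (a n < t)%R%:R.
    by rewrite /h indicE mem_setE in_itv /= andbT add0r.
  have gh n : lipschitz_primitive (g n) (h n).
    apply: (lipschitz_primitiveDZ _ _ (lipschitz_primitive_ramp _)).
    exact: lipschitz_primitive_affine.
  apply: (extended_domain_of_factors
    (K := cst `|c|) (a := cst A) (b := a) L2c gh).
  + by move=> n; exact: bdd (gh n).
  + move=> n j [->|->] // _.
    have la : (sv l < (a n)%:E)%E by rewrite -[ltLHS](fineK lfin) lte_fin -/A /a; have := delta n; lra.
    apply: filterS2 (inner_open l r l) (near_scale_left la) => x Dx sx.
    by rewrite (scale_valueE hs Dx) /= /g max_r; [ring|lra].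
  + by move=> n /=; rewrite /a; have := delta n; lra.
  + move=> n t; rewrite hE /=; case: (_ < t)%R => /=.
      by rewrite mulr1 subrr normr0.
    by rewrite mulr0 sub0r normrN.
  + move=> n x /sD/andP[sA _] nx; rewrite hE; case: ltP => ax /=; first by rewrite mulr1.
    by case: nx; rewrite ax sA.
  + rewrite (_ : (fun n => _) = (fun n => c ^+ 2 * harmonic n)); first exact: cvgK.
    by apply/funext => n; rewrite /a /= real_normK ?num_real//; ring.
  + move=> x Ix; have := cd0 _ lend nIl; rewrite -/A => cA.
    have /andP[+ _] := sAB _ Ix; set t := fine (sv x) => At.
    apply: (cvgB _ _ `|c|) => n.
    have -> : g n t - (c * t + d) = - c * (t - A - Num.max (t - a n) 0).
      by rewrite /g (_ : d = - (c * A)); [ring|lra].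
    rewrite normrM normrN; apply: ler_wpM2l => //; rewrite /a; have := delta n.
    by case: (leP (t - (A + harmonic n)) 0) => h1 h2; rewrite ger0_norm; lra.
- have := cd0 _ lend nIl; have := cd0 _ rend nIr; rewrite -/A -/B => cB cA.
  have c0 : c = 0.
    have : c * (B - A) = 0 by rewrite mulrBr; lra.
    by move/eqP; rewrite mulf_eq0 subr_eq0 (gt_eqF AB) orbF => /eqP.
  have d0 : d = 0 by move: cA; rewrite c0 mul0r add0r.
  rewrite (_ : (fun x => _) = cst 0); last by apply/funext => x; rewrite c0 d0 mul0r addr0.
  exact: (domain_extended domain_zero.1).
Qed.

(** * Tents *)

(** [f] is its own continuous version, and the exceptional set is empty. *)
Lemma zero_qe_inside f : (forall x, D x -> f y @[y --> x] --> f x) ->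
  (forall x, ~ D x -> f x = 0) ->
  (forall j, is_end l r j -> \forall x \near inner l r j, f x = 0) ->
  zero_qe l r I m s ds e (I `\` D) f.
Proof.
move=> cf f0 fend; exists f; last first.
  rewrite (_ : _ `&` _ = set0); first exact: capacity0.
  by apply/seteqP; split => // x [[_ /f0 fx]] /=; rewrite fx eqxx.
split; last exact: ae_eq_refl.
apply/subspace_continuousP => x [Dx|[xend _]].
  by apply: cvg_within_filter; exact: cf.
have nDx := end_notin xend.
have c0 : (0 : R) @[y --> x] --> f x by rewrite (f0 _ nDx); exact: cvg_cst.
apply: cvg_within_filter; apply: cvg_trans c0; apply: near_eq_cvg.
have fx : \forall y \near x, D y -> f y = 0 := fend _ xend.
apply: filterS fx => y fy; have [Dy|nDy] := pselect (D y); apply/esym; [exact: fy Dy|exact: f0 nDy].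
Qed.

(** The tent with feet [a] and [c] and height 1 at [b], written as a combination of
   an affine function and ramps so that [tent_primitive] is immediate. *)
Definition tent a b c t := 0 * t + 0 + (b - a)^-1 * Num.max (t - a) 0 +
  - ((b - a)^-1 + (c - b)^-1) * Num.max (t - b) 0 + (c - b)^-1 * Num.max (t - c) 0.

Definition tent_slope a b c t := cst 0 t + (b - a)^-1 * \1_`]a, +oo[ t +
  - ((b - a)^-1 + (c - b)^-1) * \1_`]b, +oo[ t + (c - b)^-1 * \1_`]c, +oo[ t.

Lemma tent_primitive a b c : lipschitz_primitive (tent a b c) (tent_slope a b c).
Proof.
do 3 apply: (lipschitz_primitiveDZ _ _ (lipschitz_primitive_ramp _)).
exact: lipschitz_primitive_affine.
Qed.

Lemma tent_out a b c t : a < b -> b < c -> t <= a \/ c <= t -> tent a b c t = 0.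
Proof.
move=> ab bc; have ba0 : b - a != 0 by rewrite subr_eq0 gt_eqF.
have cb0 : c - b != 0 by rewrite subr_eq0 gt_eqF.
rewrite /tent => -[h|h].
  by rewrite !max_r ?mulr0 ?addr0 ?mul0r//; lra.
rewrite !max_l; try lra.
by field; rewrite ba0 cb0.
Qed.

Lemma tent_slopeE a b c t : a < b -> b < c ->
  tent_slope a b c t = (b - a)^-1 * \1_`]a, b] t - (c - b)^-1 * \1_`]b, c] t.
Proof.
move=> ab bc; rewrite /tent_slope !indicE !mem_setE !in_itv /= !andbT.
set k := (b - a)^-1; set k' := (c - b)^-1.
case: (ltP a t) => h1; case: (ltP b t) => h2; case: (ltP c t) => h3; rewrite /=; try ring; lra.
Qed.

(** The value 0 at the ends matters at an included end of infinite scale, where the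
   profile would be evaluated at a default value. *)
Definition scale_tent a b c x := if x \in D then tent a b c (s x) else 0.

Lemma scale_tent_domain a b c : (sv l < a%:E)%E -> a < b -> b < c -> (c%:E < sv r)%E ->
  extended_domain0 l r I m s ds e (scale_tent a b c) /\
  scale_density l r I ds (scale_tent a b c) (tent_slope a b c \o s).
Proof.
move=> la ab bc cr; have gh := tent_primitive a b c.
set f := scale_tent a b c.
have fend j : is_end l r j -> \forall x \near inner l r j, f x = 0.
  have inD := inner_open l r j; have IF := inner_filter l r j.
  case=> jE; subst j.
    apply: filterS2 inD (near_scale_left la) => x Dx sx.
    by rewrite /f /scale_tent mem_set// tent_out//; left; exact: ltW.
  apply: filterS2 inD (near_scale_right cr) => x Dx sx.
  by rewrite /f /scale_tent mem_set// tent_out//; right; exact: ltW.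
have f0 x : ~ D x -> f x = 0 by move=> nDx; rewrite /f /scale_tent memNset.
have fg x : I x -> sv x \is a fin_num -> f x = tent a b c (fine (sv x)).
  move=> Ix xfin; rewrite /f /scale_tent; case: ifPn => [/set_mem Dx|/negP nDx].
    by rewrite (scale_valueE hs Dx).
  have [Dx|[xl|xr]] := in_I_cases hI Ix; first by case: nDx; rewrite inE.
    rewrite tent_out//; left; rewrite -lee_fin fineK//.
    by rewrite xl; exact: ltW.
  rewrite tent_out//; right; rewrite -lee_fin fineK//.
  by rewrite xr; exact: ltW.
have [M [M0 hM]] := lipschitz_primitive_bounded a c gh.
have fM x : I x -> `|f x| <= M.
  move=> _; rewrite /f /scale_tent; case: ifP => _; last by rewrite normr0.
  have [h1|h1] := leP a (s x); last by rewrite tent_out ?normr0//; left; exact: ltW.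
  have [h2|h2] := leP (s x) c; last by rewrite tent_out ?normr0//; right; exact: ltW.
  by apply: hM; rewrite h1.
have [_ [K [_ _ _ mh hK]]] := gh.
have [L2h _] : L2 (tent_slope a b c \o s) /\
    <<tent_slope a b c \o s, tent_slope a b c \o s>> <= K ^+ 2 * (c - a).
  apply: L2_level => //; first lra.
  move=> x _ nx; rewrite tent_slopeE// !indicE !mem_setE !in_itv /=.
  have [h1|h1] := leP (s x) a.
    by rewrite (_ : (b < s x) = false) /= ?mulr0 ?subr0//; apply/negbTE; rewrite -leNgt; lra.
  have h2 : c < s x by rewrite ltNge; apply/negP => h2; apply: nx; rewrite h1.
  have h3 : (s x <= b) = false by apply/negbTE; rewrite -ltNge; lra.
  have h4 : (s x <= c) = false by apply/negbTE; rewrite -ltNge.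
  by rewrite h3 h4 !andbF !mulr0 subr0.
have vf : vanishes_at_omitted_ends f by move=> j jend _; exact: fend.
have [hf fh] := domain_of_factor gh fg fM vf L2h.
have fe := domain_extended hf.
have df := domain_density hI le_e lt_er hs hds hf.
split.
  split => //; apply: zero_qe_inside => // x Dx.
  exact: (factor_continuous (lipschitz_primitive_continuous gh) fg Dx).
split => // x y Dx Dy xy; rewrite -df.2// /Rintegral; congr fine.
have mxy := @measurable_itv_oc R x y.
have sI := itv_sub_I hI Dx Dy.
apply: ae_eq_integral => //.
- exact: measurable_int (L2_integrable_itv hI hds Dx Dy L2h).
- exact: measurable_int (L2_integrable_itv hI hds Dx Dy df.1).
by apply: filterS fh => z /= hz xz; rewrite hz//; exact: sI.
Qed.

(** * Harmonic functions *)

(** Testing against the tent over [x], [y], [z] equates the difference quotients of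
   [v] with respect to the scale on the two sides of [y]. *)
Lemma harmonic_collinear u v p x y z : harmonic_space l r I m s ds e u ->
  version u v p -> D x -> D y -> D z -> (x < y)%E -> (y < z)%E ->
  (v y - v x) * (s z - s y) = (v z - v y) * (s y - s x).
Proof.
move=> [hu hH] uvp Dx Dy Dz xy yz.
have sxy := scale_lt hs Dx Dy xy; have syz := scale_lt hs Dy Dz yz.
have [f0 fd] := scale_tent_domain
  (scale_value_left_lt le_e lt_er hs Dx) sxy syz (scale_value_right_gt le_e lt_er hs Dz).
have [w [q fwq]] := extended_versionP hI hm le_e lt_er hs hds f0.1.
have := hH _ f0; rewrite (extended_formE hI le_e lt_er hs hds hu f0.1 uvp fwq).
have ff : {ae m, forall i, I i -> D i ->
    scale_tent (s x) (s y) (s z) i = scale_tent (s x) (s y) (s z) i}.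
  exact: nearW.
have [_ qs] := extended_version_unique hI hm le_e lt_er hs hds fwq fd ff.
have vp : scale_density l r I ds v p by case: uvp.
have wq : scale_density l r I ds w q by case: fwq.
have L2xy : L2 (\1_`]x, y]).
  apply: (L2fun_indic mI); [exact: measurable_itv_oc|exact: (itv_sub_I hI)|exact: (scale_measure_fin hds)].
have L2yz : L2 (\1_`]y, z]).
  apply: (L2fun_indic mI); [exact: measurable_itv_oc|exact: (itv_sub_I hI)|exact: (scale_measure_fin hds)].
set k := (s y - s x)^-1; set k' := (s z - s y)^-1.
pose q' i := k * \1_`]x, y] i - k' * \1_`]y, z] i.
have L2k := L2funZ mI k L2xy; have L2k' := L2funZ mI k' L2yz.
have L2q' : L2 q' := L2funB mI L2k L2k'.
have qq' : ae_eq ds I q q'.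
  apply: ae_eq_trans qs _; apply: (ae_open hds); apply: nearW => i Di.
  rewrite /comp tent_slopeE// /q' !indicE !mem_setE !in_itv /=.
  by rewrite !(scale_lt_mono hs)// !(scale_le_mono hs).
rewrite inner_productC (inner_product_ael hI wq.1 L2q' vp.1 qq') /q'.
rewrite (inner_productBl mI L2k L2k' vp.1) (inner_productZl mI k L2xy vp.1) (inner_productZl mI k' L2yz vp.1).
rewrite !(inner_productC _ _ _ p) !inner_product_indic//; last 4 first.
- exact: measurable_itv_oc.
- exact: (itv_sub_I hI).
- exact: measurable_itv_oc.
- exact: (itv_sub_I hI).
rewrite !vp.2 ?(ltW xy) ?(ltW yz)// => /eqP; rewrite mulf_eq0 invr_eq0 pnatr_eq0 /= subr_eq0 => /eqP h.
have h1 : s y - s x != 0 by rewrite subr_eq0 gt_eqF.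
have h2 : s z - s y != 0 by rewrite subr_eq0 gt_eqF.
have := congr1 (fun t => (s y - s x) * (s z - s y) * t) h.
rewrite /k /k' (_ : _ * _ * (_ * (v y - v x)) = (v y - v x) * (s z - s y)); last by field.
by move=> ->; field.
Qed.

Lemma harmonic_affine_inside u v p : harmonic_space l r I m s ds e u -> version u v p ->
  exists c d, forall x, D x -> v x = c * s x + d.
Proof.
move=> hu uvp; have col := harmonic_collinear hu uvp.
have D0 := in_open_e le_e lt_er.
have [k ek kr] := ereal_between lt_er; set y := k%:E in ek kr.
have Dy : D y by apply/in_openP; split => //; exact: lt_trans ek.
have sey := scale_lt hs D0 Dy ek; have sey0 : s y - s e != 0 by rewrite subr_eq0 gt_eqF.
exists ((v y - v e) / (s y - s e)), (v e - (v y - v e) / (s y - s e) * s e) => x Dx.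
suff H : (v x - v e) * (s y - s e) = (v y - v e) * (s x - s e).
  apply: (mulIf sey0).
  rewrite (_ : (_ / _ * _ + _) * _ = (v y - v e) * s x + v e * (s y - s e) - (v y - v e) * s e); first lra.
  by field.
case: (ltgtP x e) => [xe|ex|->]; last by rewrite !subrr mul0r mulr0.
  by have := col x e y Dx D0 Dy xe ek; lra.
case: (ltgtP x y) => [xy|yx|->//].
  by have := col e x y D0 Dx Dy ex xy; lra.
by have := col e y x D0 Dy Dx ek yx; lra.
Qed.

(** The scale range contains the scale value of such an end, and the factor is
   absolutely continuous, hence continuous, up to it. *)
Lemma domain_end_value f j : domain f -> is_end l r j -> I j -> sv j \is a fin_num ->
  f y @[y --> inner l r j] --> f j.
Proof.
move=> [_ [g [gac fg]] _ _] jend Ij jfin; have IF := inner_filter l r j.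
have De := in_open_e le_e lt_er; have inD := inner_open l r j.
have sj := scale_cvg_end le_e lt_er hs jend jfin.
set S := fine (sv j) in sj *.
have near_between t x : D x -> Num.min S (s x) < t < Num.max S (s x) ->
    exists z, D z /\ s z = t.
  move=> Dx /andP[h1 h2].
  have PF := inner_proper le_e lt_er jend.
  case: (jend) => jE; subst j.
    have Sx : S < s x.
      by rewrite -lte_fin fineK//; exact: (scale_value_left_lt le_e lt_er hs Dx).
    move: h1 h2; rewrite min_l ?max_r ?(ltW Sx)// => h1 h2.
    have lt_ : (sv l < t%:E)%E by rewrite -[X in (X < _)%E](fineK jfin) lte_fin.
    have h3 := near_scale_left lt_.
    have [y [Dy yt]] := filter_ex (filterI inD h3).
    have yx : (y <= x)%E by rewrite -(scale_le_mono hs)//; lra.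
    have [|z [Dz _ _ <-]] := scale_IVT hs (t := t) Dy Dx yx; first lra.
    by exists z.
  have Sx : s x < S.
    by rewrite -lte_fin fineK//; exact: (scale_value_right_gt le_e lt_er hs Dx).
  move: h1 h2; rewrite min_r ?max_l ?(ltW Sx)// => h1 h2.
  have lt_ : (t%:E < sv r)%E by rewrite -[X in (_ < X)%E](fineK jfin) lte_fin.
  have h3 := near_scale_right lt_.
  have [y [Dy yt]] := filter_ex (filterI inD h3).
  have yx : (x <= y)%E by rewrite -(scale_le_mono hs)//; lra.
  have [|z [Dz _ _ <-]] := scale_IVT hs (t := t) Dx Dy yx; first lra.
  by exists z.
pose lo := Num.min S (s e); pose hi := Num.max S (s e).
have lohi : lo <= hi by rewrite /lo /hi le_max ge_min lexx.
have rangeS : scale_range l r I s S by exists j.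
have rangeD x : D x -> scale_range l r I s (s x).
  move=> Dx; exists x; last by rewrite (scale_valueE hs Dx).
  by split; [exact: (open_sub_I hI)|rewrite (scale_valueE hs Dx)].
have sub : `[lo, hi]%classic `<=` scale_range l r I s.
  move=> t; rewrite /= in_itv /= => /andP[].
  rewrite le_eqVlt => /predU1P[<- _|lt1].
    by rewrite /lo; case: leP => _; [exact: rangeS|exact: (rangeD _ De)].
  rewrite le_eqVlt => /predU1P[->|lt2].
    by rewrite /hi; case: leP => _; [exact: (rangeD _ De)|exact: rangeS].
  have [|z [Dz <-]] := near_between t e De; first by rewrite lt1.
  exact: rangeD.
have fS : f j = g S by rewrite fg.
have fD x : D x -> f x = g (s x).
  by move=> Dx; rewrite (fg _ (open_sub_I hI Dx)) (scale_valueE hs Dx).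
apply/cvgrPdist_lt => eps eps0.
have [del del0 hdel] := gac lo hi lohi sub eps eps0.
have := inner_tail le_e lt_er jend De.
have /cvgrPdist_lt/(_ _ del0) := sj.
apply: filterS2 => x sx [Dx xr xl].
have lohi_x : lo <= Num.min S (s x) /\ Num.max S (s x) <= hi.
  rewrite /lo /hi; case: (jend) => jE; subst j.
    have := scale_lt hs Dx De (xl erefl).
    have : S < s x by rewrite -lte_fin fineK//; exact: (scale_value_left_lt le_e lt_er hs Dx).
    by move=> h1 h2; rewrite !min_l ?max_r ?max_r; lra.
  have := scale_lt hs De Dx (xr erefl).
  have : s x < S by rewrite -lte_fin fineK//; exact: (scale_value_right_gt le_e lt_er hs Dx).
  by move=> h1 h2; rewrite !min_r ?max_l ?max_l; lra.
have := hdel 1%N (fun=> Num.min S (s x)) (fun=> Num.max S (s x)).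
rewrite !big_ord1 fS fD//; case: lohi_x => h1 h2 h.
have : `|g (Num.max S (s x)) - g (Num.min S (s x))| < eps.
  apply: h.
  - by move=> _; split => //; rewrite le_max ge_min lexx.
  - by move=> i k; rewrite !ord1.
  - have := ler_norm (S - s x); have := ler_norm (s x - S); rewrite (distrC (s x)).
    by move: sx; case: (leP S (s x)); lra.
by case: (leP S (s x)) => _ //; rewrite distrC.
Qed.

(** The end-point values of an approximating sequence are limits from inside, at a
   rate uniform along the sequence, so the two limits can be exchanged. This
   settles the value of [u] at an end that carries mass. *)
Lemma extended_version_end u v p : extended u -> version u v p ->
  {ae m, forall x, I x -> is_end l r x -> sv x \is a fin_num ->
    v y @[y --> inner l r x] --> u x}.
Proof.
move=> [f_ hf] uvp.
have [w [q [wq qq fw w0]]] := approximating_limit hI hm le_e lt_er hs hds hf.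
have uw := approximating_ae hf fw.
have [vw _] := extended_version_unique hI hm le_e lt_er hs hds uvp wq uw.
have [hf1 _ hu] := hf; apply: filterS hu => x hx Ix xend xfin.
have PF := inner_proper le_e lt_er xend.
suff : v y - u x @[y --> inner l r x] --> (0 : R).
  move=> h; have c : v y - u x + u x @[y --> inner l r x] --> 0 + u x.
    by apply: cvgD => //; exact: cvg_cst.
  rewrite add0r in c; apply: cvg_trans c; apply: near_eq_cvg.
  by apply: nearW => y /=; rewrite subrK.
apply: (scale_bound_cvg0 le_e lt_er hs (C := <<q, q>>) xend xfin) => y Dy.
have c1 : (f_ n y - f_ n x) ^+ 2 @[n --> \oo] --> (v y - u x) ^+ 2.
  have h : f_ n y - f_ n x @[n --> \oo] --> v y - u x.
    by apply: cvgB; [rewrite vw//; exact: fw|exact: hx].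
  by rewrite expr2; under eq_fun do rewrite expr2; exact: (cvgM h h).
pose p_ n := derivative (f_ n).
have L2p n : L2 (p_ n) by exact: (domain_density hI le_e lt_er hs hds (hf1 n)).1.
have c2 : <<p_ n, p_ n>> * `|s y - fine (sv x)| @[n --> \oo] --> <<q, q>> * `|s y - fine (sv x)|.
  apply: cvgM; last exact: cvg_cst.
  exact: (cvgL2_inner_product mI L2p wq.1 L2p wq.1 qq qq).
apply: (ler_cvg_to c1 c2); apply: nearW => n.
have [a ha hb] := scale_holder_end le_e lt_er hs (domain_holder hI le_e lt_er hs hds (hf1 n)) xend xfin.
have := hb y Dy; rewrite (_ : a = f_ n x)//.
by apply: (cvg_unique _ ha) => //; exact: domain_end_value.
Qed.

Hypothesis charged_fin : forall j, j = l \/ j = r -> I j -> (0 < m [set j])%E ->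
  scale_value l r s j \is a fin_num.

(** An included end of infinite scale carries no mass, by the choice of the scale. *)
Lemma ae_end_finite : {ae m, forall x, I x -> is_end l r x -> sv x \is a fin_num}.
Proof.
have H j : is_end l r j -> {ae m, forall x, x = j -> I j -> sv j \is a fin_num}.
  move=> jend; have [h|/not_implyP[Ij nfin]] := pselect (I j -> sv j \is a fin_num).
    by apply: nearW => x _.
  exists [set j]; split; [exact: emeasurable_set1| |by move=> x /= /not_implyP[]].
  apply/eqP; rewrite eq_le measure_ge0 andbT leNgt; apply/negP => mj.
  by apply: nfin; exact: charged_fin.
have lend : is_end l r l by left.
have rend : is_end l r r by right.
apply: filterS2 (H _ lend) (H _ rend) => x hl hr Ix [xl|xr].
  by rewrite xl; apply: hl => //; rewrite -xl.
by rewrite xr; apply: hr => //; rewrite -xr.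
Qed.

(** Collinearity makes [u] affine inside, and [extended_version_end] extends this to
   the ends that carry mass. The Hoelder bound excludes a nonzero slope on an
   infinite scale, and the boundary conditions pass to the limit. Conversely, the
   conditions on [c] and [d] are those that the approximation lemmas require. *)
Lemma harmonic_spaceP u : harmonic_space l r I m s ds e u <->
  exists c d, [/\ ae_eq m I u (fun x => c * fine (sv x) + d),
    c = 0 \/ (sv l \is a fin_num /\ sv r \is a fin_num) &
    forall j, is_end l r j -> sv j \is a fin_num -> ~ I j -> c * fine (sv j) + d = 0].
Proof.
split => [hu|[c [d [ucd hc cd0]]]].
  have [v [p uvp]] := extended_versionP hI hm le_e lt_er hs hds hu.1.
  have [c [d vcd]] := harmonic_affine_inside hu uvp.
  have [vp uv v0 _] := uvp.
  have vlim j : is_end l r j -> sv j \is a fin_num ->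
      v y @[y --> inner l r j] --> c * fine (sv j) + d.
    move=> jend jfin; have IF := inner_filter l r j.
    have h : c * s y + d @[y --> inner l r j] --> c * fine (sv j) + d.
      apply: cvgD; last exact: cvg_cst.
      by apply: cvgM; [exact: cvg_cst|exact: (scale_cvg_end le_e lt_er hs)].
    apply: cvg_trans h; apply: near_eq_cvg.
    by apply: filterS (inner_open l r j) => y Dy; rewrite vcd.
  exists c, d; split.
  - have uend := extended_version_end hu.1 uvp.
    apply: filterS3 uv uend ae_end_finite => x h1 h2 h3 Ix.
    have [Dx|xend] := in_I_cases hI Ix.
      by rewrite h1// vcd// (scale_valueE hs Dx).
    have PF := inner_proper le_e lt_er xend.
    have xfin := h3 Ix xend.
    by apply: (cvg_unique _ (h2 Ix xend xfin)) => //; exact: vlim.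
  - have [c0|c0] := eqVneq c 0; [by left|right].
    have c20 : 0 < c ^+ 2 by rewrite exprn_even_gt0.
    (* The square of the increment of [v] is at most linear in that of the scale. *)
    have bd x y : D x -> D y -> `|s y - s x| <= <<p, p>> / c ^+ 2.
      move=> Dx Dy; rewrite ler_pdivlMr//.
      have := scale_density_holder hI hs hds vp Dx Dy; rewrite !vcd//.
      have -> : c * s y + d - (c * s x + d) = c * (s y - s x) by ring.
      rewrite exprMn -[(s y - s x) ^+ 2]real_normK ?num_real//.
      have := normr_ge0 (s y - s x); set t := `|_|; rewrite le_eqVlt => /predU1P[<- _|t0 h].
        by rewrite mul0r inner_product_ge0.
      by rewrite -(ler_pM2r t0) -mulrA mulrC -mulrA -expr2 mulrC [t ^+ 2 * _]mulrC.
    have De := in_open_e le_e lt_er.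
    have se : s e = 0 by case: hs.
    set C := <<p, p>> / c ^+ 2 in bd.
    have bde x : D x -> `|s x| <= C by move=> Dx; rewrite -[s x]subr0 -se; exact: bd.
    rewrite (scale_value_left_fin le_e lt_er hs) (scale_value_right_fin le_e lt_er hs).
    split; rewrite ltNge; apply/negP => h.
      have la : (sv l < (- C)%:E)%E by apply: le_lt_trans h _; exact: ltNyr.
      have PF := inner_proper le_e lt_er (or_introl erefl : is_end l r l).
      have [x [Dx sx]] := filter_ex (filterI (inner_open l r l) (near_scale_left la)).
      by have := bde _ Dx; rewrite ler_norml; lra.
    have ra : (C%:E < sv r)%E by apply: lt_le_trans h; exact: ltry.
    have PF := inner_proper le_e lt_er (or_intror erefl : is_end l r r).
    have [x [Dx sx]] := filter_ex (filterI (inner_open l r r) (near_scale_right ra)).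
    by have := bde _ Dx; rewrite ler_norml; lra.
  - move=> j jend jfin nIj; have PF := inner_proper le_e lt_er jend.
    by apply: (cvg_unique _ (vlim j jend jfin)) => //; exact: v0.
have hu : extended u.
  apply: (extended_domain_ae (u := fun x => c * fine (sv x) + d)).
    by apply: filterS ucd => x /[apply].
  have [[lfin rfin]|nfin] := pselect (sv l \is a fin_num /\ sv r \is a fin_num).
    apply: (extended_domain_affine lfin rfin) => j jend.
    by apply: cd0 => //; case: jend => ->.
  have c0 : c = 0 by case: hc.
  rewrite (_ : (fun x => _) = cst d); last by apply/funext => x; rewrite c0 mul0r add0r.
  have [d0|d0] := eqVneq d 0.
    rewrite d0; exact: (domain_extended domain_zero.1).
  apply: extended_domain_cst => j jend jfin.
  apply: contrapT => nIj; move/eqP: d0; apply.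
  by have := cd0 j jend jfin nIj; rewrite c0 mul0r add0r.
apply: (affine_harmonic hI hm le_e lt_er hs hds (c := c) (d := d)) => //.
by apply: filterS ucd => x h Ix Dx; rewrite h// (scale_valueE hs Dx).
Qed.

End harmonic_functions.

Theorem theorem3p4 (R : realType) (l r : \bar R) (I : set (\bar R))
    (hI : interval_with_endpoints l r I)
    (m : {measure set (\bar R) -> \bar R}) (hm : radon_full_support I m)
    (e : \bar R) (le_e : (l < e)%E) (lt_er : (e < r)%E) (hme : m [set e] = 0%E)
    (s : \bar R -> R) (hs : scale_tilde l r I e m s)
    (ds : {measure set (\bar R) -> \bar R}) (hds : is_scale_measure l r s ds) :
  let Ie := effective_interval l r I m ds e in
  let sl := scale_value l r s l in
  let sr := scale_value l r s r in
  let H := harmonic_space l r I m s ds e in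
  let ul := harmonic_left l r s in
  let ur := harmonic_right l r s in
  let one : \bar R -> R := cst 1 in
  [/\ (Ie = `]l, r[%classic ->
         ((-oo < sl)%E \/ (sr < +oo)%E -> H = [set u | ae_eq m I u (cst 0)]) /\
         (~ ((-oo < sl)%E \/ (sr < +oo)%E) -> H = span1 I m one)),
      (Ie = `[l, r[%classic ->
         ((sr < +oo)%E -> H = span1 I m ul) /\
         (~ (sr < +oo)%E -> H = span1 I m one)),
      (Ie = `]l, r]%classic ->
         ((-oo < sl)%E -> H = span1 I m ur) /\
         (~ (-oo < sl)%E -> H = span1 I m one))
    & (Ie = `[l, r]%classic -> H = span2 I m ul ur)].
Proof.
move=> Ie sl sr H ul ur one; case: hs => hsc charged.
have HP := harmonic_spaceP hI hm le_e lt_er hsc hds charged.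
have lr : (l < r)%E := lt_trans le_e lt_er.
have lend : is_end l r l by left.
have rend : is_end l r r by right.
have finIe j : is_end l r j -> I j -> scale_value l r s j \is a fin_num -> Ie j.
  exact: (in_effective hI hm le_e lt_er hsc hds).
have Iefin j : is_end l r j -> Ie j -> I j /\ scale_value l r s j \is a fin_num.
  move=> jend [/(end_notin jend)//|[_ jrefl]].
  exact/(reflectingP hI hm le_e lt_er hsc hds jend).
have lE := scale_value_left_fin le_e lt_er hsc.
have rE := scale_value_right_fin le_e lt_er hsc.
rewrite -/sl in lE; rewrite -/sr in rE; rewrite -lE -rE.
have slr : sl \is a fin_num -> sr \is a fin_num -> fine sr - fine sl != 0.
  move=> lfin rfin; rewrite subr_eq0 gt_eqF// -lte_fin !fineK//.
  exact: (scale_value_left_lt_right le_e lt_er hsc).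
have aeE (u v w : \bar R -> R) : ae_eq m I u v -> (forall x, v x = w x) -> ae_eq m I u w.
  by move=> uv vw; apply: filterS uv => x /[apply] ->.
(* Without omitted ends of finite scale, and on an infinite scale, there remain
   the constants. *)
have cstP : ~ (sl \is a fin_num /\ sr \is a fin_num) ->
    (forall j, is_end l r j -> scale_value l r s j \is a fin_num -> I j) ->
    H = span1 I m one.
  move=> nfin finI; apply/seteqP; split => u.
    move=> /HP[c [d [ucd [c0|//] _]]]; exists d.
    by apply: (aeE _ _ _ ucd) => x; rewrite c0 mul0r add0r mulr1.
  move=> [d ud]; apply/HP; exists 0, d; split; [|by left|by move=> j je jf; have := finI j je jf].
  by apply: (aeE _ _ _ ud) => x; rewrite mul0r add0r mulr1.
split=> IeE.
- have nIl : sl \is a fin_num -> ~ I l.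
    by move=> lfin Il; apply: (end_notin lend); rewrite -IeE; exact: finIe.
  have nIr : sr \is a fin_num -> ~ I r.
    by move=> rfin Ir; apply: (end_notin rend); rewrite -IeE; exact: finIe.
  split => [fin|/not_orP[nl nr]]; last first.
    by apply: cstP => [[]//|j [->|->] jf].
  apply/seteqP; split => u.
    move=> /HP[c [d [ucd hc cd0]]].
    have [c0 d0] : c = 0 /\ d = 0.
      case: hc => [c0|[lfin rfin]].
        split => //; case: fin => [lfin|rfin].
          by have := cd0 l lend lfin (nIl lfin); rewrite c0 mul0r add0r.
        by have := cd0 r rend rfin (nIr rfin); rewrite c0 mul0r add0r.
      have h1 := cd0 l lend lfin (nIl lfin); have h2 := cd0 r rend rfin (nIr rfin).
      have c0 : c = 0.
        apply: (mulIf (slr lfin rfin)); rewrite mul0r mulrBr; move: h1 h2.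
        by rewrite -/sl -/sr; lra.
      by split => //; move: h1; rewrite c0 mul0r add0r.
    by apply: (aeE _ _ _ ucd) => x; rewrite c0 d0 mul0r addr0.
  move=> u0; apply/HP; exists 0, 0; split; [|by left|by move=> *; rewrite mul0r addr0].
  by apply: (aeE _ _ _ u0) => x; rewrite mul0r addr0.
- have [Il lfin] : I l /\ sl \is a fin_num.
    by apply: Iefin => //; rewrite IeE /= in_itv /= lexx.
  have nIr : sr \is a fin_num -> ~ I r.
    move=> rfin Ir; have := finIe _ rend Ir rfin.
    by rewrite IeE /= in_itv /= ltxx andbF.
  split => [rfin|nrfin]; last by apply: cstP => [[]//|j [->|->] // /nrfin].
  have nz := slr lfin rfin.
  apply/seteqP; split => u.
    move=> /HP[c [d [ucd _ cd0]]]; have := cd0 r rend rfin (nIr rfin).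
    rewrite -/sr => h; exists (- c * (fine sr - fine sl)); apply: (aeE _ _ _ ucd) => x.
    have -> : d = - (c * fine sr) by lra.
    by rewrite /ul /harmonic_left -/sl -/sr; field.
  move=> [k uk]; apply/HP.
  exists (- k / (fine sr - fine sl)), (k * fine sr / (fine sr - fine sl)); split.
  + by apply: (aeE _ _ _ uk) => x; rewrite /ul /harmonic_left -/sl -/sr; field.
  + by right.
  + by move=> j [->|->] // _ _; rewrite -/sr; field.
- have [Ir rfin] : I r /\ sr \is a fin_num.
    by apply: Iefin => //; rewrite IeE /= in_itv /= lexx andbT.
  have nIl : sl \is a fin_num -> ~ I l.
    move=> lfin Il; have := finIe _ lend Il lfin.
    by rewrite IeE /= in_itv /= ltxx.
  split => [lfin|nlfin]; last by apply: cstP => [[]//|j [->|->] // /nlfin].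
  have nz := slr lfin rfin.
  apply/seteqP; split => u.
    move=> /HP[c [d [ucd _ cd0]]]; have := cd0 l lend lfin (nIl lfin).
    rewrite -/sl => h; exists (c * (fine sr - fine sl)); apply: (aeE _ _ _ ucd) => x.
    have -> : d = - (c * fine sl) by lra.
    by rewrite /ur /harmonic_right -/sl -/sr; field.
  move=> [k uk]; apply/HP.
  exists (k / (fine sr - fine sl)), (- k * fine sl / (fine sr - fine sl)); split.
  + by apply: (aeE _ _ _ uk) => x; rewrite /ur /harmonic_right -/sl -/sr; field.
  + by right.
  + by move=> j [->|->] // _ _; rewrite -/sl; field.
- have [Il lfin] : I l /\ sl \is a fin_num.
    by apply: Iefin => //; rewrite IeE /= in_itv /= lexx ltW.
  have [Ir rfin] : I r /\ sr \is a fin_num.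
    by apply: Iefin => //; rewrite IeE /= in_itv /= lexx andbT ltW.
  have nz := slr lfin rfin.
  apply/seteqP; split => u.
    move=> /HP[c [d [ucd _ _]]].
    exists (c * fine sl + d), (c * fine sr + d); apply: (aeE _ _ _ ucd) => x.
    by rewrite /ul /ur /harmonic_left /harmonic_right -/sl -/sr; field.
  move=> [a [b uab]]; apply/HP.
  exists ((b - a) / (fine sr - fine sl)), ((a * fine sr - b * fine sl) / (fine sr - fine sl)); split.
  + apply: (aeE _ _ _ uab) => x.
    by rewrite /ul /ur /harmonic_left /harmonic_right -/sl -/sr; field.
  + by right.
  + by move=> j [->|->].
Qed.
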